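(* Let $(M,g)$ be an $n$-dimensional Riemannian spin manifold ($n\ge 2$) admitting a Ricci Killing spinor $\psi$ with constant $\mu\in\mathbb{R}\setminus\{0\}$. Then the scalar curvature $\mathrm{Scal}$ is constant. If $\mathrm{Scal}=0$, then $(M,g)$ is Ricci-flat and $\psi$ is parallel ($\nabla\psi=0$). If $\mathrm{Scal}\neq 0$, then $$\mu^2\ \ge\ \frac{n}{4(n-1)\,\mathrm{Scal}},$$ and equality holds if and only if $(M,g)$ is Einstein, namely, $\psi$ is a Killing spinor.
   Context: Manifolds are connected. $(M,g)$ is a Riemannian spin manifold with complex spinor bundle $\Sigma M$, $\nabla$ is the Levi-Civita connection and also the induced spin connection on $\Sigma M$, and $\cdot$ is Clifford multiplication, with $X\cdot Y\cdot+Y\cdot X\cdot=-2g(X,Y)$. $\mathrm{Ric}$ is the Ricci tensor viewed as a symmetric endomorphism of $TM$, and $\mathrm{Scal}$ its trace. A Ricci Killing spinor with constant $\mu\in\mathbb{R}\setminus\{0\}$ is a non-zero spinor field $\psi\in\Gamma(\Sigma M)$ with $\nabla_X\psi=\mu\,\mathrm{Ric}(X)\cdot\psi$ for all $X\in TM$. A Killing spinor is a non-zero spinor field with $\nabla_X\psi=\lambda X\cdot\psi$ for all $X\in TM$ and some constant $\lambda\in\mathbb{R}$. Einstein means $\mathrm{Ric}=c\,\mathrm{Id}$ for a constant $c$. *)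

(* Defs.v *)
From mathcomp Require Export all_boot all_order all_algebra.
From mathcomp Require Export complex.
From mathcomp Require Export all_classical all_reals all_analysis.
Export Order.TTheory GRing.Theory Num.Theory numFieldNormedType.Exports.

Set Implicit Arguments.
Unset Strict Implicit.
Unset Printing Implicit Defensive.

Local Open Scope classical_set_scope.
Local Open Scope ring_scope.
Local Open Scope complex_scope.

(* [W] is meant to be open, so that derivatives at points of [W] only depend
   on [f] restricted to [W]. *)
Fixpoint Ck (R : realType) (n k : nat) (W : set 'rV[R]_n)
    (f : 'rV[R]_n -> R) : Prop :=
  (forall x, W x -> {for x, continuous f}) /\
  match k with
  | 0 => True
  | k'.+1 => forall a : 'I_n,
      (forall x, W x -> derivable f x (delta_mx 0 a)) /\
      Ck k' W (fun x => 'D_(delta_mx 0 a) f x)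
  end.

Definition smooth_on (R : realType) (n : nat) (W : set 'rV[R]_n)
    (f : 'rV[R]_n -> R) : Prop :=
  forall k, Ck k W f.

(* The smooth structure is given by an atlas.  The chart [phi i] and its
   inverse [phiV i] are total functions that are only meaningful on [dom i]
   and on [phi i @` dom i] respectively. *)
Record manifold (R : realType) (n : nat) := Manifold {
  points :> topologicalType;
  chart : Type;
  dom : chart -> set points;
  phi : chart -> points -> 'rV[R]_n;
  phiV : chart -> 'rV[R]_n -> points;
  manifold_hausdorff : hausdorff_space points;
  manifold_second_countable : @second_countable points;
  manifold_connected : connected [set: points];
  dom_open : forall i, open (dom i);
  dom_cover : forall p, exists i, dom i p;
  phi_open : forall i, open (phi i @` dom i);
  phiK : forall i p, dom i p -> phiV i (phi i p) = p;
  phi_continuous : forall i p, dom i p -> {for p, continuous (phi i)};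
  phiV_continuous : forall i x, (phi i @` dom i) x ->
    {for x, continuous (phiV i)};
  transition_smooth : forall i j (b : 'I_n),
    smooth_on (phi i @` (dom i `&` dom j)) (fun x => phi j (phiV i x) 0 b)
}.

(* Smoothness of a function near the points of an open subset [W] of
   [dom i], read in the chart [i]. *)
Definition smooth_in (R : realType) (n : nat) (M : manifold R n) (i : chart M)
    (W : set M) (f : M -> R) : Prop :=
  smooth_on (phi i @` W) (f \o phiV i).

Definition csmooth_in (R : realType) (n : nat) (M : manifold R n)
    (i : chart M) (W : set M) (f : M -> R[i]) : Prop :=
  smooth_in i W (fun p => complex.Re (f p)) /\
  smooth_in i W (fun p => complex.Im (f p)).

(* Tangent vectors at [p] in [dom i] are represented by the row vectors of
   their components in the coordinate basis of the chart [i];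
   [dird i X f p] is then X(f) at p. *)
Definition dird (R : realType) (n : nat) (M : manifold R n) (i : chart M)
    (X : 'rV[R]_n) (f : M -> R) (p : M) : R :=
  'D_X (f \o phiV i) (phi i p).

Definition pard (R : realType) (n : nat) (M : manifold R n) (i : chart M)
    (a : 'I_n) (f : M -> R) (p : M) : R :=
  dird i (delta_mx 0 a) f p.

(* [X *m jac i j p] has the components in chart [j] of the tangent vector
   whose components in chart [i] are [X]. *)
Definition jac (R : realType) (n : nat) (M : manifold R n) (i j : chart M)
    (p : M) : 'M[R]_n :=
  \matrix_(a, b) pard i a (fun q => phi j q 0 b) p.

Record metric (R : realType) (n : nat) (M : manifold R n) := Metric {
  gmx : chart M -> M -> 'M[R]_n;
  gmx_sym : forall i p, dom i p -> (gmx i p)^T = gmx i p;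
  gmx_pos : forall i p (X : 'rV[R]_n), dom i p -> X != 0 ->
    0 < (X *m gmx i p *m X^T) 0 0;
  gmx_smooth : forall i a b, smooth_in i (dom i) (fun p => gmx i p a b);
  gmx_change : forall i j p, dom i p -> dom j p ->
    gmx i p = jac i j p *m gmx j p *m (jac i j p)^T
}.

Definition gdot (R : realType) (n : nat) (M : manifold R n) (g : metric M)
    (i : chart M) (p : M) (X Y : 'rV[R]_n) : R :=
  (X *m gmx g i p *m Y^T) 0 0.

Definition christoffel (R : realType) (n : nat) (M : manifold R n)
    (g : metric M) (i : chart M) (p : M) (d a b : 'I_n) : R :=
  2^-1 * \sum_(l < n) invmx (gmx g i p) d l *
    (pard i a (fun q => gmx g i q b l) p + pard i b (fun q => gmx g i q a l) p
     - pard i l (fun q => gmx g i q a b) p).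

Definition levi_civita (R : realType) (n : nat) (M : manifold R n)
    (g : metric M) (i : chart M) (X : 'rV[R]_n) (Y : M -> 'rV[R]_n)
    (p : M) : 'rV[R]_n :=
  \row_d (dird i X (fun q => Y q 0 d) p +
          \sum_(a < n) \sum_(b < n) christoffel g i p d a b * X 0 a * Y p 0 b).

(* R(X,Y)Z, where X, Y, Z are extended with constant components in the
   chart, so that [X,Y] = 0. *)
Definition riemann (R : realType) (n : nat) (M : manifold R n) (g : metric M)
    (i : chart M) (p : M) (X Y Z : 'rV[R]_n) : 'rV[R]_n :=
  levi_civita g i X (levi_civita g i Y (fun=> Z)) p -
  levi_civita g i Y (levi_civita g i X (fun=> Z)) p.

(* The trace of X |-> R(X,Y)Z. *)
Definition ricci_tensor (R : realType) (n : nat) (M : manifold R n)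
    (g : metric M) (i : chart M) (p : M) (Y Z : 'rV[R]_n) : R :=
  \sum_(a < n) riemann g i p (delta_mx 0 a) Y Z 0 a.

(* The Ricci endomorphism is X |-> [X *m Ric g i p]. *)
Definition Ric (R : realType) (n : nat) (M : manifold R n) (g : metric M)
    (i : chart M) (p : M) : 'M[R]_n :=
  (\matrix_(b, c) ricci_tensor g i p (delta_mx 0 b) (delta_mx 0 c))
    *m invmx (gmx g i p).

Definition Scal (R : realType) (n : nat) (M : manifold R n) (g : metric M)
    (i : chart M) (p : M) : R :=
  \tr (Ric g i p).

Definition einstein (R : realType) (n : nat) (M : manifold R n)
    (g : metric M) : Prop :=
  exists c : R, forall i p, dom i p -> Ric g i p = c%:M.

Definition ricci_flat (R : realType) (n : nat) (M : manifold R n)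
    (g : metric M) : Prop :=
  forall i p, dom i p -> Ric g i p = 0.

(* A complex representation of the Clifford algebra of R^n of the dimension
   of the spinor module; this dimension forces it to be irreducible. *)
Notation spin_dim n := (2 ^ n./2)%N.

Record spinor_module (R : realType) (n : nat) := SpinorModule {
  gamma : 'I_n -> 'M[R[i]]_(spin_dim n);
  gamma_clifford : forall a b,
    gamma a *m gamma b + gamma b *m gamma a = (- (2 * (a == b)%:R))%:M
}.

Definition cliff (R : realType) (n : nat) (G : spinor_module R n)
    (v : 'rV[R]_n) : 'M[R[i]]_(spin_dim n) :=
  \sum_(a < n) (v 0 a)%:C *: gamma G a.

(* Spin(n), i.e. the products of an even number of unit vectors, as a group
   of endomorphisms of the spinor module, on which it acts faithfully. *)
Definition spin_group (R : realType) (n : nat) (G : spinor_module R n)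
    (A : 'M[R[i]]_(spin_dim n)) : Prop :=
  exists s : seq 'rV[R]_n,
    [/\ ~~ odd (size s), forall v, v \in s -> (v *m v^T) 0 0 = 1
      & A = foldr (fun v B => cliff G v *m B) 1%:M s].

(* A spin structure (which includes an orientation), presented by local
   sections over a cover [triv_dom] that refines the atlas: [frame k p] is the
   orthonormal frame underlying the k-th section (its rows are the vectors of
   the frame, in the chart [ch k]), and [spin_lift k l] is the Spin(n)-valued
   transition function; [lift_frame] says that [spin_lift k l] is sent to the
   transition function of the frames by the double cover
   Spin(n) -> SO(n), A |-> (v |-> A v A^-1). *)
Record spin_structure (R : realType) (n : nat) (M : manifold R n)
    (g : metric M) (G : spinor_module R n) := SpinStructure {
  triv : Type;
  ch : triv -> chart M;
  triv_dom : triv -> set M;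
  frame : triv -> M -> 'M[R]_n;
  spin_lift : triv -> triv -> M -> 'M[R[i]]_(spin_dim n);
  triv_dom_open : forall k, open (triv_dom k);
  triv_dom_dom : forall k, triv_dom k `<=` dom (ch k);
  triv_dom_cover : forall p, exists k, triv_dom k p;
  frame_smooth : forall k a b, smooth_in (ch k) (triv_dom k) (fun p => frame k p a b);
  frame_orthonormal : forall k p, triv_dom k p ->
    frame k p *m gmx g (ch k) p *m (frame k p)^T = 1%:M;
  lift_smooth : forall k l s t,
    csmooth_in (ch k) (triv_dom k `&` triv_dom l) (fun p => spin_lift k l p s t);
  lift_spin : forall k l p, triv_dom k p -> triv_dom l p -> spin_group G (spin_lift k l p);
  lift_cocycle : forall k l m p, triv_dom k p -> triv_dom l p -> triv_dom m p ->
    spin_lift k l p *m spin_lift l m p = spin_lift k m p;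
  lift_frame : forall k l p (X : 'rV[R]_n), triv_dom k p -> triv_dom l p ->
    cliff G (X *m gmx g (ch k) p *m (frame k p)^T) *m spin_lift k l p =
    spin_lift k l p *m cliff G (X *m jac (ch k) (ch l) p
                             *m gmx g (ch l) p *m (frame l p)^T)
}.

(* Clifford multiplication by the tangent vector [X], given in the chart
   [ch k]; its component on the a-th frame vector is g(X, e_a). *)
Definition clifford (R : realType) (n : nat) (M : manifold R n)
    (g : metric M) (G : spinor_module R n) (S : spin_structure g G)
    (k : triv S) (p : M) (X : 'rV[R]_n) : 'M[R[i]]_(spin_dim n) :=
  cliff G (X *m gmx g (ch k) p *m (frame k p)^T).

(* Smooth sections of the associated spinor bundle. *)
Record spinor_field (R : realType) (n : nat) (M : manifold R n)
    (g : metric M) (G : spinor_module R n) (S : spin_structure g G) :=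
  SpinorField {
  spinor :> triv S -> M -> 'cV[R[i]]_(spin_dim n);
  spinor_smooth : forall k s, csmooth_in (ch k) (triv_dom k) (fun p => spinor k p s 0);
  spinor_change : forall k l p, triv_dom k p -> triv_dom l p ->
    spinor k p = spin_lift k l p *m spinor l p
}.

(* The spin connection:
   X(psi) + 1/4 sum_{a,b} g(nabla_X e_a, e_b) e_a . e_b . psi. *)
Definition spin_nabla (R : realType) (n : nat) (M : manifold R n)
    (g : metric M) (G : spinor_module R n) (S : spin_structure g G)
    (psi : spinor_field S) (k : triv S) (p : M) (X : 'rV[R]_n) :
    'cV[R[i]]_(spin_dim n) :=
  \col_s (dird (ch k) X (fun q => complex.Re (psi k q s 0)) p +i*
          dird (ch k) X (fun q => complex.Im (psi k q s 0)) p) +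
  4^-1 *: (\sum_(a < n) \sum_(b < n)
    (gdot g (ch k) p (levi_civita g (ch k) X (fun q => row a (frame k q)) p)
                     (row b (frame k p)))%:C
      *: (gamma G a *m gamma G b *m psi k p)).

Definition nonzero_spinor (R : realType) (n : nat) (M : manifold R n)
    (g : metric M) (G : spinor_module R n) (S : spin_structure g G)
    (psi : spinor_field S) : Prop :=
  exists k p, triv_dom k p /\ psi k p <> 0.

Definition parallel_spinor (R : realType) (n : nat) (M : manifold R n)
    (g : metric M) (G : spinor_module R n) (S : spin_structure g G)
    (psi : spinor_field S) : Prop :=
  forall k p (X : 'rV[R]_n), triv_dom k p -> spin_nabla psi k p X = 0.

Definition killing_spinor (R : realType) (n : nat) (M : manifold R n)
    (g : metric M) (G : spinor_module R n) (S : spin_structure g G)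
    (psi : spinor_field S) : Prop :=
  nonzero_spinor psi /\
  exists lambda : R, forall k p (X : 'rV[R]_n), triv_dom k p ->
    spin_nabla psi k p X = lambda%:C *: (clifford k p X *m psi k p).

Definition ricci_killing_spinor (R : realType) (n : nat) (M : manifold R n)
    (g : metric M) (G : spinor_module R n) (S : spin_structure g G)
    (mu : R) (psi : spinor_field S) : Prop :=
  [/\ mu != 0, nonzero_spinor psi &
    forall k p (X : 'rV[R]_n), triv_dom k p ->
      spin_nabla psi k p X =
      mu%:C *: (clifford k p (X *m Ric g (ch k) p) *m psi k p)].

(* Main.v *)
From HB Require Import structures.
Require Import Defs.
From mathcomp Require Import ring lra.

(** The theorem is local up to two uses of connectedness, and the local part
    takes place in an orthonormal frame e_1, ..., e_n over the commutative ring
    of smooth functions on an open set.  There the vector fields e_i are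
    derivations d_i, and the Levi-Civita connection is the family w with
    nabla_{e_i} e_j = sum_k w_ijk e_k.  It is skew in j and k, and the frame
    determines it through [d_i, d_j] = sum_k (w_ijk - w_jik) d_k
    ([moving_frame], [connection_unique]).  The Jacobi identity, for the d_i and
    for the covariant derivatives, yields the two Bianchi identities, hence a
    symmetric Ricci tensor with 2 div Ric = d Scal ([frame_ricci_sym],
    [ricci_divergence]).

    Let psi be a Ricci Killing spinor.  Differentiating its equation once more
    expresses the curvature of the spinor bundle on psi by
    mu ((nabla_X Ric) Y - (nabla_Y Ric) X) . psi
    + mu^2 (Ric Y . Ric X - Ric X . Ric Y) . psi ([rk_curvature]).  Contracting
    with Clifford multiplication over X turns the curvature into Ric(Y) . psi / 2
    by the first Bianchi identity ([spin_curv_contraction]).  Choose a positive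
    definite symmetric form for which Clifford multiplication by vectors is skew
    ([invariant_form]): then v . psi is orthogonal to psi for every vector v.
    - The derivative mu Ric(X) . psi of psi is orthogonal to psi, so that |psi|^2
      has zero derivative ([normsq_const]).
    - Pairing the contracted identity with psi kills all vectors and leaves
      div Ric - d Scal = - d Scal / 2, so that mu (d Scal) |psi|^2 = 0
      ([scal_const]).
    - Contracting a second time and pairing with psi leaves
      Scal / 2 = 2 mu^2 (Scal^2 - |Ric|^2) wherever psi <> 0 ([ricci_norm]); the
      derivatives of Ric only contribute a vector, by [cliff_cubic_l].

    As M is connected, |psi|^2 constant along paths means that psi vanishes
    nowhere, and then Scal is a constant s ([ricci_killing_nonzero],
    [scal_constant]).  The rest is algebra: with T = |Ric - (s/n) Id|^2 =
    |Ric|^2 - s^2/n >= 0 the last identity reads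
    4 mu^2 T = s (4 mu^2 s (n-1)/n - 1) ([traceless_norm_mu]).  If s = 0 then
    T = 0, hence Ric = 0 and nabla psi = 0.  If s <> 0 it is the bound on mu^2,
    and equality means T = 0 at one point, or equivalently at all points, that is
    Ric = (s/n) Id.  For an Einstein metric the equation of psi is a Killing
    equation; conversely (mu Ric X - lambda X) . psi = 0 forces
    mu Ric X = lambda X, because v . v = - |v|^2 and psi vanishes nowhere.

    It remains to connect coordinates with frames.  The partial derivatives of a
    chart are commuting derivations of the ring of smooth functions, by the
    symmetry of second derivatives ([schwarz], [chart_derC]), and an orthonormal
    frame turns the Christoffel symbols into a connection w as above
    ([coord_moving_frame]) whose Ricci tensor is the conjugate of the coordinate
    one ([coord_ricciE], [ev_frame_ricci]).  Since w depends on the frame alone,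
    Scal and the condition Ric = c Id do not depend on the chart ([scal_change],
    [ric_scalar_change]).  Complex spinors are treated as real ones of twice the
    rank ([rmx], [rcol]). *)

Set Implicit Arguments.
Unset Strict Implicit.
Unset Printing Implicit Defensive.

Local Open Scope ring_scope.

(** * Derivations and matrices *)

Section MatrixEntries.
Variables (A : comPzRingType) (m n : nat).
Implicit Types M N : 'M[A]_(m, n).

Lemma addmxE M N i j : (M + N) i j = M i j + N i j.
Proof. by rewrite mxE. Qed.

Lemma oppmxE M i j : (- M) i j = - M i j.
Proof. by rewrite mxE. Qed.

Lemma scalemxE a M i j : (a *: M) i j = a * M i j.
Proof. by rewrite mxE. Qed.

Lemma zeromxE i j : (0 : 'M[A]_(m, n)) i j = 0.
Proof. by rewrite mxE. Qed.

End MatrixEntries.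

(** Stated for variables because the terms to which [bianchi2] applies it
    are too large to be rearranged in place. *)
Lemma cyclic_cancel (V : zmodType) (L1 L2 L3 S1 S2 S3 N1 N2 N3 : V) :
  L1 = S1 + N1 -> L2 = S2 + N2 -> L3 = S3 + N3 ->
  N1 + N2 + N3 = 0 -> L1 + L2 + L3 = 0 -> S1 + S2 + S3 = 0.
Proof.
move=> -> -> -> N0 <-.
by rewrite (addrACA S1) (addrACA (S1 + S2)) N0 addr0.
Qed.

(** Proves linear identities between matrices, entry by entry; products of
    matrices are left as atoms. *)
Ltac mxlin :=
  apply/matrixP=> ? ?; rewrite ?(addmxE, oppmxE, scalemxE, zeromxE); ring.

Record derivation (A : comPzRingType) (d : A -> A) : Prop := Derivation {
  derD : forall x y, d (x + y) = d x + d y;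
  derM : forall x y, d (x * y) = d x * y + x * d y }.

Section Derivation.
Variables (A : comPzRingType) (d : A -> A) (dd : derivation d).

Lemma der0 : d 0 = 0.
Proof. by apply: (addrI (d 0)); rewrite -(derD dd) !addr0. Qed.

Lemma derN x : d (- x) = - d x.
Proof. by apply: (addrI (d x)); rewrite -(derD dd) !subrr der0. Qed.

Lemma derB x y : d (x - y) = d x - d y.
Proof. by rewrite (derD dd) derN. Qed.

Lemma der_sum (I : Type) (r : seq I) (P : pred I) (F : I -> A) :
  d (\sum_(i <- r | P i) F i) = \sum_(i <- r | P i) d (F i).
Proof. by apply: (big_morph d (derD dd) der0). Qed.

Lemma dermx0 m n : map_mx d (0 : 'M[A]_(m, n)) = 0.
Proof. by apply/matrixP=> i j; rewrite !mxE der0. Qed.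

Lemma dermxD m n (M N : 'M[A]_(m, n)) :
  map_mx d (M + N) = map_mx d M + map_mx d N.
Proof. by apply/matrixP=> i j; rewrite !mxE (derD dd). Qed.

Lemma dermxB m n (M N : 'M[A]_(m, n)) :
  map_mx d (M - N) = map_mx d M - map_mx d N.
Proof. by apply/matrixP=> i j; rewrite !mxE derB. Qed.

Lemma dermxZ m n a (M : 'M[A]_(m, n)) :
  map_mx d (a *: M) = d a *: M + a *: map_mx d M.
Proof. by apply/matrixP=> i j; rewrite !mxE (derM dd). Qed.

Lemma dermxM m n p (M : 'M[A]_(m, n)) (N : 'M[A]_(n, p)) :
  map_mx d (M *m N) = map_mx d M *m N + M *m map_mx d N.
Proof.
apply/matrixP=> i j; rewrite !mxE der_sum -big_split /=.
by apply: eq_bigr => k _; rewrite !mxE (derM dd).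
Qed.

Lemma dermx_sum (I : Type) (r : seq I) (P : pred I) m n (F : I -> 'M[A]_(m, n)) :
  map_mx d (\sum_(i <- r | P i) F i) = \sum_(i <- r | P i) map_mx d (F i).
Proof. by apply: (big_morph (map_mx d) (@dermxD m n) (@dermx0 m n)). Qed.

End Derivation.

(** * Moving frames and the Bianchi identities *)

(** The [d i] are the vector fields of an orthonormal frame and
    nabla_{e_i} e_j = sum_k (w i j k) e_k.  That nabla is metric is [mf_skew], that
    it is torsion-free is [mf_bracket].  A vector field is only known through its
    action on functions, whence the form of [mf_free]. *)
Record moving_frame (R : realFieldType) (A : comPzRingType)
    (cst : {rmorphism R -> A}) (n : nat) (d : 'I_n -> A -> A)
    (w : 'I_n -> 'I_n -> 'I_n -> A) : Prop := MovingFrame {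
  mf_der : forall i, derivation (d i);
  mf_cst : forall i r, d i (cst r) = 0;
  mf_free : forall v : 'I_n -> A,
    (forall f, \sum_k v k * d k f = 0) -> forall k, v k = 0;
  mf_skew : forall i j k, w i j k = - w i k j;
  mf_bracket : forall i j f,
    d i (d j f) - d j (d i f) = \sum_k (w i j k - w j i k) * d k f }.

(** The component on e_l of R(e_i, e_j) e_k; the last sum comes from the
    derivative along [e_i, e_j]. *)
Definition curv (A : comPzRingType) (n : nat) (d : 'I_n -> A -> A)
    (w : 'I_n -> 'I_n -> 'I_n -> A) (i j k l : 'I_n) : A :=
  d i (w j k l) - d j (w i k l)
  + \sum_m (w j k m * w i m l - w i k m * w j m l)
  - \sum_m (w i j m - w j i m) * w m k l.

Definition frame_ricci (A : comPzRingType) (n : nat) (d : 'I_n -> A -> A)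
    (w : 'I_n -> 'I_n -> 'I_n -> A) (j k : 'I_n) : A :=
  \sum_i curv d w i j k i.

Definition frame_scal (A : comPzRingType) (n : nat) (d : 'I_n -> A -> A)
    (w : 'I_n -> 'I_n -> 'I_n -> A) : A :=
  \sum_j frame_ricci d w j j.

(** (nabla_{e_m} Ric)(e_j, e_k). *)
Definition ricci_derivative (A : comPzRingType) (n : nat) (d : 'I_n -> A -> A)
    (w : 'I_n -> 'I_n -> 'I_n -> A) (m j k : 'I_n) : A :=
  d m (frame_ricci d w j k) - \sum_p w m j p * frame_ricci d w p k
  - \sum_p w m k p * frame_ricci d w j p.

Section Torsion.
Variables (R : realFieldType) (A : comPzRingType) (cst : {rmorphism R -> A}).

(** An algebra over a field of characteristic zero has no torsion.  The
    index is shifted: [cst_mulIn 1] cancels a factor two. *)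
Lemma cst_mulIn k (x : A) : x *+ k.+1 = 0 -> x = 0.
Proof.
move=> xk0; have: cst k.+1%:R * x = 0 by rewrite rmorph_nat mulr_natl.
move=> /(congr1 (fun y => cst k.+1%:R^-1 * y)); rewrite mulr0 mulrA -rmorphM.
by rewrite mulVf ?pnatr_eq0 // rmorph1 mul1r.
Qed.

End Torsion.

Section MovingFrame.
Variables (R : realFieldType) (A : comPzRingType) (cst : {rmorphism R -> A}).
Variables (n : nat) (d : 'I_n -> A -> A) (w : 'I_n -> 'I_n -> 'I_n -> A).
Hypothesis mf : moving_frame cst d w.

Let dd i : derivation (d i) := mf_der mf i.
Let c i j k := w i j k - w j i k.
Let K := curv d w.
Let rho := frame_ricci d w.

(** Koszul's argument: the difference of two connections is symmetric in its
    first two indices and skew in its last two, hence zero. *)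
Lemma connection_unique w' : moving_frame cst d w' ->
  forall i j k, w i j k = w' i j k.
Proof.
move=> mf' i j k; pose u i j k := w i j k - w' i j k.
have uC a b e : u a b e = u b a e.
  apply/eqP; rewrite -subr_eq0; apply/eqP.
  rewrite (_ : _ - _ = c a b e - (w' a b e - w' b a e)); last by rewrite /u /c; ring.
  move: e; apply: (mf_free mf) => f; apply/eqP.
  under eq_bigr do rewrite mulrBl.
  by rewrite big_split /= sumrN -(mf_bracket mf) -(mf_bracket mf') subrr.
have uN a b e : u a b e = - u a e b.
  by rewrite /u (mf_skew mf a b e) (mf_skew mf' a b e) opprB addrC opprK.
apply/eqP; rewrite -subr_eq0; apply/eqP; rewrite -/(u i j k).
apply: (@cst_mulIn _ _ cst 1); rewrite mulr2n.
by rewrite {1}uC uN uC uN opprK uC uN addNr.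
Qed.

Lemma curvNij i j k l : K i j k l = - K j i k l.
Proof.
rewrite /K /curv.
rewrite (_ : \sum_m (w j i m - _) * _ = - \sum_m (w i j m - w j i m) * w m k l).
  rewrite (_ : \sum_m (w i k m * _ - _) = - \sum_m (w j k m * w i m l - w i k m * w j m l)).
    by ring.
  by rewrite -sumrN; apply: eq_bigr => m _; ring.
by rewrite -sumrN; apply: eq_bigr => m _; ring.
Qed.

Lemma curvNkl i j k l : K i j k l = - K i j l k.
Proof.
rewrite /K /curv (mf_skew mf j k l) (mf_skew mf i k l) !(derN (dd _)).
rewrite (_ : \sum_m (w i j m - w j i m) * w m k l =
   - \sum_m (w i j m - w j i m) * w m l k); last first.
  by rewrite -sumrN; apply: eq_bigr => m _; rewrite (mf_skew mf m k l); ring.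
rewrite (_ : \sum_m (w j k m * w i m l - _) =
   - \sum_m (w j l m * w i m k - w i l m * w j m k)); first by ring.
rewrite -sumrN; apply: eq_bigr => m _.
rewrite (mf_skew mf j k m) (mf_skew mf i m l) (mf_skew mf i k m) (mf_skew mf j m l).
by ring.
Qed.

(** Apply the Jacobi identity for the commutators of the [d i] to a
    function, and use that the frame is free. *)
Lemma structure_jacobi i j k l :
  (d i (c j k l) + \sum_m c j k m * c i m l)
  + (d j (c k i l) + \sum_m c k i m * c j m l)
  + (d k (c i j l) + \sum_m c i j m * c k m l) = 0.
Proof.
move: l; apply: (mf_free mf) => f.
have bb i' j' k' : \sum_l (d i' (c j' k' l) + \sum_m c j' k' m * c i' m l) * d l f
    = d i' (d j' (d k' f) - d k' (d j' f))
      - (d j' (d k' (d i' f)) - d k' (d j' (d i' f))).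
  rewrite !(mf_bracket mf) (der_sum (dd _)) -sumrB.
  under [RHS]eq_bigr => l _.
    rewrite (derM (dd _)) -addrA -mulrBr (mf_bracket mf) mulr_sumr.
    over.
  under [LHS]eq_bigr => l _ do rewrite mulrDl mulr_suml.
  rewrite /= !big_split /=; congr (_ + _); rewrite exchange_big /=.
  by apply: eq_bigr => l _; apply: eq_bigr => m _; rewrite mulrA.
rewrite /=; under eq_bigr => l _ do rewrite 2!mulrDl.
rewrite 2!big_split /= !bb !(derB (dd _)).
by ring.
Qed.

(** Without torsion the structure functions are c = w i j k - w j i k, and the
    Jacobi identity of the frame becomes this cyclic sum. *)
Lemma bianchi1 i j k l : K i j k l + K j k i l + K k i j l = 0.
Proof.
rewrite -[RHS](structure_jacobi i j k l) /K /curv /c !(derB (dd _)).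
set a1 := \sum__ _; set a2 := \sum__ _; set a3 := \sum__ _.
set a4 := \sum__ _; set a5 := \sum__ _; set a6 := \sum__ _.
set b1 := \sum__ _; set b2 := \sum__ _; set b3 := \sum__ _.
suff: a1 - a2 + a3 - a4 + a5 - a6 = b1 + b2 + b3.
  move=> e; transitivity (d i (w j k l) - d j (w i k l) + (d j (w k i l) - d k (w j i l))
    + (d k (w i j l) - d i (w k j l)) + (a1 - a2 + a3 - a4 + a5 - a6)); first by ring.
  by rewrite e; ring.
rewrite /a1 /a2 /a3 /a4 /a5 /a6 /b1 /b2 /b3 -!(sumrB, big_split) /=.
by apply: eq_bigr => m _; ring.
Qed.

(** Four instances of the first Bianchi identity add up to twice the
    difference of the two sides. *)
Lemma curv_pair i j k l : K i j k l = K k l i j.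
Proof.
apply/eqP; rewrite -subr_eq0; apply/eqP; apply: (@cst_mulIn _ _ cst 1).
have e1 := bianchi1 i j k l; have e2 := bianchi1 j k l i.
have e3 := bianchi1 k l i j; have e4 := bianchi1 l i j k.
rewrite (curvNkl j k l i) (curvNkl k l j i) (curvNij l j k i) in e2.
rewrite (curvNij l i k j) (curvNkl i l k j) (curvNij i k l j) (curvNkl k i l j) in e3.
rewrite (curvNij l i j k) (curvNkl i j l k) (curvNkl j l i k) in e4.
rewrite mulr2n -[LHS]subr0 -[X in _ - X = _]addr0 -{1}e1 -{1}e2.
rewrite -[LHS]addr0 -{1}e3 -[LHS]addr0 -{1}e4; ring.
Qed.

Lemma frame_ricci_sym j k : rho j k = rho k j.
Proof.
by rewrite /rho /frame_ricci -/K; apply: eq_bigr => i _; rewrite curv_pair curvNij curvNkl opprK.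
Qed.

(** The components of nabla_{e_m} R. *)
Let dK m i j k l := d m (K i j k l) - \sum_p w m i p * K p j k l
  - \sum_p w m j p * K i p k l - \sum_p w m k p * K i j p l
  - \sum_p w m l p * K i j k p.

(** Jacobi identity for the operators nab_i Z = d_i Z + Z W_i on matrices: the
    commutator of two of them is right multiplication by the curvature matrix, up
    to the bracket of the frame.  Applied to Z = 1 it gives the cyclic sum; the
    structure functions drop out by [structure_jacobi]. *)
Lemma bianchi2 m i j k l : dK m i j k l + dK i j m k l + dK j m i k l = 0.
Proof.
pose W i := \matrix_(k, l) w i k l.
pose KM i j := \matrix_(k, l) K i j k l.
pose nab i (Z : 'M[A]_n) := map_mx (d i) Z + Z *m W i.
have nabD a Y Z : nab a (Y + Z) = nab a Y + nab a Z.
  by rewrite /nab (dermxD (dd _)) mulmxDl addrACA.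
have nabsum a (F : 'I_n -> 'M[A]_n) : nab a (\sum_b F b) = \sum_b nab a (F b).
  apply: (big_morph (nab a) (nabD a)).
  by rewrite /nab (dermx0 (dd _)) mul0mx addr0.
have nabB a Y Z : nab a (Y - Z) = nab a Y - nab a Z.
  by rewrite /nab (dermxB (dd _)) mulmxBl opprD addrACA.
have nabZ a x Z : nab a (x *: Z) = d a x *: Z + x *: nab a Z.
  by rewrite /nab (dermxZ (dd _)) -scalemxAl scalerDr addrA.
pose dKM a b e := map_mx (d a) (KM b e) + KM b e *m W a - W a *m KM b e.
have nabM a Z b e : nab a (Z *m KM b e) = nab a Z *m KM b e + Z *m dKM a b e.
  rewrite /nab /dKM (dermxM (dd _)) mulmxBr !mulmxDr ?mulmxDl !mulmxA.
  by mxlin.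
have KME a b : KM a b = map_mx (d a) (W b) - map_mx (d b) (W a)
    + W b *m W a - W a *m W b - \sum_p c a b p *: W p.
  apply/matrixP=> k' l'; rewrite !mxE summxE /K /curv sumrB !addrA.
  by congr (_ + _ - _ - _); apply: eq_bigr => p _; rewrite !mxE.
have comm a b Z : nab a (nab b Z) - nab b (nab a Z)
    = Z *m KM a b + \sum_p c a b p *: nab p Z.
  rewrite KME /nab !(dermxD (dd _)) !(dermxM (dd _)) !mulmxDl.
  have -> : \sum_p c a b p *: (map_mx (d p) Z + Z *m W p) =
     (map_mx (d a) (map_mx (d b) Z) - map_mx (d b) (map_mx (d a) Z))
      + Z *m \sum_p c a b p *: W p.
    rewrite mulmx_sumr.
    under eq_bigr => p _ do rewrite scalerDr scalemxAr.
    rewrite big_split /=; congr (_ + _).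
    apply/matrixP=> k' l'; rewrite summxE !mxE (mf_bracket mf).
    by apply: eq_bigr => p _; rewrite !mxE.
  rewrite !(mulmxDr, mulmxN, mulmxA); mxlin.
have jac a b e Z : nab a (nab b (nab e Z) - nab e (nab b Z))
    - (nab b (nab e (nab a Z)) - nab e (nab b (nab a Z)))
    = Z *m (dKM a b e + \sum_p c b e p *: KM a p)
      + \sum_p (d a (c b e p) + \sum_q c b e q * c a q p) *: nab p Z.
  rewrite !comm nabD nabM nabsum.
  under eq_bigr => p _ do rewrite nabZ.
  rewrite big_split /=.
  have -> : Z *m (dKM a b e + \sum_p c b e p *: KM a p) =
      Z *m dKM a b e + \sum_p c b e p *: (Z *m KM a p).
    rewrite [LHS]mulmxDr mulmx_sumr; congr (_ + _).
    by apply: eq_bigr => p _; rewrite -scalemxAr.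
  have -> : \sum_p (d a (c b e p) + \sum_q c b e q * c a q p) *: nab p Z =
      \sum_p d a (c b e p) *: nab p Z +
      \sum_p \sum_q (c b e q * c a q p) *: nab p Z.
    by rewrite -big_split; apply: eq_bigr => p _; rewrite scalerDl scaler_suml.
  have -> : \sum_p c b e p *: nab a (nab p Z) =
      \sum_p c b e p *: nab p (nab a Z) + \sum_p c b e p *: (Z *m KM a p) +
      \sum_p \sum_q (c b e q * c a q p) *: nab p Z.
    rewrite [X in _ = _ + X]exchange_big /= -!big_split /=.
    apply: eq_bigr => p _.
    have -> : \sum_q (c b e p * c a p q) *: nab q Z =
        c b e p *: \sum_q c a p q *: nab q Z.
      by rewrite scaler_sumr; apply: eq_bigr => q _; rewrite scalerA.
    by rewrite -addrA -scalerDr -comm scalerBr addrC subrK.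
  by mxlin.
have dKcyc : (dKM m i j + \sum_p c i j p *: KM m p)
   + (dKM i j m + \sum_p c j m p *: KM i p)
   + (dKM j m i + \sum_p c m i p *: KM j p) = 0.
  have e1 := jac m i j 1%:M; have e2 := jac i j m 1%:M.
  have e3 := jac j m i 1%:M; rewrite !mul1mx !nabB in e1 e2 e3.
  have J : \sum_p (d m (c i j p) + \sum_q c i j q * c m q p) *: nab p 1%:M
     + \sum_p (d i (c j m p) + \sum_q c j m q * c i q p) *: nab p 1%:M
     + \sum_p (d j (c m i p) + \sum_q c m i q * c j q p) *: nab p 1%:M = 0.
    rewrite -!big_split big1 //= => p _.
    by rewrite -!scalerDl structure_jacobi scale0r.
  by apply: (cyclic_cancel e1 e2 e3 J); mxlin.
have dKE a b e p q : (dKM a b e) p q = d a (K b e p q)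
   - \sum_r w a p r * K b e r q - \sum_r w a q r * K b e p r.
  rewrite /dKM !(addmxE, oppmxE) ![in LHS]mxE addrAC; congr (_ - _ + _).
    by apply: eq_bigr => r _; rewrite !mxE.
  rewrite -sumrN; apply: eq_bigr => r _; rewrite !mxE (mf_skew mf a q r).
  by rewrite mulNr opprK mulrC.
clearbody dKM; have := congr1 (fun X : 'M[A]_n => X k l) dKcyc.
rewrite !(addmxE, zeromxE) !dKE !summxE => e.
rewrite /dK -[RHS]e.
set a1 := \sum_p w m i p * _; set a2 := \sum_p w m j p * _.
set a3 := \sum_p w i j p * _; set a4 := \sum_p w i m p * _.
set a5 := \sum_p w j m p * _; set a6 := \sum_p w j i p * _.
set b1 := \sum_p (c i j p *: KM m p) k l.
set b2 := \sum_p (c j m p *: KM i p) k l.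
set b3 := \sum_p (c m i p *: KM j p) k l.
suff eab : - a1 - a2 - a3 - a4 - a5 - a6 = b1 + b2 + b3.
  transitivity (d m (K i j k l) - \sum_p w m k p * K i j p l - \sum_p w m l p * K i j k p
    + (d i (K j m k l) - \sum_p w i k p * K j m p l - \sum_p w i l p * K j m k p)
    + (d j (K m i k l) - \sum_p w j k p * K m i p l - \sum_p w j l p * K m i k p)
    + (- a1 - a2 - a3 - a4 - a5 - a6)); first by ring.
  by rewrite eab; ring.
rewrite /a1 /a2 /a3 /a4 /a5 /a6 /b1 /b2 /b3 -!(sumrN, big_split) /=.
apply: eq_bigr => p _; rewrite !mxE /c.
by rewrite (curvNij p j) (curvNij p m) (curvNij p i); ring.
Qed.

Let Dr := ricci_derivative d w.

(** The two terms by which a metric connection acts on a contracted pair of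
    indices cancel, so that contraction commutes with nabla. *)
Lemma skew_contraction (a b : 'I_n -> 'I_n -> A) :
  (forall p q, a p q = - a q p) ->
  \sum_i \sum_p (a i p * b p i + a i p * b i p) = 0.
Proof.
move=> aN; under eq_bigr => i _ do rewrite big_split /=.
rewrite big_split /= exchange_big -big_split big1 //= => i _.
by rewrite -big_split big1 //= => p _; rewrite (aN p i) mulNr addNr.
Qed.

Lemma curv_contraction m j k : \sum_i dK m i j k i = Dr m j k.
Proof.
rewrite /dK /Dr /ricci_derivative /frame_ricci -/K (der_sum (dd _)).
have := skew_contraction (a := w m) (fun p i => K p j k i) (mf_skew mf m).
move: (K) => K0; under eq_bigr do rewrite big_split.
rewrite !sumrB big_split /= => /eqP; rewrite addr_eq0 => /eqP ->.
have aux (x y z t : A) : x - (- y) - z - t - y = x - z - t by ring.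
rewrite aux.
congr (_ - _ - _); rewrite exchange_big /=;
  by apply: eq_bigr => p _; rewrite mulr_sumr.
Qed.

Lemma scal_derivative j : \sum_k Dr j k k = d j (frame_scal d w).
Proof.
rewrite /Dr /ricci_derivative !sumrB -(der_sum (dd _)) /frame_scal.
have := skew_contraction (a := w j) (fun p i => rho p i) (mf_skew mf j).
under eq_bigr do rewrite big_split.
by rewrite big_split -[_ - _ - _]addrA -opprD /= => ->; rewrite subr0.
Qed.

(** The second Bianchi identity, contracted twice. *)
Lemma ricci_divergence j :
  \sum_k Dr k j k + \sum_k Dr k j k = d j (frame_scal d w).
Proof.
have sumN (f g : 'I_n -> A) : (forall p, f p = - g p) ->
    \sum_p f p = - \sum_p g p.
  by move=> fg; rewrite -sumrN; apply: eq_bigr.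
have dKNij m i a k l : dK m i a k l = - dK m a i k l.
  rewrite /dK (curvNij i a k l) (derN (dd _)).
  rewrite (sumN (fun p => w m i p * K p a k l) (fun p => w m i p * K a p k l))
    => [|p]; last by rewrite curvNij mulrN.
  rewrite (sumN (fun p => w m a p * K i p k l) (fun p => w m a p * K p i k l))
    => [|p]; last by rewrite curvNij mulrN.
  rewrite (sumN (fun p => w m k p * K i a p l) (fun p => w m k p * K a i p l))
    => [|p]; last by rewrite curvNij mulrN.
  rewrite (sumN (fun p => w m l p * K i a k p) (fun p => w m l p * K a i k p))
    => [|p]; last by rewrite curvNij mulrN.
  by ring.
have dKNkl m i a k l : dK m i a k l = - dK m i a l k.
  rewrite /dK (curvNkl i a k l) (derN (dd _)).
  rewrite (sumN (fun p => w m i p * K p a k l) (fun p => w m i p * K p a l k))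
    => [|p]; last by rewrite curvNkl mulrN.
  rewrite (sumN (fun p => w m a p * K i p k l) (fun p => w m a p * K i p l k))
    => [|p]; last by rewrite curvNkl mulrN.
  rewrite (sumN (fun p => w m k p * K i a p l) (fun p => w m k p * K i a l p))
    => [|p]; last by rewrite curvNkl mulrN.
  rewrite (sumN (fun p => w m l p * K i a k p) (fun p => w m l p * K i a p k))
    => [|p]; last by rewrite curvNkl mulrN.
  by ring.
have := erefl (\sum_k \sum_i (dK k i j k i + dK i j k k i + dK j k i k i)).
rewrite [in LHS]big1 => [|k _]; last by rewrite big1 // => i _; rewrite bianchi2.
under eq_bigr => k _.
  rewrite 2!big_split /= curv_contraction.
  rewrite -[X in _ + X]opprK -sumrN.
  under [X in _ - X]eq_bigr => i _ do rewrite -dKNij.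
  rewrite curv_contraction.
  over.
rewrite sumrB big_split /= exchange_big /=.
under [X in _ = _ + X - _]eq_bigr => i _.
  under eq_bigr => k _ do rewrite dKNij dKNkl opprK.
  rewrite curv_contraction.
  over.
by rewrite scal_derivative => /esym/eqP; rewrite subr_eq0 => /eqP.
Qed.

End MovingFrame.

(** * Orthonormal frames in coordinates *)

Section CoordinateFrame.
Variables (R : realFieldType) (A : comPzRingType) (cst : {rmorphism R -> A}).
Variables (n : nat) (p : 'I_n -> A -> A).
Hypothesis pd : forall a, derivation (p a).
Hypothesis p_cst : forall a r, p a (cst r) = 0.
Hypothesis pC : forall a b f, p a (p b f) = p b (p a f).
Hypothesis p_free : forall v : 'I_n -> A,
    (forall f, \sum_k v k * p k f = 0) -> forall k, v k = 0.
Variables (g E : 'M[A]_n).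
Hypothesis gT : g^T = g.
Hypothesis Eg : E *m g *m E^T = 1%:M.

Definition christoffel_lower a : 'M[A]_n :=
  \matrix_(b, l) (cst 2^-1 * (p a (g b l) + p b (g a l) - p l (g a b))).

(** [christoffel_mx a b c] is the Christoffel symbol of nabla_a e_b on e_c.  The
    factor [E^T *m E] is the inverse of the metric. *)
Definition christoffel_mx a : 'M[A]_n := christoffel_lower a *m (E^T *m E).

(** The entry at (j, k) is g(nabla_a E_j, E_k), where E_j is the j-th row of [E];
    note that [g *m E^T] is the inverse of [E]. *)
Definition connection_form a : 'M[A]_n :=
  (map_mx (p a) E + E *m christoffel_mx a) *m (g *m E^T).

Definition frame_der i f := \sum_a E i a * p a f.

Definition frame_connection i j k := \sum_a E i a * connection_form a j k.

(** The entry at (c, d) is the d-th component of R(e_a, e_b) e_c for coordinate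
    fields, whose brackets vanish. *)
Definition coord_curv a b : 'M[A]_n :=
  map_mx (p a) (christoffel_mx b) - map_mx (p b) (christoffel_mx a)
  + christoffel_mx b *m christoffel_mx a - christoffel_mx a *m christoffel_mx b.

Definition coord_ricci : 'M[A]_n := \matrix_(b, c) \sum_a coord_curv a b c a.

Let C := christoffel_mx.
Let om := connection_form.
Let D := frame_der.
Let w := frame_connection.
Let Ei := g *m E^T.

Lemma half2 (x : A) : cst 2^-1 * x + cst 2^-1 * x = x.
Proof.
rewrite -mulrDl -rmorphD (_ : 2^-1 + 2^-1 = 1) ?rmorph1 ?mul1r //.
by field.
Qed.

Lemma mul_frame_inv : E *m Ei = 1%:M.
Proof. by rewrite mulmxA Eg. Qed.

Lemma mul_inv_frame : Ei *m E = 1%:M.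
Proof. exact: (mulmx1C mul_frame_inv). Qed.

Lemma metric_inv : g *m (E^T *m E) = 1%:M.
Proof. by rewrite mulmxA mul_inv_frame. Qed.

Lemma gC b c : g b c = g c b.
Proof. by rewrite -[in LHS]gT mxE. Qed.

Lemma christoffel_mx_sym a b e : C a b e = C b a e.
Proof.
rewrite !mxE; apply: eq_bigr => l _; rewrite !mxE (gC b a).
by congr (_ * _ * _); ring.
Qed.

Lemma metric_compat a : map_mx (p a) g = C a *m g + g *m (C a)^T.
Proof.
have Cg : C a *m g = christoffel_lower a.
  by rewrite /C /christoffel_mx -mulmxA (mulmx1C metric_inv) mulmx1.
have gC' : g *m (C a)^T = (christoffel_lower a)^T.
  by rewrite -[X in X *m _]gT -trmx_mul Cg.
rewrite gC' Cg; apply/matrixP=> b e; rewrite !mxE (gC e b).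
by rewrite -mulrDr -[LHS]half2 -mulrDr; congr (_ * _); ring.
Qed.

Lemma der1mx a m : map_mx (p a) (1%:M : 'M[A]_m) = 0.
Proof.
apply/matrixP=> i j; rewrite !mxE; case: (i == j); last by rewrite (der0 (pd a)).
by rewrite -(rmorph1 cst) p_cst.
Qed.

(** Differentiate [E *m g *m E^T = 1%:M] and use that the Christoffel symbols
    are metric. *)
Lemma connection_form_skew a : (om a)^T = - om a.
Proof.
apply/eqP; rewrite -addr_eq0; apply/eqP.
rewrite -(der1mx a n) -Eg !(dermxM (pd a)) metric_compat.
have -> : map_mx (p a) E^T = (map_mx (p a) E)^T by rewrite map_trmx.
rewrite /om /connection_form -/C; move: (C a) => Ca.
rewrite !(trmx_mul, linearD) /= !trmx_mul !trmxK gT.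
by rewrite !(mulmxDr, mulmxDl, mulmxA); mxlin.
Qed.

Lemma frame_derE a : map_mx (p a) E = om a *m E - E *m C a.
Proof.
by rewrite /om /connection_form -mulmxA mul_inv_frame mulmx1 addrK.
Qed.

(** The Christoffel symbols are symmetric, so they cancel in the bracket of two
    frame fields. *)
Lemma frame_der_bracketE i j b : D i (E j b) - D j (E i b)
  = \sum_k (w i j k - w j i k) * E k b.
Proof.
have DE i' j' : D i' (E j' b) = \sum_k w i' j' k * E k b
    - \sum_a \sum_c E i' a * (E j' c * C a c b).
  rewrite /D /frame_der.
  under eq_bigr => a _.
    rewrite (_ : p a (E j' b) = map_mx (p a) E j' b); last by rewrite mxE.
    rewrite frame_derE !(addmxE, oppmxE) mulrBr.
    over.
  rewrite sumrB; congr (_ - _).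
    under [RHS]eq_bigr do rewrite mulr_suml.
    rewrite exchange_big; apply: eq_bigr => a _.
    rewrite mxE mulr_sumr; apply: eq_bigr => k _.
    by rewrite mulrA.
  by apply: eq_bigr => a _; rewrite mxE mulr_sumr.
rewrite !DE.
rewrite (_ : \sum_a \sum_c E j a * _ = \sum_a \sum_c E i a * (E j c * C a c b)).
  by under [RHS]eq_bigr do rewrite mulrBl; rewrite sumrB; ring.
rewrite exchange_big; apply: eq_bigr => a _; apply: eq_bigr => e _.
by rewrite (christoffel_mx_sym e a) mulrCA.
Qed.

Lemma coord_moving_frame : moving_frame cst D w.
Proof.
split=> [i|i r|v v0|i j k|i j f].
- split=> x y; rewrite /D /frame_der.
    by rewrite -big_split; apply: eq_bigr => a _; rewrite (derD (pd a)) mulrDr.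
  rewrite mulr_suml mulr_sumr -big_split; apply: eq_bigr => a _.
  by rewrite (derM (pd a)) /=; ring.
- by rewrite /D /frame_der big1 // => a _; rewrite p_cst mulr0.
- pose v' := \row_k v k.
  have v'E : v' *m E = 0.
    apply/matrixP=> i b; rewrite mxE [RHS]mxE.
    rewrite (ord1 i); move: b; apply: p_free => f.
    rewrite -[RHS](v0 f) /D /frame_der.
    under eq_bigr do rewrite mulr_suml; rewrite exchange_big.
    apply: eq_bigr => k _; rewrite mulr_sumr.
    by apply: eq_bigr => a _; rewrite mxE mulrA.
  have : v' = 0 by rewrite -[v']mulmx1 -mul_frame_inv mulmxA v'E mul0mx.
  by move=> /matrixP v'0 k; have := v'0 0 k; rewrite !mxE.
- rewrite /w /frame_connection -sumrN; apply: eq_bigr => a _.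
  rewrite -mulrN; congr (_ * _).
  by have := congr1 (fun X : 'M[A]_n => X k j) (connection_form_skew a); rewrite !mxE.
- have DD i' j' : D i' (D j' f) = \sum_b D i' (E j' b) * p b f
      + \sum_a \sum_b E i' a * E j' b * p a (p b f).
    rewrite {1 2}/D /frame_der.
    under eq_bigr => a _.
      rewrite (der_sum (pd a)) mulr_sumr.
      under eq_bigr do rewrite (derM (pd a)) mulrDr.
      rewrite big_split.
      over.
    rewrite big_split; congr (_ + _).
      rewrite exchange_big; apply: eq_bigr => b _.
      by rewrite mulr_suml; apply: eq_bigr => a _; rewrite mulrA.
    by apply: eq_bigr => a _; apply: eq_bigr => b _; rewrite mulrA.
  rewrite !DD (_ : \sum_a \sum_b E j a * _ * _ =
      \sum_a \sum_b E i a * E j b * p a (p b f)); last first.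
    rewrite exchange_big; apply: eq_bigr => a _; apply: eq_bigr => b _.
    by rewrite pC [E j b * _]mulrC.
  rewrite opprD addrACA subrr addr0 -sumrB.
  under eq_bigr => b _ do rewrite -mulrBl frame_der_bracketE mulr_suml.
  rewrite exchange_big; apply: eq_bigr => k _.
  by rewrite mulr_sumr; apply: eq_bigr => b _; rewrite mulrA.
Qed.

(** [connection_form] is the gauge transform of [christoffel_mx] by [E], and the
    curvature of a connection transforms by conjugation. *)
Lemma gauge_curvature a b :
  map_mx (p a) (om b) - map_mx (p b) (om a) + om b *m om a - om a *m om b
  = E *m coord_curv a b *m Ei.
Proof.
have omE e : om e = map_mx (p e) E *m Ei + E *m C e *m Ei.
  by rewrite /om /connection_form mulmxDl.
have dEi e : map_mx (p e) Ei = - (Ei *m map_mx (p e) E *m Ei).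
  apply/eqP; rewrite -addr_eq0; apply/eqP.
  have /(congr1 (map_mx (p e))) := mul_inv_frame.
  rewrite (dermxM (pd e)) der1mx => /(congr1 (mulmx^~ Ei)).
  by rewrite mulmxDl mul0mx -!mulmxA mul_frame_inv mulmx1.
have dom e f : map_mx (p e) (om f) + om f *m om e =
    (map_mx (p e) (map_mx (p f) E) + map_mx (p e) E *m C f
     + E *m map_mx (p e) (C f) + map_mx (p f) E *m C e + E *m C f *m C e) *m Ei.
  have omE' : om f = (map_mx (p f) E + E *m C f) *m Ei by [].
  have dom : map_mx (p e) (om f) = (map_mx (p e) (map_mx (p f) E) +
      (map_mx (p e) E *m C f + E *m map_mx (p e) (C f))) *m Ei -
      om f *m (map_mx (p e) E *m Ei).
    rewrite {1}omE' (dermxM (pd e) _ Ei) dEi (dermxD (pd e)) (dermxM (pd e) E).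
    by rewrite mulmxN (omE' : om f = _) !mulmxA.
  have ome : om f *m om e = om f *m (map_mx (p e) E *m Ei)
      + (map_mx (p f) E + E *m C f) *m (C e *m Ei).
    rewrite [in LHS](omE e) [LHS]mulmxDr -[E *m C e *m Ei]mulmxA [om f *m (E *m _)]mulmxA.
    by rewrite (_ : om f *m E = map_mx (p f) E + E *m C f) // frame_derE subrK.
  rewrite dom ome; move: (C e) (C f) => Ce Cf.
  by rewrite !(mulmxDr, mulmxDl, mulmxA); mxlin.
transitivity ((map_mx (p a) (om b) + om b *m om a) - (map_mx (p b) (om a) + om a *m om b)).
  by mxlin.
rewrite !dom /coord_curv -/C.
have -> : map_mx (p b) (map_mx (p a) E) = map_mx (p a) (map_mx (p b) E).
  by apply/matrixP=> i j; rewrite !mxE pC.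
by rewrite !(mulmxDr, mulmxDl, mulmxN, mulNmx, mulmxA); mxlin.
Qed.

(** The curvature is tensorial: the derivatives of the coefficients of [E] cancel
    against the brackets of the frame. *)
Lemma coord_curvE i j k l : curv D w i j k l =
  \sum_a \sum_b E i a * E j b * (E *m coord_curv a b *m Ei) k l.
Proof.
have Dw i' j' : D i' (w j' k l) = \sum_b D i' (E j' b) * om b k l
    + \sum_a \sum_b E i' a * E j' b * p a (om b k l).
  rewrite {1 2}/D /frame_der /w /frame_connection.
  under eq_bigr => a _.
    rewrite (der_sum (pd a)) mulr_sumr.
    under eq_bigr do rewrite (derM (pd a)) mulrDr.
    rewrite big_split.
    over.
  rewrite big_split; congr (_ + _).
    rewrite exchange_big; apply: eq_bigr => b _.
    by rewrite mulr_suml; apply: eq_bigr => a _; rewrite mulrA.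
  by apply: eq_bigr => a _; apply: eq_bigr => b _; rewrite mulrA.
have ww i' j' : \sum_m w j' k m * w i' m l =
    \sum_a \sum_b E i' a * E j' b * (om b *m om a) k l.
  under eq_bigr do rewrite mulr_sumr.
  rewrite exchange_big; apply: eq_bigr => a _.
  under [RHS]eq_bigr do rewrite mxE mulr_sumr.
  rewrite [RHS]exchange_big; apply: eq_bigr => m _.
  by rewrite mulr_suml; apply: eq_bigr => b _; rewrite -/om; ring.
have swap (F : 'I_n -> 'I_n -> A) : \sum_a \sum_b E j a * E i b * F a b =
    \sum_a \sum_b E i a * E j b * F b a.
  rewrite exchange_big; apply: eq_bigr => a _; apply: eq_bigr => b _.
  by rewrite [E j b * _]mulrC.
rewrite /curv sumrB !Dw !ww !swap.
have -> : \sum_m (w i j m - w j i m) * w m k l =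
    \sum_b D i (E j b) * om b k l - \sum_b D j (E i b) * om b k l.
  rewrite -sumrB; under [RHS]eq_bigr do rewrite -mulrBl frame_der_bracketE mulr_suml.
  rewrite exchange_big; apply: eq_bigr => m _.
  by rewrite mulr_sumr; apply: eq_bigr => b _; rewrite mulrA.
have -> : \sum_a \sum_b E i a * E j b * (E *m coord_curv a b *m Ei) k l =
   \sum_a \sum_b E i a * E j b * p a (om b k l)
   - \sum_a \sum_b E i a * E j b * p b (om a k l)
   + \sum_a \sum_b E i a * E j b * (om b *m om a) k l
   - \sum_a \sum_b E i a * E j b * (om a *m om b) k l.
  rewrite -!(sumrB, big_split) /=; apply: eq_bigr => a _.
  rewrite -!(sumrB, big_split) /=; apply: eq_bigr => b _.
  rewrite -gauge_curvature !(addmxE, oppmxE) !mulrDr !mulrN.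
  by congr (_ * _ - _ * _ + _ - _); rewrite mxE.
by ring.
Qed.

Lemma coord_ricciE j k : frame_ricci D w j k = (E *m coord_ricci *m E^T) j k.
Proof.
rewrite /frame_ricci; under eq_bigr do rewrite coord_curvE.
rewrite exchange_big /=.
under eq_bigr => a _ do rewrite exchange_big /=.
rewrite exchange_big /= !mxE.
under [RHS]eq_bigr => c _.
  rewrite mxE mulr_suml.
  over.
rewrite [RHS]exchange_big /=; apply: eq_bigr => b _.
under [RHS]eq_bigr => c _.
  rewrite !mxE mulr_sumr mulr_suml.
  over.
rewrite [RHS]exchange_big /=; apply: eq_bigr => a _.
transitivity (\sum_i E j b * ((E *m coord_curv a b *m Ei) k i * E i a)).
  by apply: eq_bigr => i _; ring.
rewrite -mulr_sumr.
have -> : \sum_i (E *m coord_curv a b *m Ei) k i * E i a = (E *m coord_curv a b) k a.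
  have := congr1 (fun X : 'M[A]_n => X k a) (mulmx1 (E *m coord_curv a b)).
  by rewrite /= -{1}mul_inv_frame mulmxA => <-; rewrite [in RHS]mxE.
rewrite mxE mulr_sumr; apply: eq_bigr => c _.
by ring.
Qed.

Lemma coord_ricci_entry b c : coord_ricci b c =
  \sum_a (map_mx (p a) (christoffel_mx b) c a - map_mx (p b) (christoffel_mx a) c a
    + (christoffel_mx b *m christoffel_mx a) c a
    - (christoffel_mx a *m christoffel_mx b) c a).
Proof.
by rewrite mxE; apply: eq_bigr => a _; rewrite /coord_curv !(addmxE, oppmxE).
Qed.

End CoordinateFrame.

(** * Cubic relations and the spin Lie algebra in a Clifford algebra *)

Section Clifford.
Variables (R : realFieldType) (A : comPzRingType) (cst : {rmorphism R -> A}).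
Variables (n N : nat) (C : 'I_n -> 'M[A]_N).
Hypothesis CC : forall i j, C i *m C j + C j *m C i = (- (2 * (i == j)%:R))%:M.

(** The skew matrix [m], an element of so(n), acting on spinors. *)
Definition spin_alg (m : 'I_n -> 'I_n -> A) : 'M[A]_N :=
  cst 4^-1 *: \sum_j \sum_k m j k *: (C j *m C k).

Definition cl (v : 'I_n -> A) : 'M[A]_N := \sum_k v k *: C k.

Local Notation S := spin_alg.

Lemma sum_delta (V : lmodType A) i (F : 'I_n -> V) :
  \sum_j (i == j)%:R *: F j = F i.
Proof.
rewrite (bigD1 i) //= eqxx scale1r big1 ?addr0 // => j /negPf.
by rewrite eq_sym => ->; rewrite scale0r.
Qed.

Lemma CCN i j : C i *m C j = - (C j *m C i) - (2 * (i == j)%:R) *: 1%:M.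
Proof.
by rewrite -[LHS](addrK (C j *m C i)) CC addrC scalemx1; congr (_ + _); rewrite raddfN.
Qed.

Lemma quad_comm b c e : C b *m C c *m C e - C e *m (C b *m C c) =
  (2 * (b == e)%:R) *: C c - (2 * (c == e)%:R) *: C b.
Proof.
rewrite -mulmxA (CCN c e) mulmxDr !mulmxN !mulmxA (CCN b e).
rewrite -scalemxAr mulmx1 mulmxDl !mulNmx -scalemxAl mul1mx.
by mxlin.
Qed.

Lemma cl_ext v v' : v =1 v' -> cl v = cl v'.
Proof. by move=> vv'; apply: eq_bigr => k _; rewrite vv'. Qed.

Lemma spin_alg_ext m m' : m =2 m' -> S m = S m'.
Proof.
move=> mm'; congr (_ *: _); apply: eq_bigr => j _; apply: eq_bigr => k _.
by rewrite mm'.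
Qed.

Lemma spin_algD m m' : S (fun j k => m j k + m' j k) = S m + S m'.
Proof.
rewrite /S -scalerDr -big_split; congr (_ *: _); apply: eq_bigr => j _.
by rewrite -big_split; apply: eq_bigr => k _; rewrite scalerDl.
Qed.

Lemma spin_algZ a m : S (fun j k => a * m j k) = a *: S m.
Proof.
rewrite /S [RHS]scalerA [a * _]mulrC -[RHS]scalerA [a *: _]scaler_sumr; congr (_ *: _).
apply: eq_bigr => j _; rewrite scaler_sumr; apply: eq_bigr => k _.
by rewrite scalerA.
Qed.

Lemma spin_algB m m' : S (fun j k => m j k - m' j k) = S m - S m'.
Proof.
rewrite -[- S m']scaleN1r -spin_algZ -spin_algD.
by apply: spin_alg_ext => j k; rewrite mulN1r.
Qed.

Lemma spin_alg_sum (I : finType) (F : I -> 'I_n -> 'I_n -> A) :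
  S (fun j k => \sum_i F i j k) = \sum_i S (F i).
Proof.
rewrite /S -scaler_sumr; congr (_ *: _).
rewrite [RHS]exchange_big; apply: eq_bigr => j _.
by rewrite [RHS]exchange_big; apply: eq_bigr => k _; rewrite scaler_suml.
Qed.

Lemma clD v v' : cl (fun k => v k + v' k) = cl v + cl v'.
Proof. by rewrite -big_split; apply: eq_bigr => k _; rewrite scalerDl. Qed.

Lemma clZ a v : cl (fun k => a * v k) = a *: cl v.
Proof. by rewrite scaler_sumr; apply: eq_bigr => k _; rewrite scalerA. Qed.

Lemma clB v v' : cl (fun k => v k - v' k) = cl v - cl v'.
Proof. by rewrite -sumrB; apply: eq_bigr => k _; rewrite scalerBl. Qed.

Lemma cl_sum (I : finType) (F : I -> 'I_n -> A) :
  cl (fun k => \sum_i F i k) = \sum_i cl (F i).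
Proof.
by rewrite [RHS]exchange_big; apply: eq_bigr => k _; rewrite scaler_suml.
Qed.

(** The commutator with [S m] rotates vectors infinitesimally by [m].  The factor
    1/4 is what makes this exact. *)
Lemma spin_alg_gen m e : (forall j k, m j k = - m k j) ->
  S m *m C e - C e *m S m = cl (m e).
Proof.
move=> mN; rewrite /S -scalemxAl -scalemxAr -scalerBr mulmx_suml mulmx_sumr -sumrB.
have e1 : \sum_j (e == j)%:R *: (\sum_k (2 * m j k) *: C k) =
    \sum_k (2 * m e k) *: C k by rewrite sum_delta.
have e2 : \sum_j \sum_k (e == k)%:R *: ((2 * m j k) *: C j) =
    - \sum_k (2 * m e k) *: C k.
  rewrite -sumrN; apply: eq_bigr => j _.
  by rewrite (sum_delta e (fun k => (2 * m j k) *: C j)) mN mulrN scaleNr.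
transitivity (cst 4^-1 *: (\sum_j (e == j)%:R *: (\sum_k (2 * m j k) *: C k)
    - \sum_j \sum_k (e == k)%:R *: ((2 * m j k) *: C j))).
  congr (_ *: _); rewrite -sumrB; apply: eq_bigr => j _.
  rewrite scaler_sumr mulmx_suml mulmx_sumr -!sumrB; apply: eq_bigr => k _.
  rewrite -scalemxAl -scalemxAr -scalerBr quad_comm scalerBr !scalerA.
  by rewrite (eq_sym e j) (eq_sym e k); congr (_ *: _ - _ *: _); ring.
rewrite e1 e2 opprK -big_split scaler_sumr; apply: eq_bigr => k _ /=.
rewrite -scalerDl scalerA; congr (_ *: _).
have -> : 2 * m e k + 2 * m e k = cst 4 * m e k by rewrite rmorph_nat; ring.
by rewrite mulrA -rmorphM mulVf ?pnatr_eq0 // rmorph1 mul1r.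
Qed.

Lemma spin_alg_cl m v : (forall j k, m j k = - m k j) ->
  S m *m cl v = cl v *m S m + cl (fun k => \sum_l v l * m l k).
Proof.
move=> mN; apply/eqP; rewrite addrC -subr_eq; apply/eqP.
rewrite mulmx_suml mulmx_sumr -sumrB cl_sum; apply: eq_bigr => l _.
by rewrite -scalemxAl -scalemxAr -scalerBr spin_alg_gen // clZ.
Qed.

(** [spin_alg] reverses brackets of matrices because the matrices act on row
    vectors.  This makes the curvature of the spin connection the image of the
    Riemannian curvature. *)
Lemma spin_alg_comm m q : (forall j k, m j k = - m k j) ->
  S m *m S q - S q *m S m =
  S (fun j k => \sum_l (q j l * m l k - m j l * q l k)).
Proof.
move=> mN; rewrite [S q]/S -scalemxAl -scalemxAr -scalerBr; congr (_ *: _).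
transitivity (\sum_e \sum_f q e f *: (cl (m e) *m C f + C e *m cl (m f))).
  rewrite mulmx_suml mulmx_sumr -sumrB; apply: eq_bigr => e _.
  rewrite mulmx_suml mulmx_sumr -sumrB; apply: eq_bigr => f _.
  rewrite -scalemxAl -scalemxAr -scalerBr; congr (_ *: _).
  rewrite -!spin_alg_gen // mulmxBl mulmxBr !mulmxA; mxlin.
have -> : \sum_j \sum_k (\sum_l (q j l * m l k - m j l * q l k)) *: (C j *m C k)
  = \sum_j \sum_k \sum_l (q j l * m l k) *: (C j *m C k)
    + \sum_j \sum_k \sum_l (q l k * m l j) *: (C j *m C k).
  rewrite -big_split; apply: eq_bigr => j _.
  rewrite -big_split; apply: eq_bigr => k _.
  rewrite -big_split scaler_suml; apply: eq_bigr => l _.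
  by rewrite /= -scalerDl (mN l j); congr (_ *: _); ring.
under eq_bigr => e _.
  under eq_bigr do rewrite scalerDr.
  rewrite big_split.
  over.
rewrite big_split [LHS]addrC; congr (_ + _).
  apply: eq_bigr => e _; rewrite [RHS]exchange_big; apply: eq_bigr => f _.
  rewrite /= /cl mulmx_sumr scaler_sumr; apply: eq_bigr => k _.
  by rewrite -scalemxAr scalerA.
under [RHS]eq_bigr => j _ do rewrite exchange_big.
rewrite [RHS]exchange_big; apply: eq_bigr => e _.
rewrite [RHS]exchange_big; apply: eq_bigr => f _.
rewrite /cl mulmx_suml scaler_sumr; apply: eq_bigr => k _.
by rewrite -scalemxAl scalerA.
Qed.

(** By [quad_comm], rotating the indices cyclically changes the sum by a multiple
    of a single vector.  By the cyclic identity the three rotated sums add up to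
    zero, which determines the sum. *)
Lemma cliff_cubic (r : 'I_n -> 'I_n -> 'I_n -> A) :
  (forall i j k, r i j k = - r i k j) ->
  (forall i j k, r i j k + r j k i + r k i j = 0) ->
  \sum_i \sum_j \sum_k r i j k *: (C i *m C j *m C k)
  = 2 *: cl (fun k => \sum_i r i k i).
Proof.
move=> rN rcyc.
pose Q := \sum_i \sum_j \sum_k r i j k *: (C i *m C j *m C k).
pose V := cl (fun k => \sum_i r i k i).
have V1 : \sum_i \sum_j \sum_k (i == k)%:R *: (r i j k *: C j) = V.
  rewrite /V /cl; under [RHS]eq_bigr do rewrite scaler_suml.
  rewrite [RHS]exchange_big; apply: eq_bigr => i _; apply: eq_bigr => j _.
  by rewrite (sum_delta i (fun k => r i j k *: C j)).
have V2 : \sum_i \sum_j \sum_k (i == j)%:R *: (r i j k *: C k) = - V.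
  rewrite -V1 -sumrN; apply: eq_bigr => i _.
  rewrite exchange_big -sumrN; apply: eq_bigr => k _.
  by rewrite -sumrN; apply: eq_bigr => j _; rewrite rN scaleNr scalerN.
have V3 : \sum_i \sum_j \sum_k (j == k)%:R *: (r i j k *: C i) = 0.
  rewrite big1 // => i _; rewrite big1 // => j _.
  rewrite (sum_delta j (fun k => r i j k *: C i)) (_ : r i j j = 0) ?scale0r //.
  by apply: (@cst_mulIn _ _ cst 1); rewrite mulr2n {1}rN addNr.
have rot (F : 'I_n -> 'I_n -> 'I_n -> 'M[A]_N) :
    \sum_i \sum_j \sum_k F i j k = \sum_i \sum_j \sum_k F k i j.
  under [RHS]eq_bigr do rewrite exchange_big.
  by rewrite [RHS]exchange_big.
have lin (F G H : 'I_n -> 'I_n -> 'I_n -> 'M[A]_N) :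
    \sum_i \sum_j \sum_k (F i j k - 2 *: G i j k + 2 *: H i j k) =
    \sum_i \sum_j \sum_k F i j k - 2 *: (\sum_i \sum_j \sum_k G i j k)
    + 2 *: (\sum_i \sum_j \sum_k H i j k).
  rewrite !scaler_sumr -sumrB -big_split; apply: eq_bigr => i _ /=.
  rewrite !scaler_sumr -sumrB -big_split; apply: eq_bigr => j _ /=.
  by rewrite !scaler_sumr -sumrB -big_split.
have qc i j k : C i *m C j *m C k = C k *m (C i *m C j)
    + (2 * (i == k)%:R) *: C j - (2 * (j == k)%:R) *: C i.
  by rewrite -addrA -quad_comm addrC subrK.
have e1 : \sum_i \sum_j \sum_k r j k i *: (C i *m C j *m C k) = Q - 2 *: V.
  have /= := (lin (fun i j k => r i j k *: (C i *m C j *m C k))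
    (fun i j k => (i == k)%:R *: (r i j k *: C j))
    (fun i j k => (j == k)%:R *: (r i j k *: C i))).
  rewrite V1 V3 -/Q scaler0 addr0 => <-.
  rewrite [LHS]rot; apply: eq_bigr => i _; apply: eq_bigr => j _.
  apply: eq_bigr => k _.
  by rewrite (qc i j k) -mulmxA; mxlin.
have e2 : \sum_i \sum_j \sum_k r k i j *: (C i *m C j *m C k) = Q - 4 *: V.
  transitivity (Q - 2 *: V + 2 *: (- V) : 'M[A]_N); last by mxlin.
  have /= := (lin (fun i j k => r i j k *: (C i *m C j *m C k))
    (fun i j k => (i == k)%:R *: (r i j k *: C j))
    (fun i j k => (i == j)%:R *: (r i j k *: C k))).
  rewrite V1 V2 -/Q => <-.
  rewrite [LHS]rot [LHS]rot; apply: eq_bigr => i _; apply: eq_bigr => j _.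
  apply: eq_bigr => k _.
  by rewrite (qc j k i) (eq_sym j i) (eq_sym k i) mulmxA; mxlin.
have : Q + (Q - 2 *: V) + (Q - 4 *: V) = 0.
  rewrite -e1 -e2 /Q -!big_split big1 //= => i _.
  rewrite -!big_split big1 //= => j _; rewrite -!big_split big1 //= => k _.
  by rewrite -!scalerDl rcyc scale0r.
move=> e; apply/eqP; rewrite -/Q -/V -subr_eq0; apply/eqP.
apply/matrixP=> s t; rewrite [RHS]zeromxE; apply: (@cst_mulIn _ _ cst 2).
have := congr1 (fun X : 'M[A]_N => X s t) e.
rewrite !(addmxE, oppmxE, scalemxE, zeromxE) => <-.
by ring.
Qed.

(** Reduces to [cliff_cubic] by moving the last generator to the front; the two
    resulting corrections combine with the contraction that [cliff_cubic] gives. *)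
Lemma cliff_cubic_l (r : 'I_n -> 'I_n -> 'I_n -> A) :
  (forall i j k, r i j k = - r j i k) ->
  (forall i j k, r i j k + r j k i + r k i j = 0) ->
  \sum_i \sum_j \sum_k r i j k *: (C i *m C j *m C k)
  = 2 *: cl (fun k => \sum_i r i k i).
Proof.
move=> rN rcyc; pose r' k i j := r i j k.
have r'N i j k : r' i j k = - r' i k j by rewrite /r' rN.
have r'cyc i j k : r' i j k + r' j k i + r' k i j = 0.
  by rewrite /r' -[RHS](rcyc i j k); ring.
pose b k := \sum_i r i k i; pose e k := \sum_j r k j j.
have ee := cliff_cubic r'N r'cyc; rewrite -/e in ee.
rewrite -/b -[RHS](subrKC (2 *: cl e)) -[X in _ = X + _]ee.
have -> : cl b = \sum_i \sum_j \sum_k (i == k)%:R *: (r i j k *: C j).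
  rewrite cl_sum; apply: eq_bigr => i _; apply: eq_bigr => j _.
  by rewrite (sum_delta i (fun k => r i j k *: C j)).
have -> : cl e = \sum_i \sum_j \sum_k (j == k)%:R *: (r i j k *: C i).
  apply: eq_bigr => i _; rewrite scaler_suml; apply: eq_bigr => j _.
  by rewrite (sum_delta j (fun k => r i j k *: C i)).
rewrite [X in _ = X + _]exchange_big.
under [X in _ = X + _]eq_bigr do rewrite exchange_big.
rewrite !scaler_sumr -sumrB -big_split; apply: eq_bigr => i _ /=.
rewrite !scaler_sumr -sumrB -big_split; apply: eq_bigr => j _ /=.
rewrite !scaler_sumr -sumrB -big_split; apply: eq_bigr => k _ /=.
rewrite -[C i *m C j *m C k](subrK (C k *m (C i *m C j))) quad_comm -mulmxA /r'.
by mxlin.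
Qed.

End Clifford.

(** * Ricci Killing spinors over a moving frame *)

Definition sqnorm (A : comPzRingType) (N : nat) (H : 'M[A]_N) (psi : 'cV[A]_N) : A :=
  (psi^T *m H *m psi) 0 0.

Section Spinor.
Variables (R : realFieldType) (A : comPzRingType) (cst : {rmorphism R -> A}).
Variables (n : nat) (d : 'I_n -> A -> A) (w : 'I_n -> 'I_n -> 'I_n -> A).
Hypothesis mf : moving_frame cst d w.
Variables (N : nat) (c : 'I_n -> 'M[R]_N).
Hypothesis cc : forall i j, c i *m c j + c j *m c i = (- (2 * (i == j)%:R))%:M.

Let dd i : derivation (d i) := mf_der mf i.
Let C i := map_mx cst (c i).
Let K := curv d w.
Let rho := frame_ricci d w.
Let S := spin_alg cst C.
Let Cl := cl C.
Implicit Types psi : 'cV[A]_N.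

Definition spin_conn i psi := map_mx (d i) psi + S (w i) *m psi.
Let nab := spin_conn.

Lemma const_clifford i j : C i *m C j + C j *m C i = (- (2 * (i == j)%:R))%:M.
Proof.
rewrite -!map_mxM -map_mxD cc map_scalar_mx rmorphN rmorphM.
by rewrite !rmorph_nat.
Qed.
Let CC := const_clifford.

Lemma dC i j : map_mx (d i) (C j) = 0.
Proof. by apply/matrixP=> s t; rewrite !mxE (mf_cst mf). Qed.

Lemma d_spin_alg i m : map_mx (d i) (S m) = S (fun j k => d i (m j k)).
Proof.
rewrite /S /spin_alg (dermxZ (dd i)) (mf_cst mf) scale0r add0r.
rewrite (dermx_sum (dd i)); congr (_ *: _); apply: eq_bigr => j _.
rewrite (dermx_sum (dd i)); apply: eq_bigr => k _.
by rewrite (dermxZ (dd i)) (dermxM (dd i)) !dC mul0mx mulmx0 addr0 scaler0 addr0.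
Qed.

Lemma d_cl i v : map_mx (d i) (Cl v) = Cl (fun k => d i (v k)).
Proof.
rewrite /Cl /cl (dermx_sum (dd i)); apply: eq_bigr => k _.
by rewrite (dermxZ (dd i)) dC scaler0 addr0.
Qed.

(** Both [spin_alg] and [curv] turn commutators of covariant derivatives into
    brackets of the connection, see [spin_alg_comm]. *)
Lemma spin_curvature i j psi :
  nab i (nab j psi) - nab j (nab i psi)
  = S (K i j) *m psi + \sum_k (w i j k - w j i k) *: nab k psi.
Proof.
have -> : \sum_k (w i j k - w j i k) *: nab k psi =
   map_mx (d i) (map_mx (d j) psi) - map_mx (d j) (map_mx (d i) psi)
   + S (fun k l => \sum_m (w i j m - w j i m) * w m k l) *m psi.
  rewrite /S (spin_alg_sum _ _ (fun m k l => (w i j m - w j i m) * w m k l)) mulmx_suml.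
  under eq_bigr do rewrite scalerDr.
  rewrite big_split /=; congr (_ + _).
    apply/matrixP=> s t; rewrite summxE !mxE (mf_bracket mf).
    by apply: eq_bigr => k _; rewrite !mxE.
  by apply: eq_bigr => k _; rewrite spin_algZ scalemxAl.
rewrite {1}/K /curv /S spin_algB spin_algD spin_algB.
rewrite -(spin_alg_comm cst CC (m := w i)); last exact: (mf_skew mf).
rewrite -/S -!d_spin_alg /nab /spin_conn !(dermxD (dd _)) !(dermxM (dd _)).
by rewrite !(mulmxDl, mulmxDr, mulmxBl, mulNmx, mulmxA); mxlin.
Qed.

Lemma spin_leibniz i v psi :
  nab i (Cl v *m psi) =
  Cl (fun k => d i (v k) + \sum_l v l * w i l k) *m psi + Cl v *m nab i psi.
Proof.
rewrite /nab /spin_conn (dermxM (dd i)) d_cl /Cl (clD C (fun k => d i (v k))) mulmxA.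
rewrite /S (spin_alg_cl cst CC); last exact: (mf_skew mf).
by rewrite -/Cl !(mulmxDl, mulmxDr, mulmxA); mxlin.
Qed.

Let Dr := ricci_derivative d w.
Let T i j k := Dr i j k - Dr j i k.
Let s := frame_scal d w.

Section RicciKilling.
Variables (mu : R) (psi : 'cV[A]_N).
Hypothesis rk : forall i, nab i psi = cst mu *: (Cl (rho i) *m psi).
Variable H : 'M[R]_N.
Hypothesis HT : H^T = H.
Hypothesis cH : forall i, (c i)^T *m H = - (H *m c i).

Lemma spin_connZ i r (phi : 'cV[A]_N) :
  nab i (cst r *: phi) = cst r *: nab i phi.
Proof.
rewrite /nab /spin_conn (dermxZ (dd i)) (mf_cst mf) scale0r add0r scalerDr.
by rewrite scalemxAr.
Qed.

(** Differentiate the equation of [psi] once more with [spin_leibniz] and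
    antisymmetrize; since nabla has no torsion, the derivatives of the Ricci tensor
    form the tensor [T]. *)
Lemma rk_curvature i j : S (K i j) *m psi =
  cst mu *: (Cl (T i j) *m psi) +
  cst (mu ^+ 2) *: ((Cl (rho j) *m Cl (rho i) - Cl (rho i) *m Cl (rho j)) *m psi).
Proof.
pose X a b k := d a (rho b k) + \sum_l rho b l * w a l k.
have TE : T i j =1 fun k => X i j k - X j i k - \sum_l (w i j l - w j i l) * rho l k.
  have DrE a b k : Dr a b k = X a b k - \sum_p w a b p * rho p k.
    rewrite /Dr /ricci_derivative -/rho /X addrAC; congr (_ + _ - _).
    rewrite -sumrN; apply: eq_bigr => p _.
    by rewrite (mf_skew mf a k p) mulNr opprK mulrC.
  move=> k; rewrite /T !DrE.
  by under [in RHS]eq_bigr do rewrite mulrBl; rewrite sumrB; ring.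
have nn a b : nab a (nab b psi) = cst mu *: (Cl (X a b) *m psi)
    + cst (mu ^+ 2) *: (Cl (rho b) *m Cl (rho a) *m psi).
  rewrite rk spin_connZ spin_leibniz rk scalerDr; congr (_ + _).
  by rewrite -scalemxAr scalerA -rmorphM -expr2 mulmxA.
have e := spin_curvature i j psi.
rewrite -[LHS](addrK (\sum_k (w i j k - w j i k) *: nab k psi)) -e !nn.
rewrite /Cl (cl_ext _ TE) (clB C (fun k => X i j k - X j i k)).
rewrite (clB C (X i j)) (cl_sum C (fun l k => (w i j l - w j i l) * rho l k)) -/Cl.
have -> : \sum_k (w i j k - w j i k) *: nab k psi = cst mu *:
    ((\sum_k Cl (fun l => (w i j k - w j i k) * rho k l)) *m psi).
  rewrite mulmx_suml scaler_sumr; apply: eq_bigr => k _.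
  by rewrite /Cl clZ rk -scalemxAl !scalerA mulrC.
by rewrite !(mulmxBl, mulmxA); mxlin.
Qed.

Lemma torsion2_mx m p (X : 'M[A]_(m, p)) : X + X = 0 -> X = 0.
Proof.
move=> X0; apply/matrixP=> a b; rewrite [RHS]mxE.
apply: (@cst_mulIn _ _ cst 1); rewrite mulr2n.
by have := congr1 (fun Y : 'M[A]_(m, p) => Y a b) X0; rewrite !mxE.
Qed.

(** Only the symmetric part of C_i C_k, which is scalar, survives against a
    symmetric matrix. *)
Lemma cl_trace_sym (a : 'I_n -> 'I_n -> A) : (forall i k, a i k = a k i) ->
  \sum_i C i *m Cl (a i) = - (\sum_i a i i) *: 1%:M.
Proof.
move=> aC; apply/eqP; rewrite -subr_eq0; apply/eqP; apply: torsion2_mx.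
have e : \sum_i C i *m Cl (a i) = \sum_i \sum_k a i k *: (C i *m C k).
  apply: eq_bigr => i _; rewrite /Cl /cl mulmx_sumr.
  by apply: eq_bigr => k _; rewrite -scalemxAr.
have e' : \sum_i C i *m Cl (a i) = \sum_i \sum_k a i k *: (C k *m C i).
  by rewrite e exchange_big; apply: eq_bigr => i _; apply: eq_bigr => k _; rewrite aC.
have : \sum_i C i *m Cl (a i) + \sum_i C i *m Cl (a i) = - (2 * \sum_i a i i) *: 1%:M.
  rewrite {1}e e' -big_split mulr_sumr -sumrN scaler_suml; apply: eq_bigr => i _.
  rewrite -big_split /= -[RHS](sum_delta i (fun k => - (2 * a i k) *: 1%:M)).
  apply: eq_bigr => k _; rewrite -scalerDr CC.
  by rewrite -[(- (2 * _))%:M]scalemx1 !scalerA; congr (_ *: _); ring.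
set Y := \sum_i _ => {}e.
transitivity ((Y + Y) + (2 * \sum_i a i i) *: 1%:M : 'M[A]_N); first by mxlin.
by rewrite e scaleNr addNr.
Qed.

(** The first Bianchi identity is the cyclic hypothesis of [cliff_cubic], and the
    vector produced there is the Ricci tensor. *)
Lemma spin_curv_contraction j :
  \sum_i C i *m S (K i j) = cst 2^-1 *: Cl (rho j).
Proof.
transitivity (cst 4^-1 *: \sum_i \sum_k \sum_l K i j k l *: (C i *m C k *m C l)).
  rewrite scaler_sumr; apply: eq_bigr => i _; rewrite /S /spin_alg -scalemxAr.
  congr (_ *: _); rewrite mulmx_sumr; apply: eq_bigr => k _.
  rewrite mulmx_sumr; apply: eq_bigr => l _.
  by rewrite -scalemxAr mulmxA.
rewrite (cliff_cubic cst CC (r := fun i k l => K i j k l)); first last.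
- move=> i k l; rewrite /K (curv_pair mf i j k l) (curv_pair mf k j l i).
  by rewrite (curv_pair mf l j i k) (bianchi1 mf).
- by move=> i k l; rewrite /K (curvNkl mf).
rewrite scalerA; congr (_ *: _).
have -> : 2 = cst 2 by rewrite rmorph_nat.
by rewrite -rmorphM; congr (cst _); field.
Qed.

Let rho2 j k := \sum_i rho j i * rho i k.

(** Move C_i past [Cl (rho j)] to bring it next to [Cl (rho i)], where
    [cl_trace_sym] produces the scalar curvature. *)
Lemma ricci_contraction j :
  \sum_i C i *m (Cl (rho j) *m Cl (rho i) - Cl (rho i) *m Cl (rho j))
  = (2 * s) *: Cl (rho j) - 2 *: Cl (rho2 j).
Proof.
have tr : \sum_i C i *m Cl (rho i) = - s *: 1%:M.
  exact: cl_trace_sym (frame_ricci_sym mf).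
have CCl i : C i *m Cl (rho j) = - (Cl (rho j) *m C i) - (2 * rho j i) *: 1%:M.
  rewrite {1}/Cl /cl mulmx_sumr.
  under eq_bigr => k _ do rewrite -scalemxAr (CCN CC i k) scalerBr scalerN !scalerA.
  rewrite sumrB sumrN; congr (- _ - _).
    by rewrite mulmx_suml; apply: eq_bigr => k _; rewrite -scalemxAl.
  rewrite -[RHS](sum_delta i (fun k => (2 * rho j k) *: 1%:M)).
  by apply: eq_bigr => k _; rewrite scalerA; congr (_ *: _); ring.
under eq_bigr => i _ do rewrite mulmxBr !mulmxA CCl mulmxBl mulNmx -scalemxAl mul1mx
  -[Cl (rho j) *m C i *m _]mulmxA.
rewrite !sumrB sumrN -mulmx_sumr -mulmx_suml tr.
have -> : \sum_i (2 * rho j i) *: Cl (rho i) = 2 *: Cl (rho2 j).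
  rewrite /rho2 /Cl (cl_sum C (fun i k => rho j i * rho i k)) scaler_sumr.
  by apply: eq_bigr => i _; rewrite clZ scalerA.
by rewrite -scalemxAr -scalemxAl mulmx1 mul1mx; mxlin.
Qed.

Lemma rk_contraction j : cst 2^-1 *: (Cl (rho j) *m psi) =
  cst mu *: ((\sum_i C i *m Cl (T i j)) *m psi) +
  cst (mu ^+ 2) *: (((2 * s) *: Cl (rho j) - 2 *: Cl (rho2 j)) *m psi).
Proof.
rewrite scalemxAl -spin_curv_contraction -ricci_contraction !mulmx_suml !scaler_sumr.
rewrite -big_split; apply: eq_bigr => i _.
by rewrite /= -[C i *m S _ *m _]mulmxA rk_curvature [LHS]mulmxDr -!scalemxAr !mulmxA.
Qed.

Lemma rk_double_contraction : - (cst 2^-1 * s) *: psi =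
  cst mu *: ((\sum_j \sum_i C j *m (C i *m Cl (T i j))) *m psi) +
  (cst (mu ^+ 2) * (2 * (\sum_j rho2 j j) - 2 * s * s)) *: psi.
Proof.
have tr : \sum_i C i *m Cl (rho i) = - s *: 1%:M.
  exact: cl_trace_sym (frame_ricci_sym mf).
have rhoC : forall j k, rho j k = rho k j := frame_ricci_sym mf.
have rho2C j k : rho2 j k = rho2 k j.
  rewrite /rho2; apply: eq_bigr => i _.
  by rewrite mulrC (rhoC j i) (rhoC i k).
have tr2 := cl_trace_sym rho2C.
transitivity (\sum_j C j *m (cst 2^-1 *: (Cl (rho j) *m psi))).
  under eq_bigr => j _ do rewrite -scalemxAr mulmxA.
  by rewrite -scaler_sumr -mulmx_suml tr -scalemxAl mul1mx scalerA mulrN.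
transitivity (\sum_j (cst mu *: ((\sum_i C j *m (C i *m Cl (T i j))) *m psi) +
  cst (mu ^+ 2) *: (((2 * s) *: (C j *m Cl (rho j)) - 2 *: (C j *m Cl (rho2 j)))
    *m psi))).
  apply: eq_bigr => j _; rewrite rk_contraction mulmxDr -!scalemxAr !mulmxA.
  by rewrite mulmx_sumr mulmxBr -!scalemxAr.
rewrite big_split -!scaler_sumr -!mulmx_suml sumrB -!scaler_sumr tr tr2 /=.
congr (_ + _); rewrite -scalerA; congr (_ *: _).
rewrite !scalerA -scalerBl -scalemxAl mul1mx; congr (_ *: _).
by ring.
Qed.

Let Hc := map_mx cst H.
Let pair (u v : 'cV[A]_N) : A := (u^T *m Hc *m v) 0 0.
Let normsq := sqnorm Hc psi.

Lemma pairC u v : pair u v = pair v u.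
Proof.
have HcT : Hc^T = Hc by rewrite /Hc map_trmx HT.
rewrite /pair (_ : v^T *m Hc *m u = (u^T *m Hc *m v)^T); first by rewrite [RHS]mxE.
by rewrite !trmx_mul trmxK HcT mulmxA.
Qed.

Lemma pairD u v v' : pair u (v + v') = pair u v + pair u v'.
Proof. by rewrite /pair mulmxDr mxE. Qed.

Lemma pairZ u a v : pair u (a *: v) = a * pair u v.
Proof. by rewrite /pair -scalemxAr mxE. Qed.

Lemma pair_sum (I : Type) (r : seq I) (P : pred I) u (F : I -> 'cV[A]_N) :
  pair u (\sum_(i <- r | P i) F i) = \sum_(i <- r | P i) pair u (F i).
Proof. by rewrite /pair mulmx_sumr summxE. Qed.

Lemma pair_gen i u v : pair (C i *m u) v = - pair u (C i *m v).
Proof.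
rewrite /pair trmx_mul -!mulmxA [(C i)^T *m _]mulmxA.
have -> : (C i)^T *m Hc = - (Hc *m C i).
  by rewrite /C /Hc map_trmx -!map_mxM -map_mxN cH.
by rewrite mulNmx mulmxN !mulmxA mxE.
Qed.

(** Clifford multiplication by a vector is skew for the form. *)
Lemma pair_cl v : pair psi (Cl v *m psi) = 0.
Proof.
rewrite /Cl /cl mulmx_suml pair_sum big1 // => k _.
rewrite -scalemxAl pairZ (_ : pair _ _ = 0) ?mulr0 //.
apply: (@cst_mulIn _ _ cst 1); rewrite mulr2n.
by rewrite {1}pairC pair_gen addNr.
Qed.

Lemma pair_quad i k : pair psi (C i *m C k *m psi) = - (i == k)%:R * normsq.
Proof.
have sym a b : pair psi (C a *m C b *m psi) = - pair (C a *m psi) (C b *m psi).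
  by rewrite pair_gen opprK mulmxA.
apply/eqP; rewrite -subr_eq0; apply/eqP.
apply: (@cst_mulIn _ _ cst 1); rewrite mulr2n.
have e : pair psi (C i *m C k *m psi) + pair psi (C i *m C k *m psi) =
    - (2 * (i == k)%:R) * normsq.
  have e2 : pair psi (C i *m C k *m psi) = pair psi (C k *m C i *m psi).
    by rewrite !sym pairC.
  by rewrite {2}e2 -pairD -mulmxDl CC mul_scalar_mx pairZ.
transitivity (pair psi (C i *m C k *m psi) + pair psi (C i *m C k *m psi)
  + 2 * (i == k)%:R * normsq); first by ring.
by rewrite e; ring.
Qed.

(** Both the spin connection and the derivative prescribed by [rk] act on [psi]
    by operators that are skew for the form. *)
Lemma normsq_const i : d i normsq = 0.
Proof.
have dp : d i normsq = pair psi (map_mx (d i) psi) + pair psi (map_mx (d i) psi).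
  rewrite {1}pairC /normsq /sqnorm.
  have := congr1 (fun X : 'M[A]_1 => X 0 0) (dermxM (dd i) (psi^T *m Hc) psi).
  rewrite /= mxE (dermxM (dd i)) => ->.
  rewrite (_ : map_mx (d i) Hc = 0); last first.
    by apply/matrixP=> a b; rewrite !mxE (mf_cst mf).
  by rewrite mulmx0 addr0 -map_trmx mxE.
have Sp : pair psi (S (w i) *m psi) = 0.
  rewrite /S /spin_alg -scalemxAl pairZ mulmx_suml pair_sum big1 ?mulr0 // => j _.
  rewrite mulmx_suml pair_sum.
  under eq_bigr => k _ do rewrite -scalemxAl pairZ pair_quad mulNr mulrN mulrCA -mulrN.
  rewrite (sum_delta j (fun k => - (w i j k * normsq) : A^o)).
  have -> : w i j j = 0.
    by apply: (@cst_mulIn _ _ cst 1); rewrite mulr2n {1}(mf_skew mf) addNr.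
  by rewrite mul0r oppr0.
rewrite dp; have -> : map_mx (d i) psi = nab i psi + (- 1) *: (S (w i) *m psi).
  by rewrite scaleN1r addrK.
by rewrite pairD pairZ Sp rk pairZ pair_cl !mulr0 !addr0.
Qed.

(** In the pairing of [rk_contraction] with [psi] all Clifford vectors vanish
    and what remains is the contraction of [T], that is div Ric - d Scal, which
    [ricci_divergence] turns into - d Scal / 2. *)
Lemma scal_const j : cst mu * d j s * normsq = 0.
Proof.
have /(congr1 (pair psi)) := rk_contraction j.
rewrite pairD !pairZ mulmxBl pairD -scalemxAl pairZ !pair_cl.
have -> : pair psi (- (2 *: Cl (rho2 j) *m psi)) = 0.
  by rewrite -scaleN1r -scalemxAl !pairZ pair_cl !mulr0.
rewrite !mulr0 !addr0 mulmx_suml pair_sum mulr0 addr0.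
have e i : pair psi (C i *m Cl (T i j) *m psi) = - T i j i * normsq.
  rewrite /Cl /cl mulmx_sumr mulmx_suml pair_sum.
  under eq_bigr => k _ do rewrite -scalemxAr -scalemxAl pairZ pair_quad mulNr mulrN mulrCA -mulrN.
  by rewrite (sum_delta i (fun k => - (T i j k * normsq) : A^o)) mulNr.
under eq_bigr => i _ do rewrite e.
rewrite -mulr_suml sumrN /T sumrB (scal_derivative mf) -(ricci_divergence mf).
set D := \sum_i Dr i j i => e0.
have -> : cst mu * (D + D) * normsq =
    cst mu * (- (D - (D + D)) * normsq) + cst mu * (- (D - (D + D)) * normsq) by ring.
by rewrite -e0 addr0.
Qed.

(** In [rk_double_contraction] the derivatives of the Ricci tensor form a cubic
    Clifford sum, which [cliff_cubic_l] reduces to a vector: [T] is skew in its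
    first two indices, and cyclic because the Ricci tensor is symmetric.  The
    pairing with [psi] then only sees the scalars. *)
Lemma ricci_norm : cst 2^-1 * s * normsq =
  cst (mu ^+ 2) * (2 * s * s - 2 * \sum_j \sum_i rho j i * rho i j) * normsq.
Proof.
have /(congr1 (pair psi)) := rk_double_contraction.
rewrite pairD !pairZ.
have -> : \sum_j \sum_i C j *m (C i *m Cl (T i j)) =
  \sum_j \sum_i \sum_k T i j k *: (C j *m C i *m C k).
  apply: eq_bigr => j _; apply: eq_bigr => i _; rewrite mulmxA mulmx_sumr.
  by apply: eq_bigr => k _; rewrite -scalemxAr.
rewrite (cliff_cubic_l cst CC (r := fun j i k => T i j k)); first last.
- have DrC a b e : Dr a b e = Dr a e b.
    have rhoC : forall j k, rho j k = rho k j := frame_ricci_sym mf.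
    rewrite /Dr /ricci_derivative -/rho (rhoC b e) addrAC.
    by congr (_ - _ - _); apply: eq_bigr => p _; rewrite rhoC.
  by move=> i j k; rewrite /T (DrC i k j) (DrC k j i) (DrC j i k); ring.
- by move=> i j k; rewrite /= /T; ring.
rewrite -scalemxAl pairZ pair_cl !mulr0 add0r -[pair psi psi]/normsq => e.
have -> : forall x : A, x * normsq = - (- x * normsq) by move=> x; ring.
by rewrite e /rho2; ring.
Qed.

End RicciKilling.
End Spinor.

(** * Several real variables: differentiability and symmetry of second derivatives *)

Local Open Scope classical_set_scope.
Local Open Scope ring_scope.

Section Calculus.
Variables (R : realType) (n : nat).
Implicit Types (f g : 'rV[R]_n -> R) (x y v h : 'rV[R]_n).
Local Notation e a := (delta_mx 0 a : 'rV[R]_n).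

Lemma coord_le_norm v a : `|v 0 a| <= `|v|.
Proof.
rewrite [leRHS]/Num.Def.normr /= mx_normrE.
exact: (le_bigmax _ (fun i : 'I_1 * 'I_n => `|v i.1 i.2|) (0, a)).
Qed.

Lemma norm_le_coord v r : 0 <= r -> (forall a, `|v 0 a| <= r) -> `|v| <= r.
Proof.
move=> r0 vr; rewrite [leLHS]/Num.Def.normr /= mx_normrE.
by apply: bigmax_le => // -[i a] _ /=; rewrite (ord1 i).
Qed.

Lemma is_derive_line f x v (t : R) : derivable f (x + t *: v) v ->
  is_derive t 1 (fun s : R => f (x + s *: v)) ('D_v f (x + t *: v)).
Proof.
move=> df.
have E : (fun h : R => h^-1 *: (((fun s : R => f (x + s *: v)) \o shift t) (h *: (1 : R)) -
      f (x + t *: v))) =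
    (fun h : R => h^-1 *: ((f \o shift (x + t *: v)) (h *: v) - f (x + t *: v))).
  apply/funext => h /=; congr (_ *: (f _ - _)).
  by rewrite [_%:A]mulr1 scalerDl addrCA.
by apply: DeriveDef; rewrite /derivable /derive E.
Qed.

(** Stated with absolute values so that [h] may have any sign. *)
Lemma line_mvt f x v (h : R) :
  (forall t : R, `|t| <= `|h| -> derivable f (x + t *: v) v) ->
  exists2 c : R, `|c| <= `|h| & f (x + h *: v) - f x = h * 'D_v f (x + c *: v).
Proof.
move=> df; pose phi (s : R) := f (x + s *: v).
have dphi (t : R) : `|t| <= `|h| -> is_derive t 1 phi ('D_v f (x + t *: v)).
  by move=> th; apply: is_derive_line; apply: df.
have mvt (a b : R) : a <= b -> (forall t, a <= t <= b -> `|t| <= `|h|) ->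
    exists2 c : R, `|c| <= `|h| & phi b - phi a = 'D_v f (x + c *: v) * (b - a).
  move=> ab abh.
  have dphi' (t : R) : t \in `]a, b[ -> is_derive t 1 phi ('D_v f (x + t *: v)).
    by rewrite in_itv /= => /andP[/ltW at_ /ltW tb]; apply/dphi/abh; rewrite at_.
  have cphi : {within `[a, b], continuous phi}.
    apply: derivable_within_continuous => t.
    by rewrite in_itv /= => /abh /dphi [].
  have [c c01 e] := MVT_segment ab dphi' cphi.
  by exists c => //; apply: abh; move: c01; rewrite in_itv.
have phi0 : phi 0 = f x by rewrite /phi scale0r addr0.
have [h0|/ltW h0] := leP 0 h.
  have [|c ch e] := mvt 0 h h0.
    by move=> t /andP[t0 th]; rewrite !ger0_norm.
  by exists c => //; rewrite -phi0 -/(phi h) e subr0 mulrC.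
have [|c ch e] := mvt h 0 h0.
  by move=> t /andP[t0 th]; rewrite !ler0_norm ?lerN2.
by exists c => //; rewrite -phi0 -/(phi h) -opprB e sub0r mulrN opprK mulrC.
Qed.

(** The successive [trunc_row k h] lead from 0 to [h] by changing one coordinate
    at a time. *)
Definition trunc_row (k : nat) h : 'rV[R]_n := \row_b (if (b < k)%N then h 0 b else 0).

Lemma trunc_rowS (k : 'I_n) h : trunc_row k.+1 h = trunc_row k h + h 0 k *: e k.
Proof.
apply/rowP => b; rewrite !mxE eqxx /= ltnS leq_eqVlt (inj_eq val_inj).
case: (b =P k) => [->|_] /=; first by rewrite ltnn add0r mulr1.
by rewrite mulr0 addr0.
Qed.

Lemma trunc_row_norm k h (i : 'I_n) (t : R) : `|t| <= `|h 0 i| -> (k <= i)%N ->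
  `|trunc_row k h + t *: e i| <= `|h|.
Proof.
move=> th ki; apply: norm_le_coord => // b; rewrite !mxE eqxx /=.
case: (b =P i) => [->|_] /=.
  rewrite ltnNge ki /= add0r mulr1; apply: le_trans th _; exact: coord_le_norm.
rewrite mulr0 addr0; case: ifP => _; first exact: coord_le_norm.
by rewrite normr0.
Qed.

(** The mean value theorem on each step of the path [trunc_row] compares the
    increment with the partial derivative at [x]. *)
Lemma frechet_estimate f x (r eps : R) (W : set 'rV[R]_n) : 0 <= eps ->
  (forall y, `|y - x| <= r -> W y) ->
  (forall a y, W y -> derivable f y (e a)) ->
  (forall a y, W y -> `|'D_(e a) f y - 'D_(e a) f x| <= eps) ->
  forall h, `|h| <= r ->
  `|f (x + h) - f x - \sum_a h 0 a * 'D_(e a) f x| <= n%:R * eps * `|h|.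
Proof.
move=> eps0 rW df Df h hr.
have xW y : `|y| <= `|h| -> W (x + y).
  by move=> yh; apply: rW; rewrite addrC addKr (le_trans yh).
have step (k : 'I_n) : `|f (x + trunc_row k.+1 h) - f (x + trunc_row k h)
    - h 0 k * 'D_(e k) f x| <= eps * `|h|.
  rewrite trunc_rowS addrA.
  have [t|c ch ->] := @line_mvt f (x + trunc_row k h) (e k) (h 0 k).
    by move=> th; apply: df; rewrite -addrA; apply/xW/trunc_row_norm.
  rewrite -mulrBr normrM mulrC; apply: ler_pM => //; last exact: coord_le_norm.
  by apply: Df; rewrite -addrA; apply/xW/trunc_row_norm.
have t0 : trunc_row 0 h = 0 by apply/rowP => b; rewrite !mxE.
have tn : trunc_row n h = h by apply/rowP => b; rewrite !mxE ltn_ord.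
have -> : f (x + h) - f x = \sum_(k < n) (f (x + trunc_row k.+1 h) - f (x + trunc_row k h)).
  rewrite -(big_mkord xpredT (fun k => f (x + trunc_row k.+1 h) - f (x + trunc_row k h))).
  by rewrite telescope_sumr // tn t0 addr0.
rewrite -sumrB (le_trans (ler_norm_sum _ _ _)) //.
have -> : n%:R * eps * `|h| = \sum_(k < n) eps * `|h|.
  by rewrite sumr_const card_ord -mulrA mulr_natl.
by apply: ler_sum => k _; apply: step.
Qed.

Definition lform (D : 'I_n -> R) v : R := \sum_a v 0 a * D a.

Lemma lform_is_linear D : linear (lform D).
Proof.
move=> k u v; rewrite /lform scaler_sumr -big_split; apply: eq_bigr => a _ /=.
by rewrite !mxE mulrDl -mulrA.
Qed.

HB.instance Definition _ D := GRing.isLinear.Build R 'rV[R]_n R _ (lform D)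
  (lform_is_linear D).

Lemma lform_continuous D : continuous (lform D).
Proof.
apply: continuous_big => [|a _]; first exact: add_continuous.
move=> v; apply: (@continuous_comp _ _ _ (fun v : 'rV[R]_n => v 0 a)
  (fun x : R => x * D a)); first exact: coord_continuous.
by apply: continuousM; [exact: cvg_id|exact: cvg_cst].
Qed.

Definition C1_on (W : set 'rV[R]_n) f := forall a x, W x ->
  derivable f x (e a) /\ {for x, continuous ('D_(e a) f)}.

(** [frechet_estimate] applied with the oscillation of the partial derivatives
    near [x], which is arbitrarily small by continuity. *)
Lemma C1_differentiable W f x : open W -> C1_on W f -> W x ->
  differentiable f x /\ 'd f x = lform (fun a => 'D_(e a) f x) :> (_ -> _).
Proof.
move=> oW fC1 Wx.
pose D a := 'D_(e a) f x.
have E : f \o shift x = cst (f x) + lform D +o_ (0 : 'rV[R]_n) id.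
  apply/eqaddoP => eps eps0.
  (* n + 1 rather than n, in case n = 0 *)
  pose eps' := eps / (n%:R + 1).
  have eps'0 : 0 < eps' by rewrite divr_gt0 // ltr_wpDl.
  pose W' := W `&` [set y | forall a, `|'D_(e a) f y - D a| <= eps'].
  have nW : nbhs x W'.
    apply: filterI; first exact: open_nbhs_nbhs.
    apply: (@filter_forall _ _ _ (nbhs x) _) => a.
    have [_ /cvgrPdist_le /(_ _ eps'0)] := fC1 a x Wx.
    by apply: (@filterS _ (nbhs x) _) => y; rewrite distrC.
  move: nW => /nbhs_normP[r /= r0 rW].
  apply/(@nbhs_normP _ _ (0 : 'rV[R]_n)); exists (r / 2) => [|h].
    by rewrite /= divr_gt0.
  rewrite /= sub0r normrN => /ltW hr.
  change (`|f (h + x) - (f x + lform D h)| <= eps * `|h|).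
  have := @frechet_estimate f x (r / 2) eps' W' (ltW eps'0) _ _ _ h hr.
  rewrite opprD addrA [h + x]addrC => est; apply: le_trans (est _ _ _) _.
  - move=> y yx; apply: rW; rewrite /ball_ /= distrC (le_lt_trans yx) //.
    by rewrite ltr_pdivrMr // ltr_pMr // ltrDl.
  - by move=> a y [/fC1 H _]; case: (H a).
  - by move=> a y [].
  rewrite ler_wpM2r // /eps' mulrA ler_pdivrMr ?ltr_wpDl // mulrC ler_wpM2l //.
    exact: ltW.
  by rewrite lerDl.
have dfE := diff_unique (@lform_continuous D) E.
by split=> //; apply/diff_locallyP; rewrite dfE; split=> //; exact: lform_continuous.
Qed.

Lemma C1_derive W f x v : open W -> C1_on W f -> W x ->
  derivable f x v /\ 'D_v f x = \sum_a v 0 a * 'D_(e a) f x.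
Proof.
move=> oW fC1 Wx; have [df dfE] := C1_differentiable oW fC1 Wx.
by split; [exact: diff_derivable|rewrite deriveE // dfE].
Qed.

Lemma locally_constant W f x : open W -> C1_on W f -> W x ->
  (forall a y, W y -> 'D_(e a) f y = 0) -> \forall y \near x, f y = f x.
Proof.
move=> oW fC1 Wx f0; have /nbhs_normP[r /= r0 rW] : nbhs x W by exact: open_nbhs_nbhs.
apply/nbhs_normP; exists r => //= y; rewrite /= distrC => yr.
have xW (t : R) : `|t| <= `|1 : R| -> W (x + t *: (y - x)).
  move=> t1; apply: rW; rewrite /ball_ /= opprD addrA subrr sub0r normrN normrZ.
  by apply: le_lt_trans yr; rewrite ler_piMl // -[leRHS]normr1.
have [|c c1] := @line_mvt f x (y - x) 1.
  by move=> t /xW Wt; have [] := C1_derive (y - x) oW fC1 Wt.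
have [_ ->] := C1_derive (y - x) oW fC1 (xW c c1).
rewrite scale1r [x + _]addrC subrK mul1r big1 => [/subr0_eq //|a _].
by rewrite f0 ?mulr0 //; apply: xW.
Qed.

(** The mean value theorem twice: for the increment in the direction b as a
    function along the direction a, then for the a-th partial derivative along b. *)
Lemma second_difference W f x (r h : R) (a b : 'I_n) :
  (forall y, `|y - x| <= r -> W y) -> `|h| + `|h| <= r ->
  (forall y, W y -> derivable f y (e a)) ->
  (forall y, W y -> derivable ('D_(e a) f) y (e b)) ->
  exists2 y, `|y - x| <= r & f (x + h *: e a + h *: e b) - f (x + h *: e a)
     - f (x + h *: e b) + f x = h * h * 'D_(e b) ('D_(e a) f) y.
Proof.
move=> rW hr dfa dfb.
have near_x (s t : R) : `|s| <= `|h| -> `|t| <= `|h| -> `|x + s *: e a + t *: e b - x| <= r.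
  move=> sh th; rewrite addrC !addrA addNr add0r (le_trans (ler_normD _ _)) //.
  have eN (c : 'I_n) (u : R) : `|u *: e c| <= `|u|.
    apply: norm_le_coord => // i; rewrite !mxE eqxx /=.
    by case: (i == c); rewrite ?mulr1 // mulr0 normr0.
  by apply: le_trans hr; apply: lerD; [apply: le_trans (eN a s) sh|apply: le_trans (eN b t) th].
pose phi z := f (z + h *: e b) - f z.
have dphi (t : R) : `|t| <= `|h| -> is_derive (x + t *: e a) (e a) phi
    ('D_(e a) f (x + t *: e a + h *: e b) - 'D_(e a) f (x + t *: e a)).
  move=> th.
  have d1 : is_derive (x + t *: e a) (e a) f ('D_(e a) f (x + t *: e a)).
    by apply: derivableP; apply/dfa/rW; rewrite -[X in X - _]addr0 -(scale0r (e b));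
      apply: near_x; rewrite ?normr0.
  have d2 : is_derive (x + t *: e a) (e a) (fun z => f (z + h *: e b))
      ('D_(e a) f (x + t *: e a + h *: e b)).
    have df2 : derivable f (x + t *: e a + h *: e b) (e a) by apply/dfa/rW/near_x.
    have E : (fun k : R => k^-1 *: (((fun z => f (z + h *: e b)) \o shift (x + t *: e a)) (k *: e a)
        - f (x + t *: e a + h *: e b))) =
      (fun k : R => k^-1 *: ((f \o shift (x + t *: e a + h *: e b)) (k *: e a)
        - f (x + t *: e a + h *: e b))).
      by apply/funext => k /=; rewrite !addrA.
    by apply: DeriveDef; rewrite /derivable /derive E.
  exact: is_deriveB.
have [|s sh] := @line_mvt phi x (e a) h; first by move=> t /dphi [].
have [_ ->] := dphi s sh.
have [|t th ->] := @line_mvt ('D_(e a) f) (x + s *: e a) (e b) h.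
  by move=> t th; apply/dfb/rW/near_x.
move=> E; exists (x + s *: e a + t *: e b); first exact: near_x.
by rewrite -mulrA -E /phi; ring.
Qed.

(** By [second_difference] both mixed derivatives, at suitable points near [x],
    equal the same second difference quotient; they are continuous at [x]. *)
Lemma schwarz W f x a b : open W -> W x ->
  C1_on W f -> (forall c, C1_on W ('D_(e c) f)) ->
  'D_(e a) ('D_(e b) f) x = 'D_(e b) ('D_(e a) f) x.
Proof.
move=> oW Wx fC1 dfC1; apply/eqP; rewrite -subr_eq0 -normr_le0.
apply/ler_addgt0Pl => eps eps0; rewrite addr0.
pose P y := W y /\ (`|'D_(e a) ('D_(e b) f) x - 'D_(e a) ('D_(e b) f) y| <= eps / 2 /\
  `|'D_(e b) ('D_(e a) f) x - 'D_(e b) ('D_(e a) f) y| <= eps / 2).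
have eps2 : 0 < eps / 2 by rewrite divr_gt0.
have /nbhs_normP[r /= r0 rP] : nbhs x P.
  have [_ /cvgrPdist_le /(_ _ eps2) c1] := dfC1 b a x Wx.
  have [_ /cvgrPdist_le /(_ _ eps2) c2] := dfC1 a b x Wx.
  apply: (@filterI _ (nbhs x) _); first exact: open_nbhs_nbhs.
  exact: (@filterI _ (nbhs x) _ _ _ c1 c2).
have rP' y : `|y - x| <= r / 2 -> P y.
  move=> yr; apply: rP; rewrite /ball_ /= distrC (le_lt_trans yr) //.
  by rewrite ltr_pdivrMr // ltr_pMr // ltrDl.
have rW y : `|y - x| <= r / 2 -> W y by case/rP'.
(* two increments of length h stay within r / 2 *)
pose h := r / 4.
have h0 : 0 < h by rewrite divr_gt0.
have hr : `|h| + `|h| <= r / 2.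
  by rewrite (ger0_norm (ltW h0)) (_ : r / 2 = h + h) // /h; field.
have [y yr e1] := @second_difference W f x (r / 2) h a b rW hr
  (fun y Wy => (fC1 a y Wy).1) (fun y Wy => (dfC1 a b y Wy).1).
have [z zr e2] := @second_difference W f x (r / 2) h b a rW hr
  (fun y Wy => (fC1 b y Wy).1) (fun y Wy => (dfC1 b a y Wy).1).
have pp : f (x + h *: e b + h *: e a) = f (x + h *: e a + h *: e b).
  by congr f; rewrite addrAC.
have [_ [_ yb]] := rP' y yr; have [_ [za _]] := rP' z zr.
rewrite pp in e2.
have cancel (u v p q r' s t : R) : t != 0 -> p - q - r' + s = t * t * u ->
    p - r' - q + s = t * t * v -> u = v.
  move=> t0 eu ev; apply: (mulfI (mulf_neq0 t0 t0)).
  by rewrite -eu -ev [p - q - r']addrAC.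
have E := cancel _ _ _ _ _ _ _ (lt0r_neq0 h0) e1 e2.
have finish (u v p q : R) : `|p - v| <= eps / 2 -> `|q - u| <= eps / 2 ->
    u = v -> `|p - q| <= eps.
  move=> pv qu uv; rewrite [leRHS](splitr eps).
  by apply: le_trans (ler_distD v _ _) (lerD pv _); rewrite -uv distrC.
exact: finish za yb E.
Qed.

End Calculus.

(** * The chain rule and the stability of smoothness *)

Lemma derive_coord (R : realType) (n : nat) (x v : 'rV[R]_n) k :
  derivable (fun y : 'rV[R]_n => y 0 k) x v
  /\ 'D_v (fun y : 'rV[R]_n => y 0 k) x = v 0 k.
Proof.
have di : derivable (@id 'rV[R]_n) x v by exact: derivable_id.
split; first by have [H _] := derivable_mxP (@id 'rV[R]_n) x v; exact: H di 0 k.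
by have := derive_mx di; rewrite derive_id => /(congr1 (fun M : 'rV[R]_n => M 0 k)); rewrite mxE.
Qed.

Section ChainRule.
Variables (R : realType) (n m : nat).
Variables (f : 'rV[R]_m -> R) (tau : 'rV[R]_n -> 'rV[R]_m) (x v : 'rV[R]_n).
Variable (W : set 'rV[R]_m).
Hypothesis oW : open W.
Hypothesis fC1 : C1_on W f.
Hypothesis Wx : W (tau x).
Hypothesis dtau : forall b, derivable (fun y => tau y 0 b) x v.

(** Restricting to the line through [x] directed by [v] leaves a function of one
    variable, where differentiability of the curve is that of its components. *)
Lemma chain_rule : derivable (f \o tau) x v /\
  'D_v (f \o tau) x = \sum_b 'D_v (fun y => tau y 0 b) x * 'D_(delta_mx 0 b) f (tau x).
Proof.
pose gam (h : R) := tau (h *: v + x).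
have gam0 : gam 0 = tau x by rewrite /gam scale0r add0r.
have dgamb b : derivable (fun h : R => gam h 0 b) (0 : R) 1.
  have [H _] := derivable1P (fun y => tau y 0 b) x v. exact: H (@dtau b).
have dgam : derivable gam (0 : R) 1.
  by apply/derivable_mxP => i b; rewrite (ord1 i); exact: dgamb.
have diffgam : differentiable gam (0 : R) by exact/derivable1_diffP.
have [difff difffE] := C1_differentiable oW fC1 Wx.
have difff' : differentiable f (gam 0) by rewrite gam0.
have diffc : differentiable (f \o gam) (0 : R) by exact: differentiable_comp.
have dfg : derivable (f \o gam) (0 : R) 1 by exact: diff_derivable.
have dft : derivable (f \o tau) x v.
  exact: (derivable1P (f \o tau) x v).2 dfg.
split=> //.
have line (g : 'rV[R]_n -> R) : derivable g x v ->
    'D_v g x = 'D_(1 : R) (fun h : R => g (h *: v + x)) (0 : R).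
  move=> dg; have := @is_derive_line R n g x v 0.
  rewrite scale0r addr0 => /(_ dg) [_ <-].
  by congr ('D_(1 : R) _ (0 : R)); apply/funext => h; rewrite addrC.
rewrite line // -[LHS]/('D_(1 : R) (f \o gam) (0 : R)) deriveE // diff_comp //= gam0 difffE.
rewrite -deriveE // derive_mx //; apply: eq_bigr => b _.
rewrite mxE; congr (_ * _); apply/esym/line; exact: dtau.
Qed.

End ChainRule.

Section CkClosure.
Variables (R : realType) (n : nat) (W : set 'rV[R]_n).
Hypothesis oW : open W.
Local Notation e a := (delta_mx 0 a : 'rV[R]_n).
Implicit Types f g : 'rV[R]_n -> R.

Lemma near_open x (P : 'rV[R]_n -> Prop) : W x -> (forall y, W y -> P y) ->
  \forall y \near x, P y.
Proof.
move=> Wx WP; apply: (@filterS _ (nbhs x) _ W) => //.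
exact: open_nbhs_nbhs.
Qed.

Lemma continuous_eq_on f g x : W x -> (forall y, W y -> f y = g y) ->
  {for x, continuous f} -> {for x, continuous g}.
Proof.
move=> Wx fg cf.
have fgn : \forall y \near x, f y = g y by exact: near_open.
have H : g y @[y --> x] `=>` f y @[y --> x] by exact: near_eq_cvg fgn.
have : g y @[y --> x] --> f x by exact: cvg_trans H cf.
by rewrite (fg x Wx).
Qed.

Lemma Ck_eq k f g : (forall x, W x -> f x = g x) -> Ck k W f -> Ck k W g.
Proof.
elim: k f g => [|k IH] f g fg /= [cf Hf].
  by split=> // x Wx; exact: continuous_eq_on fg (cf x Wx).
have fgn x : W x -> \forall y \near x, f y = g y by move=> Wx; exact: near_open.
split; first by move=> x Wx; exact: continuous_eq_on fg (cf x Wx).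
move=> a; have [df Cf] := Hf a; split.
  by move=> x Wx; apply: near_eq_derivable (df x Wx); exact: fgn.
by apply: IH Cf => x Wx; apply: near_eq_derive; exact: fgn.
Qed.

Lemma CkS k f : Ck k.+1 W f -> Ck k W f.
Proof.
elim: k f => [|k IH] f /= [cf Hf]; first by split.
by split=> // a; have [df Cf] := Hf a; split=> //; exact: IH.
Qed.

Lemma Ck_cst k (c : R) : Ck k W (cst c).
Proof.
elim: k c => [|k IH] c /=; split=> //; try by move=> x Wx; exact: cst_continuous.
move=> a; split; first by move=> x _; exact: derivable_cst.
rewrite (_ : (fun _ => _) = cst 0); first exact: IH.
by apply/funext => x; rewrite derive_cst.
Qed.

Lemma CkD k f g : Ck k W f -> Ck k W g -> Ck k W (fun x => f x + g x).
Proof.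
elim: k f g => [|k IH] f g /= [cf Hf] [cg Hg].
all: split; first by move=> x Wx; exact: continuousD (cf x Wx) (cg x Wx).
  by [].
move=> a; have [df Cf] := Hf a; have [dg Cg] := Hg a; split.
  by move=> x Wx; exact: derivableD (df x Wx) (dg x Wx).
apply: Ck_eq (IH _ _ Cf Cg) => x Wx.
exact/esym/(deriveD (df x Wx) (dg x Wx)).
Qed.

(** The product rule involves [f] and [g] themselves, hence the appeal to [CkS]. *)
Lemma CkM k f g : Ck k W f -> Ck k W g -> Ck k W (fun x => f x * g x).
Proof.
elim: k f g => [|k IH] f g.
  by move=> [cf _] [cg _]; split=> // x Wx; exact: continuousM (cf x Wx) (cg x Wx).
move=> Kf Kg; have [cf Hf] := Kf; have [cg Hg] := Kg.
split; first by move=> x Wx; exact: continuousM (cf x Wx) (cg x Wx).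
move=> a; have [df Cf] := Hf a; have [dg Cg] := Hg a; split.
  by move=> x Wx; exact: derivableM (df x Wx) (dg x Wx).
have := CkD (IH _ _ (CkS Kf) Cg) (IH _ _ Cf (CkS Kg)).
apply: Ck_eq => x Wx; apply/esym.
have := @deriveM _ _ f g x (e a) (df x Wx) (dg x Wx).
by move=> /= E; apply: etrans E _; congr (_ + _); exact: mulrC.
Qed.

Lemma Ck_sum k (I : Type) (r : seq I) (F : I -> 'rV[R]_n -> R) :
  (forall i, Ck k W (F i)) -> Ck k W (fun x => \sum_(i <- r) F i x).
Proof.
move=> KF; elim: r => [|i r IH].
  rewrite (_ : (fun _ => _) = cst 0); first exact: Ck_cst.
  by apply/funext => x; rewrite big_nil.
rewrite (_ : (fun _ => _) = fun x => F i x + \sum_(i <- r) F i x); first exact: CkD.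
by apply/funext => x; rewrite big_cons.
Qed.

Lemma smooth_C1 f : smooth_on W f -> C1_on W f.
Proof.
move=> sf a x Wx; have [_ H] := sf 1%N; have [df [cf _]] := H a.
by split; [exact: df|exact: cf].
Qed.

Lemma smooth_partial f a : smooth_on W f -> smooth_on W ('D_(e a) f).
Proof. by move=> sf k; have [_ H] := sf k.+1; have [] := H a. Qed.

Lemma CkW k f (W' : set 'rV[R]_n) : W' `<=` W -> Ck k W f -> Ck k W' f.
Proof.
move=> W'W; elim: k f => [|k IH] f /= [cf Hf]; split=> //; try by move=> x /W'W; exact: cf.
move=> a; have [df Cf] := Hf a; split; last exact: IH.
by move=> x /W'W; exact: df.
Qed.

End CkClosure.

Section CkComposition.
Variables (R : realType) (n m : nat) (W : set 'rV[R]_n) (V : set 'rV[R]_m).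
Hypotheses (oW : open W) (oV : open V).
Variable tau : 'rV[R]_n -> 'rV[R]_m.
Hypothesis tauV : forall x, W x -> V (tau x).
Hypothesis stau : forall b, smooth_on W (fun x => tau x 0 b).

Lemma row_continuous x : W x -> {for x, continuous tau}.
Proof.
move=> Wx; apply/(@cvgrPdist_le _ _ _ (nbhs x) _) => eps eps0.
have : \forall y \near x, forall b, `|tau x 0 b - tau y 0 b| <= eps.
  apply: (@filter_forall _ _ _ (nbhs x) _) => b.
  have [cb _] := stau b 0%N.
  by have /cvgrPdist_le := cb x Wx; apply.
apply: (@filterS _ (nbhs x) _) => y yb.
apply: norm_le_coord => [|b]; first exact: ltW.
by rewrite !mxE.
Qed.

(** Induction on [k] for all smooth [f] at once: the chain rule expresses the
    partial derivatives by the composites of [tau] with those of [f]. *)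
Lemma Ck_comp k f : smooth_on V f -> Ck k W (f \o tau).
Proof.
elim: k f => [|k IH] f sf.
all: have cft x : W x -> {for x, continuous (f \o tau)}.
1,3: move=> Wx; apply: continuous_comp; [exact: row_continuous|].
1,2: have [cf _] := sf 0%N; exact: cf (tauV Wx).
  by split.
split=> // a.
have chain x (Wx : W x) := chain_rule oV (smooth_C1 sf) (tauV Wx)
  (fun b => (smooth_C1 (stau b) a Wx).1).
split; first by move=> x Wx; have [] := chain x Wx.
have K : Ck k W (fun x => \sum_(b <- index_enum 'I_m)
    'D_(delta_mx 0 a) (fun y => tau y 0 b) x * ('D_(delta_mx 0 b) f \o tau) x).
  apply: Ck_sum => // b; apply: CkM => //; first exact: smooth_partial.
  by apply: IH; exact: smooth_partial.
by apply: Ck_eq K => // x Wx; have [_ ->] := chain x Wx.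
Qed.

End CkComposition.

(** * The ring of smooth functions on an open set *)

(** The functions are extended by zero outside [W], so that equality on [W] is
    Leibniz equality, in which the ring axioms are stated. *)
Record smooth_fun (R : realType) (n : nat) (W : set 'rV[R]_n) (oW : open W) :=
  SmoothFun {
    sf_val :> 'rV[R]_n -> R;
    sf_smooth : smooth_on W sf_val;
    sf_out : forall x, ~ W x -> sf_val x = 0 }.

Section SmoothFun.
Variables (R : realType) (n : nat) (W : set 'rV[R]_n) (oW : open W).
Local Notation A := (smooth_fun oW).
Implicit Types a b c : A.
Local Notation e i := (delta_mx 0 i : 'rV[R]_n).

HB.instance Definition _ := gen_eqMixin A.
HB.instance Definition _ := gen_choiceMixin A.

Lemma sf_eq a b : (forall x, W x -> a x = b x) -> a = b.
Proof.
move=> ab.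
have : sf_val a = sf_val b.
  apply/funext => x; have [/ab //|Wx] := pselect (W x).
  by rewrite !sf_out.
case: a b {ab} => [f sf f0] [g sg g0] /= fg; subst g.
by congr SmoothFun; exact: Prop_irrelevance.
Qed.

Definition sf_restrict (f : 'rV[R]_n -> R) x := if pselect (W x) then f x else 0.

Lemma sf_restrictE f x : W x -> sf_restrict f x = f x.
Proof. by rewrite /sf_restrict; case: pselect. Qed.

Lemma sf_restrict_smooth f : smooth_on W f -> smooth_on W (sf_restrict f).
Proof.
by move=> sf k; apply: Ck_eq (sf k) => // x Wx; rewrite sf_restrictE.
Qed.

Lemma sf_restrict_out f x : ~ W x -> sf_restrict f x = 0.
Proof. by rewrite /sf_restrict; case: pselect. Qed.

Definition sf_mk f (sf : smooth_on W f) : A :=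
  SmoothFun oW (sf_restrict_smooth sf) (@sf_restrict_out f).

Lemma sf_mkE f (sf : smooth_on W f) x : W x -> sf_mk sf x = f x.
Proof. exact: sf_restrictE. Qed.

Fact sf_cst_smooth (r : R) : smooth_on W (cst r).
Proof. by move=> k; exact: Ck_cst. Qed.
Definition sf_cst r := sf_mk (sf_cst_smooth r).

Fact sf_add_smooth a b : smooth_on W (fun x => a x + b x).
Proof. by move=> k; apply: CkD => //; exact: sf_smooth. Qed.
Definition sf_add a b := sf_mk (sf_add_smooth a b).

Fact sf_mul_smooth a b : smooth_on W (fun x => a x * b x).
Proof. by move=> k; apply: CkM => //; exact: sf_smooth. Qed.
Definition sf_mul a b := sf_mk (sf_mul_smooth a b).

Fact sf_addA : associative sf_add.
Proof. by move=> a b c; apply: sf_eq => x Wx; rewrite !sf_mkE // addrA. Qed.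
Fact sf_addC : commutative sf_add.
Proof. by move=> a b; apply: sf_eq => x Wx; rewrite !sf_mkE // addrC. Qed.
Fact sf_add0 : left_id (sf_cst 0) sf_add.
Proof. by move=> a; apply: sf_eq => x Wx; rewrite !sf_mkE // add0r. Qed.
Fact sf_addN : left_inverse (sf_cst 0) (sf_mul (sf_cst (-1))) sf_add.
Proof. by move=> a; apply: sf_eq => x Wx; rewrite !sf_mkE // mulN1r addNr. Qed.

HB.instance Definition _ := GRing.isZmodule.Build A sf_addA sf_addC sf_add0 sf_addN.

Fact sf_mulA : associative sf_mul.
Proof. by move=> a b c; apply: sf_eq => x Wx; rewrite !sf_mkE // mulrA. Qed.
Fact sf_mulC : commutative sf_mul.
Proof. by move=> a b; apply: sf_eq => x Wx; rewrite !sf_mkE // mulrC. Qed.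
Fact sf_mul1 : left_id (sf_cst 1) sf_mul.
Proof. by move=> a; apply: sf_eq => x Wx; rewrite !sf_mkE // mul1r. Qed.
Fact sf_mulD : left_distributive sf_mul sf_add.
Proof. by move=> a b c; apply: sf_eq => x Wx; rewrite !sf_mkE // mulrDl. Qed.

HB.instance Definition _ :=
  GRing.Zmodule_isComPzRing.Build A sf_mulA sf_mulC sf_mul1 sf_mulD.

Lemma sf_addE a b x : W x -> (a + b) x = a x + b x.
Proof. exact: sf_mkE. Qed.

Lemma sf_mulE a b x : W x -> (a * b) x = a x * b x.
Proof. exact: sf_mkE. Qed.

Lemma sf_oppE a x : W x -> (- a) x = - a x.
Proof. by move=> Wx; rewrite [LHS](sf_mkE _ Wx) sf_mkE // mulN1r. Qed.

Lemma sf_cstE r x : W x -> sf_cst r x = r.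
Proof. exact: sf_mkE. Qed.

Fact sf_cst_zmod : zmod_morphism sf_cst.
Proof. by move=> r s; apply: sf_eq => x Wx; rewrite sf_addE // sf_oppE // !sf_cstE. Qed.
Fact sf_cst_monoid : monoid_morphism sf_cst.
Proof.
split; first by apply: sf_eq.
by move=> r s; apply: sf_eq => x Wx; rewrite sf_mulE // !sf_cstE.
Qed.
HB.instance Definition _ := GRing.isZmodMorphism.Build R A sf_cst sf_cst_zmod.
HB.instance Definition _ := GRing.isMonoidMorphism.Build R A sf_cst sf_cst_monoid.

End SmoothFun.

(** * Functions in different charts *)

Section Charts.
Variables (R : realType) (n : nat) (M : manifold R n).
Implicit Types (i j : chart M) (W : set M) (f g : M -> R) (p q : M).
Local Notation e a := (delta_mx 0 a : 'rV[R]_n).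

Lemma image_open i W : open W -> W `<=` dom i -> open (phi i @` W).
Proof.
move=> oW Wi; rewrite openE => x [p Wp <-]; rewrite /interior.
have dx : (phi i @` dom i) (phi i p) by exists p => //; exact: Wi.
have n1 : nbhs (phi i p) (phi i @` dom i) by apply: open_nbhs_nbhs; split=> //; exact: phi_open.
have n2 : nbhs (phi i p) (phiV i @^-1` W).
  apply: (phiV_continuous dx); rewrite phiK; last exact: Wi.
  exact: open_nbhs_nbhs.
apply: (@filterS _ (nbhs (phi i p)) _ _ _ _ (@filterI _ (nbhs (phi i p)) _ _ _ n1 n2)).
move=> y [[q dq <-] /=]; rewrite phiK // => Wq.
by exists q.
Qed.

Lemma pard_eq i W f g a p : open W -> W `<=` dom i -> W p ->
  (forall q, W q -> f q = g q) -> pard i a f p = pard i a g p.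
Proof.
move=> oW Wi Wp fg; apply: near_eq_derive.
apply: (near_open (image_open oW Wi)); first by exists p.
by move=> y [q Wq <-] /=; rewrite phiK ?fg //; exact: Wi.
Qed.

Lemma smooth_in_eq i W f g : open W -> W `<=` dom i ->
  (forall q, W q -> f q = g q) -> smooth_in i W f -> smooth_in i W g.
Proof.
move=> oW Wi fg sf k; apply: Ck_eq (sf k); first exact: image_open.
by move=> y [q Wq <-] /=; rewrite phiK ?fg //; exact: Wi.
Qed.

Lemma smooth_inW i W W' f : W' `<=` W -> smooth_in i W f -> smooth_in i W' f.
Proof. by move=> W'W sf k; apply: CkW (sf k); exact: image_subset. Qed.

Lemma smooth_in_pard i W f a : open W -> W `<=` dom i ->
  smooth_in i W f -> smooth_in i W (pard i a f).
Proof.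
move=> oW Wi sf k; have := smooth_partial a sf k; apply: Ck_eq; first exact: image_open.
by move=> y [q Wq <-] /=; rewrite phiK //; exact: Wi.
Qed.

Section Change.
Variables (i j : chart M) (W : set M).
Hypotheses (oW : open W) (Wi : W `<=` dom i) (Wj : W `<=` dom j).

Lemma transition_coord_smooth b : smooth_on (phi i @` W) (fun x => phi j (phiV i x) 0 b).
Proof.
move=> k; apply: CkW (transition_smooth i j b k).
by apply: image_subset => q Wq; split; [exact: Wi|exact: Wj].
Qed.

Lemma smooth_in_coord b : smooth_in i W (fun q => phi j q 0 b).
Proof. exact: transition_coord_smooth. Qed.

Lemma transition_image x : (phi i @` W) x -> (phi j @` W) (phi j (phiV i x)).
Proof. by move=> [q Wq <-]; exists q => //; rewrite phiK //; exact: Wi. Qed.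

Lemma transition_comp f x : (phi i @` W) x ->
  ((f \o phiV j) \o (phi j \o phiV i)) x = (f \o phiV i) x.
Proof. move=> [q Wq <-] /=; have := Wi Wq; have := Wj Wq => qj qi.
by rewrite !phiK. Qed.

Lemma smooth_in_change f : smooth_in j W f -> smooth_in i W f.
Proof.
move=> sf k.
have := Ck_comp (image_open oW Wi) (image_open oW Wj) (tau := phi j \o phiV i)
  transition_image transition_coord_smooth k sf.
apply: Ck_eq; first exact: image_open.
exact: transition_comp.
Qed.

Lemma pard_change f a p : smooth_in j W f -> W p ->
  pard i a f p = \sum_b jac i j p a b * pard j b f p.
Proof.
move=> sf Wp.
have Vp : (phi j @` W) ((phi j \o phiV i) (phi i p)).
  by apply: transition_image; exists p.
have Up : (phi i @` W) (phi i p) by exists p.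
have [_ E] := chain_rule (image_open oW Wj) (smooth_C1 sf) Vp
  (fun b => (smooth_C1 (transition_coord_smooth b) a Up).1).
transitivity ('D_(e a) ((f \o phiV j) \o (phi j \o phiV i)) (phi i p)).
  apply: near_eq_derive; apply: (near_open (image_open oW Wi)) => // y Wy.
  by rewrite transition_comp.
rewrite E; apply: eq_bigr => b _; rewrite mxE /pard /dird; congr (_ * _).
by rewrite /= phiK //; exact: Wi.
Qed.

End Change.
End Charts.

(** * Partial derivatives as derivations *)

Section PardCalculus.
Variables (R : realType) (n : nat) (M : manifold R n) (j : chart M) (W : set M).
Hypotheses (oW : open W) (Wj : W `<=` dom j).
Implicit Types (f g : M -> R) (p : M).
Local Notation e a := (delta_mx 0 a : 'rV[R]_n).

Let Wp_image p : W p -> (phi j @` W) (phi j p).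
Proof. by move=> Wp; exists p. Qed.

Lemma smooth_in_derivable f a p : smooth_in j W f -> W p ->
  derivable (f \o phiV j) (phi j p) (e a).
Proof. by move=> sf /Wp_image Up; have [] := smooth_C1 sf a Up. Qed.

Lemma pardD f g a p : smooth_in j W f -> smooth_in j W g -> W p ->
  pard j a (fun q => f q + g q) p = pard j a f p + pard j a g p.
Proof.
move=> sf sg Wp.
have E := deriveD (@smooth_in_derivable f a p sf Wp) (@smooth_in_derivable g a p sg Wp).
exact: etrans E _.
Qed.

Lemma pardM f g a p : smooth_in j W f -> smooth_in j W g -> W p ->
  pard j a (fun q => f q * g q) p = pard j a f p * g p + f p * pard j a g p.
Proof.
move=> sf sg Wp.
have E := deriveM (@smooth_in_derivable f a p sf Wp) (@smooth_in_derivable g a p sg Wp).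
have mix (F f' G g' a1 b1 : R) : F = f' -> G = g' ->
    F *: a1 + G *: b1 = b1 * g' + f' * a1.
  by move=> -> ->; rewrite addrC; congr (_ + _); exact: mulrC.
have val (h : M -> R) : (h \o phiV j) (phi j p) = h p by rewrite /= phiK //; exact: Wj.
apply: (etrans E); exact: (mix _ _ _ _ _ _ (val f) (val g)).
Qed.

Lemma pard_cst r a p : pard j a (fun=> r) p = 0.
Proof. exact: derive_cst. Qed.

Lemma pardC f a b p : smooth_in j W f -> W p ->
  pard j a (pard j b f) p = pard j b (pard j a f) p.
Proof.
move=> sf Wp; have oU := image_open oW Wj; have Up := Wp_image Wp.
have E c d : pard j c (pard j d f) p = 'D_(e c) ('D_(e d) (f \o phiV j)) (phi j p).
  apply: near_eq_derive; apply: (near_open oU) => // y [q Wq <-].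
  by rewrite /= phiK //; exact: Wj.
apply: etrans (E a b) _; apply: etrans _ (esym (E b a)).
exact: (schwarz a b oU Up (smooth_C1 sf) (fun c => smooth_C1 (smooth_partial c sf))).
Qed.

Lemma pard_coord a b p : W p -> pard j a (fun q => phi j q 0 b) p = (a == b)%:R.
Proof.
move=> Wp; have [_ E] := derive_coord (phi j p) (e a) b.
transitivity ('D_(e a) (fun y : 'rV[R]_n => y 0 b) (phi j p)).
  apply: near_eq_derive; apply: (near_open (image_open oW Wj)); first exact: Wp_image.
  by move=> y [q Wq <-] /=; rewrite phiK //; exact: Wj.
by rewrite E mxE eqxx eq_sym.
Qed.

End PardCalculus.

Section ChartRing.
Variables (R : realType) (n : nat) (M : manifold R n) (i : chart M) (W : set M).
Hypotheses (oW : open W) (Wi : W `<=` dom i).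
Implicit Types (f g : M -> R) (p q : M).

Definition chart_ring := smooth_fun (image_open oW Wi).
HB.instance Definition _ := GRing.ComPzRing.on chart_ring.
Local Notation A := chart_ring.
Implicit Types a b : A.

Definition chart_cst : {rmorphism R -> A} := sf_cst (image_open oW Wi).

(** The function on the manifold that an element of the ring represents, to be
    used on [W] only. *)
Definition low a : M -> R := fun q => sf_val a (phi i q).

(** Made total by sending the functions that are not smooth to 0; the lemmas about
    it assume smoothness. *)
Definition lift f : A :=
  if pselect (smooth_in i W f) is left sf then sf_mk (image_open oW Wi) sf else 0.

Let image_in p : W p -> (phi i @` W) (phi i p).
Proof. by move=> Wp; exists p. Qed.

Lemma low_inj a b : (forall p, W p -> low a p = low b p) -> a = b.
Proof. by move=> ab; apply: sf_eq => x [p Wp <-]; exact: ab. Qed.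

Lemma liftE f p : smooth_in i W f -> W p -> low (lift f) p = f p.
Proof.
rewrite /low /lift => sf Wp; case: pselect => // sf'.
by rewrite sf_mkE /= ?phiK //; [exact: Wi|exact: image_in].
Qed.

Lemma low_smooth a : smooth_in i W (low a).
Proof.
move=> k; have := sf_smooth a k; apply: Ck_eq; first exact: image_open.
by move=> y [q Wq <-]; rewrite /low /= phiK //; exact: Wi.
Qed.

(** Evaluation at a point of [W].  Identities in the ring are proved by applying
    this morphism at all points, see [ev_inj]. *)
Definition ev p (_ : W p) a : R := low a p.

Fact ev_zmod p (Wp : W p) : zmod_morphism (ev Wp).
Proof.
move=> a b; rewrite /ev /low (sf_addE _ _ (image_in Wp)).
by rewrite (sf_oppE _ (image_in Wp)).
Qed.
Fact ev_monoid p (Wp : W p) : monoid_morphism (ev Wp).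
Proof.
split; first exact: (sf_cstE (image_open oW Wi) 1 (image_in Wp)).
by move=> a b; exact: (sf_mulE _ _ (image_in Wp)).
Qed.
HB.instance Definition _ p (Wp : W p) :=
  GRing.isZmodMorphism.Build A R (ev Wp) (ev_zmod Wp).
HB.instance Definition _ p (Wp : W p) :=
  GRing.isMonoidMorphism.Build A R (ev Wp) (ev_monoid Wp).

Lemma ev_cst p (Wp : W p) r : ev Wp (chart_cst r) = r.
Proof. exact: sf_cstE (image_in Wp). Qed.

Lemma ev_inj a b : (forall p (Wp : W p), ev Wp a = ev Wp b) -> a = b.
Proof. by move=> ab; apply: low_inj => p Wp; exact: (ab p Wp). Qed.

Section Derivations.
Variable j : chart M.
Hypothesis Wj : W `<=` dom j.

(** The chart [j] that differentiates may differ from the chart [i] in which the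
    ring is read: comparing two charts requires both families of derivations on the
    same ring. *)
Definition chart_der (c : 'I_n) a : A := lift (pard j c (low a)).
Local Notation D := chart_der.

Lemma low_smooth_in a : smooth_in j W (low a).
Proof. exact: (smooth_in_change oW Wj Wi (low_smooth a)). Qed.

Lemma chart_derE p (Wp : W p) c a : ev Wp (D c a) = pard j c (low a) p.
Proof.
apply: liftE => //; apply: (smooth_in_change oW Wi Wj).
exact: (smooth_in_pard c oW Wj (low_smooth_in a)).
Qed.

Lemma chart_der_lift p (Wp : W p) c f : smooth_in i W f ->
  ev Wp (D c (lift f)) = pard j c f p.
Proof.
move=> sf; rewrite chart_derE; apply: (pard_eq c oW Wj Wp) => q Wq.
exact: liftE.
Qed.

Lemma chart_der_derivation c : derivation (D c).
Proof.
split=> a b; apply: ev_inj => p Wp.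
  rewrite rmorphD /= !chart_derE -(pardD c (low_smooth_in a) (low_smooth_in b) Wp).
  by apply: (pard_eq c oW Wj Wp) => q Wq; exact: (rmorphD (ev Wq)).
rewrite rmorphD !rmorphM /= !chart_derE.
rewrite -(pardM Wj c (low_smooth_in a) (low_smooth_in b) Wp).
by apply: (pard_eq c oW Wj Wp) => q Wq; exact: (rmorphM (ev Wq)).
Qed.

Lemma chart_der_cst c r : D c (chart_cst r) = 0.
Proof.
apply: ev_inj => p Wp; rewrite chart_derE rmorph0 -(pard_cst j r c p).
by apply: (pard_eq c oW Wj Wp) => q Wq; exact: (ev_cst Wq).
Qed.

Lemma chart_derC k l a : D k (D l a) = D l (D k a).
Proof.
have E p (Wp : W p) k' l' :
    ev Wp (D k' (D l' a)) = pard j k' (pard j l' (low a)) p.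
  rewrite chart_derE; apply: (pard_eq k' oW Wj Wp) => q Wq.
  exact: (chart_derE Wq).
apply: ev_inj => p Wp; apply: etrans (E p Wp k l) _.
apply: etrans _ (esym (E p Wp l k)); exact: (pardC oW Wj k l (low_smooth_in a) Wp).
Qed.

(** Apply the relation to the coordinate functions of the chart. *)
Lemma chart_der_free (v : 'I_n -> A) :
  (forall a, \sum_k v k * D k a = 0) -> forall k, v k = 0.
Proof.
move=> v0 k; rewrite -[RHS](v0 (lift (fun q => phi j q 0 k))).
have Dc l : D l (lift (fun q => phi j q 0 k)) = (l == k)%:R.
  apply: ev_inj => p Wp; rewrite chart_der_lift; last exact: smooth_in_coord.
  by rewrite (pard_coord oW Wj) // rmorph_nat.
rewrite (bigD1 k) //= Dc eqxx mulr1 big1 ?addr0 // => l /negPf lk.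
by rewrite Dc lk mulr0.
Qed.

End Derivations.
End ChartRing.

(** * The metric and its curvature over a chart *)

Section PointwiseGeometry.
Variables (R : realType) (n : nat) (M : manifold R n) (g : metric M).
Variables (j : chart M).
Implicit Types p q : M.
Local Notation e a := (delta_mx 0 a : 'rV[R]_n).

Lemma levi_civita_basis a Y p d : levi_civita g j (e a) Y p 0 d =
  pard j a (fun q => Y q 0 d) p + \sum_b christoffel g j p d a b * Y p 0 b.
Proof.
rewrite mxE; congr (_ + _); rewrite (bigD1 a) //= [X in _ + X]big1 ?addr0 => [|a' /negPf aa'].
  by apply: eq_bigr => b _; rewrite mxE !eqxx mulr1.
by rewrite big1 // => b _; rewrite mxE aa' andbF mulr0 mul0r.
Qed.

Lemma ricci_tensor_basis p b c : ricci_tensor g j p (e b) (e c) =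
  \sum_a (pard j a (fun q => christoffel g j q a b c) p
    - pard j b (fun q => christoffel g j q a a c) p
    + \sum_d christoffel g j p a a d * christoffel g j p d b c
    - \sum_d christoffel g j p a b d * christoffel g j p d a c).
Proof.
have lc k q d : levi_civita g j (e k) (fun=> e c) q 0 d = christoffel g j q d k c.
  rewrite levi_civita_basis pard_cst add0r (bigD1 c) //= mxE !eqxx mulr1.
  by rewrite big1 ?addr0 // => k' /negPf kc; rewrite mxE eqxx kc mulr0.
have lc2 k l d : levi_civita g j (e k) (levi_civita g j (e l) (fun=> e c)) p 0 d =
    pard j k (fun q => christoffel g j q d l c) p
    + \sum_b' christoffel g j p d k b' * christoffel g j p b' l c.
  rewrite levi_civita_basis; congr (_ + _).
    by congr (pard j k _ p); apply/funext => q; exact: lc.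
  by apply: eq_bigr => b' _; rewrite lc.
have aux (x y z t : R) : x + y - (z + t) = x - z + y - t by ring.
rewrite /ricci_tensor; apply: eq_bigr => a _; rewrite /riemann addmxE oppmxE.
by rewrite (lc2 a b a) (lc2 b a a) aux.
Qed.

Definition ricci_mx p : 'M[R]_n :=
  \matrix_(b, c) ricci_tensor g j p (e b) (e c).

(** The matrix form of the fact that a metric is recovered from an orthonormal
    frame. *)
Lemma metric_unit p (F : 'M[R]_n) : F *m gmx g j p *m F^T = 1%:M ->
  (gmx g j p \in unitmx) /\ invmx (gmx g j p) = F^T *m F.
Proof.
move=> Fg; have FgF : gmx g j p *m (F^T *m F) = 1%:M.
  by rewrite mulmxA; apply: mulmx1C; rewrite mulmxA.
have [gu _] := mulmx1_unit FgF; split=> //.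
by rewrite -[RHS](mulKmx gu) FgF mulmx1.
Qed.

Lemma ricci_mxE p : gmx g j p \in unitmx -> ricci_mx p = Ric g j p *m gmx g j p.
Proof. by move=> gu; rewrite /Ric mulmxKV. Qed.

End PointwiseGeometry.

Section ChartGeometry.
Variables (R : realType) (n : nat) (M : manifold R n) (g : metric M).
Variables (i j : chart M) (W : set M).
Hypotheses (oW : open W) (Wi : W `<=` dom i) (Wj : W `<=` dom j).
Variable F : M -> 'M[R]_n.
Hypothesis F_smooth : forall a b, smooth_in i W (fun p => F p a b).
Hypothesis F_orthonormal : forall p, W p -> F p *m gmx g j p *m (F p)^T = 1%:M.

Local Notation A := (chart_ring oW Wi).
Local Notation cst := (chart_cst oW Wi).

Definition lift_mx k l (X : M -> 'M[R]_(k, l)) : 'M[A]_(k, l) :=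
  \matrix_(a, b) lift oW Wi (fun p => X p a b).

Lemma ev_lift_mx k l (X : M -> 'M[R]_(k, l)) p (Wp : W p) :
  (forall a b, smooth_in i W (fun p => X p a b)) ->
  map_mx (ev Wp) (lift_mx X) = X p.
Proof. by move=> sX; apply/matrixP => a b; rewrite !mxE; exact: liftE. Qed.

Lemma mx_ev_inj k l (X Y : 'M[A]_(k, l)) :
  (forall p (Wp : W p), map_mx (ev Wp) X = map_mx (ev Wp) Y) -> X = Y.
Proof.
move=> XY; apply/matrixP => a b; apply: ev_inj => p Wp.
by have /matrixP/(_ a b) := XY p Wp; rewrite !mxE.
Qed.

Definition metric_lift : 'M[A]_n := lift_mx (gmx g j).
Local Notation G := metric_lift.
Local Notation E := (lift_mx F).
Local Notation D := (chart_der (oW := oW) (Wi := Wi) j).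

Lemma metric_smooth_in a b : smooth_in i W (fun p => gmx g j p a b).
Proof.
apply: (smooth_in_change oW Wi Wj); apply: (smooth_inW Wj).
exact: gmx_smooth.
Qed.

Lemma ev_metric p (Wp : W p) : map_mx (ev Wp) G = gmx g j p.
Proof. by apply: ev_lift_mx; exact: metric_smooth_in. Qed.

Lemma ev_frame p (Wp : W p) : map_mx (ev Wp) E = F p.
Proof. exact: ev_lift_mx. Qed.

Lemma metric_liftT : G^T = G.
Proof.
apply: mx_ev_inj => p Wp; rewrite -map_trmx ev_metric gmx_sym //.
exact: Wj.
Qed.

Lemma frame_lift_orthonormal : E *m G *m E^T = 1%:M.
Proof.
apply: mx_ev_inj => p Wp; rewrite !map_mxM -map_trmx ev_frame ev_metric.
by rewrite F_orthonormal // map_mx1.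
Qed.

Let dD := chart_der_derivation oW Wi Wj.
Let dcst := chart_der_cst oW Wi Wj.
Let dC := chart_derC (oW := oW) (Wi := Wi) Wj.

Definition chart_frame_der : 'I_n -> A -> A := frame_der D E.
Definition chart_connection : 'I_n -> 'I_n -> 'I_n -> A := frame_connection cst D G E.

Lemma chart_moving_frame : moving_frame cst chart_frame_der chart_connection.
Proof.
exact: (coord_moving_frame dD dcst dC (chart_der_free Wj) metric_liftT
  frame_lift_orthonormal).
Qed.

Lemma ev_christoffel p (Wp : W p) a b d :
  ev Wp (christoffel_mx cst D G E a b d) = christoffel g j p d a b.
Proof.
have gT q : W q -> (gmx g j q)^T = gmx g j q by move=> /Wj; exact: gmx_sym.
have [gu gi] := metric_unit (F_orthonormal Wp).
rewrite /christoffel_mx mxE rmorph_sum /christoffel mulr_sumr.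
apply: eq_bigr => l _; rewrite rmorphM /=.
have -> : ev Wp ((E^T *m E) l d) = invmx (gmx g j p) d l.
  have -> : ev Wp ((E^T *m E) l d) = (map_mx (ev Wp) (E^T *m E)) l d by rewrite [RHS]mxE.
  rewrite map_mxM -map_trmx ev_frame -gi.
  by rewrite -[in RHS](gT p Wp) -trmx_inv [RHS]mxE.
have evM (r : R) (x : A) : ev Wp (cst r * x) = r * ev Wp x.
  by rewrite rmorphM; congr (_ * _); exact: ev_cst.
rewrite mxE evM rmorphB rmorphD !mxE.
have dl x y z : ev Wp (D x (lift oW Wi (fun q => gmx g j q y z))) =
    pard j x (fun q => gmx g j q y z) p.
  exact: (chart_der_lift oW Wi Wj Wp x (metric_smooth_in y z)).
rewrite /= !dl.
by rewrite -mulrA [_ * invmx _ _ _]mulrC.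
Qed.

(** The Christoffel symbols are represented by the ring elements
    [christoffel_mx]. *)
Lemma christoffel_smooth a b d : smooth_in i W (fun q => christoffel g j q d a b).
Proof.
have := low_smooth (christoffel_mx cst D G E a b d).
by apply: smooth_in_eq => // q Wq; exact: (ev_christoffel Wq).
Qed.

Lemma christoffel_lift a b d :
  christoffel_mx cst D G E a b d = lift oW Wi (fun q => christoffel g j q d a b).
Proof.
apply: ev_inj => p Wp; rewrite ev_christoffel; apply/esym/liftE => //.
exact: christoffel_smooth.
Qed.

Lemma ev_coord_ricci p (Wp : W p) :
  map_mx (ev Wp) (coord_ricci cst D G E) = ricci_mx g j p.
Proof.
have ev4 (x y z t : A) :
    ev Wp (x - y + z - t) = ev Wp x - ev Wp y + ev Wp z - ev Wp t.
  by rewrite rmorphB rmorphD rmorphB.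
have evd x k l m : ev Wp (map_mx (D x) (christoffel_mx cst D G E k) l m) =
    pard j x (fun q => christoffel g j q m k l) p.
  rewrite mxE christoffel_lift.
  exact: (chart_der_lift oW Wi Wj Wp _ (christoffel_smooth _ _ _)).
have evmm k l m q : ev Wp ((christoffel_mx cst D G E k *m christoffel_mx cst D G E l) m q)
    = \sum_d christoffel g j p q l d * christoffel g j p d k m.
  rewrite mxE rmorph_sum; apply: eq_bigr => d _; rewrite rmorphM mulrC.
  by congr (_ * _); exact: ev_christoffel.
apply/matrixP => b c; rewrite [LHS]mxE [RHS]mxE ricci_tensor_basis.
rewrite coord_ricci_entry rmorph_sum; apply: eq_bigr => a _.
apply: (etrans (ev4 _ _ _ _)).
have congr4 (x x' y y' z z' t t' : R) : x = x' -> y = y' -> z = z' -> t = t' ->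
    x - y + z - t = x' - y' + z' - t' by move=> -> -> -> ->.
exact: (congr4 _ _ _ _ _ _ _ _ (evd a b c a) (evd b a c a) (evmm b a c a)
  (evmm a b c a)).
Qed.

(** The row indexed by a of [F p] holds the components of the a-th frame vector,
    hence both sides are the values of the Ricci tensor on the frame. *)
Lemma ev_frame_ricci p (Wp : W p) :
  \matrix_(a, b) ev Wp (frame_ricci chart_frame_der chart_connection a b) =
  F p *m (Ric g j p *m gmx g j p) *m (F p)^T.
Proof.
have [gu _] := metric_unit (F_orthonormal Wp).
rewrite -ricci_mxE // -ev_coord_ricci -ev_frame map_trmx -!map_mxM.
apply/matrixP => a b; rewrite mxE [RHS]mxE; congr (ev Wp _).
exact: (coord_ricciE dD dcst dC metric_liftT frame_lift_orthonormal).
Qed.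

Lemma ev_frame_scal p (Wp : W p) :
  ev Wp (frame_scal chart_frame_der chart_connection) = Scal g j p.
Proof.
rewrite rmorph_sum /Scal.
transitivity (\tr (\matrix_(a, b) ev Wp (frame_ricci chart_frame_der chart_connection a b))).
  by apply: eq_bigr => a _; rewrite mxE.
rewrite ev_frame_ricci mxtrace_mulC !mulmxA mxtrace_mulC !mulmxA.
have /mulmx1C : F p *m (gmx g j p *m (F p)^T) = 1%:M by rewrite mulmxA F_orthonormal.
by move=> ->; rewrite mul1mx.
Qed.

Lemma ev_connection_form p (Wp : W p) c a b :
  ev Wp (connection_form cst D G E c a b) =
  gdot g j p (levi_civita g j (delta_mx 0 c) (fun q => row a (F q)) p) (row b (F p)).
Proof.
have -> : ev Wp (connection_form cst D G E c a b) =
    (map_mx (ev Wp) (connection_form cst D G E c)) a b by rewrite [RHS]mxE.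
rewrite /connection_form !map_mxM -map_trmx ev_metric ev_frame map_mxD map_mxM ev_frame.
rewrite /gdot mulmxA.
have -> : levi_civita g j (delta_mx 0 c) (fun q => row a (F q)) p =
    row a (map_mx (ev Wp) (map_mx (D c) E) +
      F p *m map_mx (ev Wp) (christoffel_mx cst D G E c)).
  apply/rowP => d; rewrite levi_civita_basis [RHS]mxE [RHS]addmxE; congr (_ + _).
    have -> : map_mx (ev Wp) (map_mx (D c) E) a d =
        ev Wp (D c (lift oW Wi (fun q => F q a d))) by rewrite !mxE.
    apply: etrans _ (esym (chart_der_lift oW Wi Wj Wp c (F_smooth a d))).
    by congr (pard j c _ p); apply/funext => q; rewrite mxE.
  rewrite [RHS]mxE; apply: eq_bigr => b' _; rewrite [row _ _ _ _]mxE mulrC.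
  by congr (_ * _); rewrite mxE; exact/esym/ev_christoffel.
by rewrite -row_mul tr_row -row_mul -[RHS]/(_ 0 0) !mxE; apply: eq_bigr => l _; rewrite !mxE.
Qed.

End ChartGeometry.

(** * Independence of the chart *)

Lemma ricci_congr (A : comPzRingType) n (d d' : 'I_n -> A -> A) w w' :
  (forall k f, d k f = d' k f) -> (forall i j k, w i j k = w' i j k) ->
  forall j k, frame_ricci d w j k = frame_ricci d' w' j k.
Proof.
move=> dd' ww' j k; apply: eq_bigr => i _; rewrite /curv.
congr (_ + _ - _); first by rewrite !dd' !ww'.
  by apply: eq_bigr => m _; rewrite !ww'.
by apply: eq_bigr => m _; rewrite !ww'.
Qed.

Section ScalarFrame.
Variables (R : comNzRingType) (n : nat) (F g Q : 'M[R]_n).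
Hypothesis Fg : F *m g *m F^T = 1%:M.

Let FgF : g *m F^T *m F = 1%:M.
Proof. by apply: mulmx1C; rewrite mulmxA. Qed.

Lemma frame_scalar c : F *m (Q *m g) *m F^T = c%:M <-> Q = c%:M.
Proof.
split=> [e|->]; last first.
  by rewrite mul_scalar_mx -scalemxAr -scalemxAl Fg scalemx1.
have : g *m F^T *m (F *m (Q *m g) *m F^T) *m F = Q.
  transitivity (g *m F^T *m F *m Q *m (g *m F^T *m F)); first by rewrite !mulmxA.
  by rewrite FgF mul1mx mulmx1.
by move=> <-; rewrite e mul_mx_scalar -scalemxAl FgF scalemx1.
Qed.

Lemma frame_trace : \tr (F *m (Q *m g) *m F^T) = \tr Q.
Proof.
rewrite mxtrace_mulC !mulmxA mxtrace_mulC !mulmxA FgF.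
by rewrite mul1mx.
Qed.

End ScalarFrame.

Section Comparison.
Variables (R : realType) (n : nat) (M : manifold R n) (g : metric M).
Variables (i j : chart M) (W : set M).
Hypotheses (oW : open W) (Wi : W `<=` dom i) (Wj : W `<=` dom j).
Variable F : M -> 'M[R]_n.
Hypothesis F_smooth : forall a b, smooth_in i W (fun p => F p a b).
Hypothesis F_orthonormal : forall p, W p -> F p *m gmx g j p *m (F p)^T = 1%:M.

Let F' p : 'M[R]_n := F p *m jac j i p.

Let F'_smooth a b : smooth_in i W (fun p => F' p a b).
Proof.
have H : smooth_in i W (fun p => \sum_c F p a c * pard j c (fun q => phi i q 0 b) p).
  move=> k; apply: Ck_sum; first exact: image_open.
  move=> c; apply: CkM; first exact: image_open.
    exact: F_smooth.
  apply: (smooth_in_change oW Wi Wj); apply: (smooth_in_pard c oW Wj).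
  exact: (smooth_in_coord Wj Wi).
apply: smooth_in_eq H => // q Wq; rewrite mxE.
by apply: eq_bigr => c _; rewrite mxE.
Qed.

Let F'_orthonormal p : W p -> F' p *m gmx g i p *m (F' p)^T = 1%:M.
Proof.
move=> Wp; rewrite -(F_orthonormal Wp) (gmx_change g (Wj Wp) (Wi Wp)).
by rewrite /F' trmx_mul !mulmxA.
Qed.

(** A vector field acts on functions in the same way whichever chart expresses
    it; this is the chain rule [pard_change]. *)
Lemma chart_frame_der_change a (f : chart_ring oW Wi) :
  chart_frame_der j F a f = chart_frame_der i F' a f.
Proof.
apply: ev_inj => p Wp; rewrite /chart_frame_der /frame_der !rmorph_sum.
have L b : ev Wp (lift_mx oW Wi F a b * chart_der j b f) =
    F p a b * \sum_c jac j i p b c * pard i c (low f) p.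
  rewrite rmorphM; congr (_ * _); first by rewrite mxE; exact: liftE.
  have E1 := chart_derE Wj Wp b f.
  apply: etrans E1 _.
  exact: (pard_change oW Wj Wi b (low_smooth f) Wp).
have L' b : ev Wp (lift_mx oW Wi F' a b * chart_der i b f) =
    F' p a b * pard i b (low f) p.
  rewrite rmorphM; congr (_ * _); first by rewrite mxE; exact: liftE.
  exact: (chart_derE Wi Wp b f).
apply: etrans (eq_bigr _ (fun b _ => L b)) _.
apply: etrans _ (esym (eq_bigr _ (fun b _ => L' b))).
under eq_bigr do rewrite mulr_sumr.
rewrite exchange_big; apply: eq_bigr => c _; rewrite [F' p a c]mxE mulr_suml.
by apply: eq_bigr => b _; rewrite mulrA.
Qed.

(** By [chart_frame_der_change] the charts give the same derivations, by
    [connection_unique] the same connection, hence the same Ricci tensor on the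
    frame. *)
Lemma frame_ricci_change p : W p ->
  F p *m (Ric g j p *m gmx g j p) *m (F p)^T =
  F' p *m (Ric g i p *m gmx g i p) *m (F' p)^T.
Proof.
move=> Wp.
rewrite -(ev_frame_ricci oW Wi Wj F_smooth F_orthonormal Wp).
rewrite -(ev_frame_ricci oW Wi Wi F'_smooth F'_orthonormal Wp).
have mf := chart_moving_frame oW Wi Wj F_smooth F_orthonormal.
have mf' := chart_moving_frame oW Wi Wi F'_smooth F'_orthonormal.
have wE := connection_unique mf (eq_ind _ (fun d => moving_frame _ d _) mf' _
  (esym (funext (fun k => funext (chart_frame_der_change k))))).
have E a b := ricci_congr chart_frame_der_change wE a b.
by apply/matrixP => a b; rewrite [LHS]mxE [RHS]mxE E.
Qed.

Lemma scal_change p : W p -> Scal g i p = Scal g j p.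
Proof.
move=> Wp; rewrite /Scal -(frame_trace (Ric g j p) (F_orthonormal Wp)) frame_ricci_change //.
by rewrite frame_trace // F'_orthonormal.
Qed.

Lemma ric_scalar_change p c : W p -> Ric g j p = c%:M -> Ric g i p = c%:M.
Proof.
move=> Wp; rewrite -(frame_scalar _ (F_orthonormal Wp)) frame_ricci_change //.
by rewrite (frame_scalar _ (F'_orthonormal Wp)).
Qed.

End Comparison.

(** * Real structure of the spinor module *)

Local Open Scope complex_scope.

Section Realification.
Variable R : realType.
Local Notation Re := (@complex.Re R).
Local Notation Im := (@complex.Im R).

(** The matrix, over the reals, of a complex linear map in the splitting into real
    and imaginary parts that [rcol] uses. *)
Definition rmx m n (X : 'M[R[i]]_(m, n)) : 'M[R]_(m + m, n + n) :=
  block_mx (map_mx Re X) (- map_mx Im X) (map_mx Im X) (map_mx Re X).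

Definition rcol m (v : 'cV[R[i]]_m) : 'cV[R]_(m + m) :=
  col_mx (map_mx Re v) (map_mx Im v).

Lemma ReM (x y : R[i]) : Re (x * y) = Re x * Re y - Im x * Im y.
Proof. by case: x y => [a b] [c d]. Qed.

Lemma ImM (x y : R[i]) : Im (x * y) = Im x * Re y + Re x * Im y.
Proof. by case: x y => [a b] [c d] /=; rewrite addrC. Qed.

Lemma ReD (x y : R[i]) : Re (x + y) = Re x + Re y.
Proof. by case: x y => [a b] [c d]. Qed.

Lemma ImD (x y : R[i]) : Im (x + y) = Im x + Im y.
Proof. by case: x y => [a b] [c d]. Qed.

Lemma map_ReM m n p (X : 'M[R[i]]_(m, n)) (Y : 'M[R[i]]_(n, p)) :
  map_mx Re (X *m Y) = map_mx Re X *m map_mx Re Y - map_mx Im X *m map_mx Im Y.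
Proof.
apply/matrixP=> a b; rewrite !mxE -sumrB (big_morph Re ReD (erefl (Re 0))).
by apply: eq_bigr => c _; rewrite !mxE ReM.
Qed.

Lemma map_ImM m n p (X : 'M[R[i]]_(m, n)) (Y : 'M[R[i]]_(n, p)) :
  map_mx Im (X *m Y) = map_mx Im X *m map_mx Re Y + map_mx Re X *m map_mx Im Y.
Proof.
apply/matrixP=> a b; rewrite !mxE -big_split (big_morph Im ImD (erefl (Im 0))).
by apply: eq_bigr => c _; rewrite !mxE ImM.
Qed.

Lemma rmxM m n p (X : 'M[R[i]]_(m, n)) (Y : 'M[R[i]]_(n, p)) :
  rmx (X *m Y) = rmx X *m rmx Y.
Proof.
rewrite /rmx mulmx_block map_ReM map_ImM !mulNmx !mulmxN opprD.
by congr block_mx; rewrite addrC.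
Qed.

Lemma rcolM m n (X : 'M[R[i]]_(m, n)) (v : 'cV[R[i]]_n) :
  rcol (X *m v) = rmx X *m rcol v.
Proof.
by rewrite /rcol /rmx mul_block_col map_ReM map_ImM mulNmx.
Qed.

Lemma rmxD m n (X Y : 'M[R[i]]_(m, n)) : rmx (X + Y) = rmx X + rmx Y.
Proof.
rewrite /rmx add_block_mx; congr block_mx; apply/matrixP => a b; rewrite !mxE.
- exact: ReD.
- by rewrite ImD opprD.
- exact: ImD.
- exact: ReD.
Qed.

Lemma rmx_scalar n (r : R) : rmx (r%:C%:M : 'M[R[i]]_n) = r%:M.
Proof.
rewrite [RHS]scalar_mx_block /rmx; congr block_mx; apply/matrixP => a b; rewrite !mxE.
- by case: (a == b).
- by case: (a == b) => /=; rewrite oppr0.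
- by case: (a == b).
- by case: (a == b).
Qed.

Lemma rmxZ m n (r : R) (X : 'M[R[i]]_(m, n)) : rmx (r%:C *: X) = r *: rmx X.
Proof.
rewrite /rmx scale_block_mx; congr block_mx; apply/matrixP => a b; rewrite !mxE ?ReM ?ImM /=.
- by rewrite mul0r subr0.
- by rewrite mul0r add0r mulrN.
- by rewrite mul0r add0r.
- by rewrite mul0r subr0.
Qed.

Lemma rmx0 m n : rmx (0 : 'M[R[i]]_(m, n)) = 0.
Proof.
rewrite /rmx -[RHS]block_mx0; congr block_mx; apply/matrixP => a b; rewrite !mxE //=.
by rewrite oppr0.
Qed.

Lemma rmx_sum (I : Type) (r : seq I) m n (F : I -> 'M[R[i]]_(m, n)) :
  rmx (\sum_(i <- r) F i) = \sum_(i <- r) rmx (F i).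
Proof. exact: (big_morph _ (@rmxD m n) (@rmx0 m n)). Qed.

Lemma rcolD m (u v : 'cV[R[i]]_m) : rcol (u + v) = rcol u + rcol v.
Proof.
rewrite /rcol add_col_mx; congr col_mx; apply/matrixP => a b; rewrite !mxE.
  exact: ReD.
exact: ImD.
Qed.

Lemma rcolZ m (r : R) (v : 'cV[R[i]]_m) : rcol (r%:C *: v) = r *: rcol v.
Proof.
rewrite /rcol scale_col_mx; congr col_mx; apply/matrixP => a b; rewrite !mxE ?ReM ?ImM /=.
  by rewrite mul0r subr0.
by rewrite mul0r add0r.
Qed.

Lemma rcol_eq0 m (v : 'cV[R[i]]_m) : (rcol v == 0) = (v == 0).
Proof.
apply/eqP/eqP => [|->]; last first.
  by rewrite /rcol -[RHS]col_mx0; congr col_mx; apply/matrixP => a b; rewrite !mxE.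
move=> e; have : rcol v = col_mx 0 0 by rewrite e col_mx0.
move=> /eq_col_mx[/matrixP v1 /matrixP v2].
apply/matrixP => a b; have := v1 a b; have := v2 a b; rewrite !mxE.
by case: (v a b) => x y /= -> ->.
Qed.

End Realification.

Section InvariantForm.
Variables (R : realType) (n N : nat) (c : 'I_n -> 'M[R]_N).
Hypothesis cc : forall i j, c i *m c j + c j *m c i = (- (2 * (i == j)%:R))%:M.

Lemma clifford_anticomm i j : i != j -> c i *m c j = - (c j *m c i).
Proof.
move=> /negPf ij; apply/eqP; rewrite -addr_eq0 cc ij mulr0 oppr0.
by rewrite raddf0.
Qed.

Lemma clifford_square i : c i *m c i = - 1%:M.
Proof.
have := cc i i; rewrite eqxx mulr1 => e; apply/matrixP => a b.
have := congr1 (fun X : 'M[R]_N => X a b) e; rewrite !mxE => {}e.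
apply: (@mulfI _ 2%:R); first by rewrite pnatr_eq0.
rewrite mulr_natl mulr2n e; case: (a == b); rewrite ?mulr1n ?mulr0n; ring.
Qed.

(** The standard form averaged over the products of the [c i], one generator at a
    time: [H + (c i)^T *m H *m c i] is invariant under [c i] because [c i] squares
    to -1, and it remains invariant under the other generators that preserve [H]
    because these anticommute with [c i]. *)
Definition average_form : seq 'I_n -> 'M[R]_N :=
  foldr (fun i H => H + (c i)^T *m H *m c i) 1%:M.

Lemma average_form_sym s : (average_form s)^T = average_form s.
Proof.
elim: s => [|i s IH] /=; first by rewrite trmx1.
by rewrite linearD /= !trmx_mul trmxK IH mulmxA.
Qed.

Lemma average_form_pos s (v : 'cV[R]_N) : v != 0 -> 0 < (v^T *m average_form s *m v) 0 0.
Proof.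
elim: s v => [|i s IH] v v0 /=.
  rewrite mulmx1 mxE; under eq_bigr do rewrite mxE.
  rewrite lt_neqAle sumr_ge0 ?andbT => [|a _]; last by rewrite -expr2 sqr_ge0.
  apply: contra v0 => /eqP/esym/eqP; rewrite psumr_eq0 => [/allP e|a _]; last first.
    by rewrite -expr2 sqr_ge0.
  apply/eqP/colP => a; rewrite mxE; have := e a (mem_index_enum a).
  by rewrite /= mulf_eq0 orbb => /eqP.
have cv0 : c i *m v != 0.
  apply: contra v0 => /eqP cv; have := congr1 (mulmx (c i)) cv.
  rewrite mulmx0 mulmxA clifford_square mulNmx mul1mx => /eqP.
  by rewrite oppr_eq0.
have := addr_gt0 (IH v v0) (IH _ cv0).
by rewrite trmx_mul mulmxDr mulmxDl !mulmxA addmxE.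
Qed.

Lemma average_form_inv s i : i \in s ->
  (c i)^T *m average_form s *m c i = average_form s.
Proof.
elim: s => [//|k s IH]; rewrite inE /=.
case: eqP => [->|/eqP ik] /=.
  move=> _; rewrite mulmxDr mulmxDl addrC; congr (_ + _).
  rewrite !mulmxA -trmx_mul clifford_square -!mulmxA clifford_square.
  have -> : (- 1%:M : 'M[R]_N)^T = - 1%:M by rewrite linearN /= trmx1.
  by rewrite mulmxN mulmx1 mulNmx mul1mx opprK.
move=> /IH e; rewrite mulmxDr mulmxDl e; congr (_ + _).
rewrite !mulmxA -trmx_mul -(mulmxA _ (c k) (c i)).
rewrite (clifford_anticomm (i := k) (j := i)); last by rewrite eq_sym.
have -> : (- (c i *m c k))^T = - (c i *m c k)^T by rewrite linearN.
by rewrite !mulNmx mulmxN opprK trmx_mul -[in RHS]e !mulmxA.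
Qed.

(** A form preserved by [c i] makes [c i] skew, because its square is -1. *)
Lemma invariant_form : exists H : 'M[R]_N,
  [/\ H^T = H, forall i, (c i)^T *m H = - (H *m c i)
    & forall v : 'cV[R]_N, v != 0 -> 0 < (v^T *m H *m v) 0 0].
Proof.
exists (average_form (enum 'I_n)); split=> [|i|]; first exact: average_form_sym.
  have e := average_form_inv (mem_enum 'I_n i).
  rewrite -[in RHS]e -!mulmxA clifford_square.
  by rewrite !mulmxN !mulmx1 opprK.
exact: average_form_pos.
Qed.

End InvariantForm.

(** * The spinor equation over the ring of smooth functions *)

Section RealSpinor.
Variables (R : realType) (n : nat) (M : manifold R n) (g : metric M).
Variables (G : spinor_module R n) (S : spin_structure g G) (psi : spinor_field S).
Variable (mu : R).
Hypothesis hrk : forall k p (X : 'rV[R]_n), triv_dom k p ->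
      spin_nabla psi k p X =
      mu%:C *: (clifford k p (X *m Ric g (ch k) p) *m psi k p).
Variable k : triv S.
Local Notation j := (ch k).
Local Notation W := (triv_dom k).
Local Notation F := (frame k).
Local Notation N := (spin_dim n + spin_dim n)%N.
Local Notation e a := (delta_mx 0 a : 'rV[R]_n).

Definition real_gamma a : 'M[R]_N := rmx (gamma G a).
Local Notation c := real_gamma.

Lemma real_gamma_clifford a b :
  c a *m c b + c b *m c a = (- (2 * (a == b)%:R))%:M.
Proof.
rewrite -!rmxM -rmxD gamma_clifford -rmx_scalar; congr rmx; congr scalar_mx.
by rewrite rmorphN rmorphM !rmorph_nat.
Qed.

Definition real_spinor q : 'cV[R]_N := rcol (psi k q).

Lemma real_spinor_smooth s t : smooth_in j W (fun q => real_spinor q s t).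
Proof.
rewrite (ord1 t); have := spinor_smooth psi k.
case: (split_ordP s) => [s' ->|s' ->] /(_ s')[sRe sIm].
  by have -> : (fun q => real_spinor q (lshift _ s') 0) = (fun q => complex.Re (psi k q s' 0));
    [apply/funext => q; rewrite /real_spinor /rcol col_mxEu mxE|].
by have -> : (fun q => real_spinor q (rshift _ s') 0) = (fun q => complex.Im (psi k q s' 0));
  [apply/funext => q; rewrite /real_spinor /rcol col_mxEd mxE|].
Qed.

Lemma real_cliff (v : 'rV[R]_n) : rmx (cliff G v) = \sum_b v 0 b *: c b.
Proof. by rewrite /cliff rmx_sum; apply: eq_bigr => b _; rewrite rmxZ. Qed.

(** The hypothesis in the direction of the a-th coordinate field, between real
    spinors. *)
Lemma real_ricci_killing p a : W p ->
  \col_s pard j a (fun q => real_spinor q s 0) p + 4^-1 *: \sum_b \sum_d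
    gdot g j p (levi_civita g j (e a) (fun q => row b (F q)) p) (row d (F p))
    *: (c b *m c d *m real_spinor p)
  = mu *: ((\sum_b (e a *m Ric g j p *m gmx g j p *m (F p)^T) 0 b *: c b)
           *m real_spinor p).
Proof.
move=> Wp; have := congr1 (@rcol R _) (hrk (e a) Wp).
rewrite rcolZ rcolM /clifford real_cliff => <-.
rewrite /spin_nabla rcolD; congr (_ + _).
  apply/colP => s; rewrite mxE; case: (split_ordP s) => [s' ->|s' ->].
    rewrite /rcol col_mxEu !mxE /=; congr (pard j a _ p).
    by apply/funext => q; rewrite /real_spinor /rcol col_mxEu mxE.
  rewrite /rcol col_mxEd !mxE /=; congr (pard j a _ p).
  by apply/funext => q; rewrite /real_spinor /rcol col_mxEd mxE.
have -> : (4^-1 : R[i]) = (4^-1 : R)%:C by rewrite fmorphV rmorph_nat.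
rewrite rcolZ; congr (_ *: _).
have rcol_sum (I : Type) (r : seq I) (f : I -> 'cV[R[i]]_(spin_dim n)) :
    rcol (\sum_(i <- r) f i) = \sum_(i <- r) rcol (f i).
  by apply: (big_morph _ (@rcolD R _)); apply/eqP; rewrite rcol_eq0.
rewrite rcol_sum; apply: eq_bigr => b _; rewrite rcol_sum; apply: eq_bigr => d _.
by rewrite rcolZ rcolM rmxM.
Qed.

End RealSpinor.

Lemma scale_sum3 (R : comPzRingType) (V : lmodType R) (I J K : finType) (r : R)
    (x : K -> R) (X : K -> I -> J -> V) :
  \sum_l x l *: (r *: \sum_b \sum_d X l b d) =
  r *: \sum_b \sum_d \sum_l x l *: X l b d.
Proof.
under eq_bigr do rewrite scalerA mulrC -scalerA scaler_sumr.
rewrite -scaler_sumr exchange_big; congr (_ *: _); apply: eq_bigr => b _.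
under eq_bigr do rewrite scaler_sumr.
by rewrite exchange_big.
Qed.

Section LocalSpinor.
Variables (R : realType) (n : nat) (M : manifold R n) (g : metric M).
Variables (G : spinor_module R n) (S : spin_structure g G) (psi : spinor_field S).
Variable (mu : R).
Hypothesis hrk : forall k p (X : 'rV[R]_n), triv_dom k p ->
      spin_nabla psi k p X =
      mu%:C *: (clifford k p (X *m Ric g (ch k) p) *m psi k p).
Variable k : triv S.
Local Notation j := (ch k).
Local Notation W := (triv_dom k).
Local Notation F := (frame k).
Local Notation N := (spin_dim n + spin_dim n)%N.
Local Notation e a := (delta_mx 0 a : 'rV[R]_n).
Local Notation c := (real_gamma G).
Local Notation oW := (@triv_dom_open _ _ _ _ _ S k).
Local Notation Wj := (@triv_dom_dom _ _ _ _ _ S k).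
Local Notation A := (chart_ring oW Wj).
Local Notation cst := (chart_cst oW Wj).
Local Notation Fs := (@frame_smooth _ _ _ _ _ S k).
Local Notation Fo := (@frame_orthonormal _ _ _ _ _ S k).
Local Notation D := (chart_der (oW := oW) (Wi := Wj) j).
Local Notation delta := (chart_frame_der (oW := oW) (Wi := Wj) j F).
Local Notation w := (chart_connection g j oW Wj F).
Local Notation Psi := (lift_mx oW Wj (real_spinor psi k)).
Local Notation C := (fun a => map_mx cst (c a)).

Lemma ev_gamma p (Wp : W p) a : map_mx (ev Wp) (C a) = c a.
Proof. by apply/matrixP => s t; rewrite mxE mxE; exact: ev_cst. Qed.

Lemma ev_spinor p (Wp : W p) : map_mx (ev Wp) Psi = real_spinor psi k p.
Proof. by apply: ev_lift_mx => s t; exact: real_spinor_smooth. Qed.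

Lemma ev_cstZ p (Wp : W p) a b r (X : 'M[A]_(a, b)) :
  map_mx (ev Wp) (cst r *: X) = r *: map_mx (ev Wp) X.
Proof. by rewrite map_mxZ; congr (_ *: _); exact: ev_cst. Qed.

Lemma ev_cl p (Wp : W p) (v : 'I_n -> A) :
  map_mx (ev Wp) (cl C v) = \sum_b ev Wp (v b) *: c b.
Proof.
rewrite /cl raddf_sum; apply: eq_bigr => b _.
by rewrite [LHS]map_mxZ; congr (_ *: _); exact: ev_gamma.
Qed.

Lemma ev_spin_alg p (Wp : W p) (m : 'I_n -> 'I_n -> A) :
  map_mx (ev Wp) (spin_alg cst C m) =
  4^-1 *: \sum_b \sum_d ev Wp (m b d) *: (c b *m c d).
Proof.
rewrite /spin_alg ev_cstZ raddf_sum; congr (_ *: _); apply: eq_bigr => b _.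
rewrite [LHS]raddf_sum; apply: eq_bigr => d _.
rewrite [LHS]map_mxZ map_mxM; congr (_ *: _).
by congr (_ *m _); exact: ev_gamma.
Qed.

Lemma ev_chart_connection p (Wp : W p) a b d : ev Wp (w a b d) =
  \sum_l F p a l *
    gdot g j p (levi_civita g j (e l) (fun q => row b (F q)) p) (row d (F p)).
Proof.
rewrite /chart_connection /frame_connection rmorph_sum; apply: eq_bigr => l _.
rewrite rmorphM; congr (_ * _); first by rewrite mxE; exact: (liftE oW Wj (Fs a l) Wp).
exact: (ev_connection_form oW Wj Wj Fs Fo Wp l b d).
Qed.

Lemma ev_chart_ricci p (Wp : W p) a b : ev Wp (frame_ricci delta w a b) =
  \sum_l F p a l * (e l *m Ric g j p *m gmx g j p *m (F p)^T) 0 b.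
Proof.
have E := congr1 (fun X : 'M[R]_n => X a b) (ev_frame_ricci oW Wj Wj Fs Fo Wp).
rewrite /= [LHS]mxE in E; rewrite E -mulmxA [LHS]mxE; apply: eq_bigr => l _.
by rewrite -!mulmxA -rowE [in RHS]mxE !mulmxA.
Qed.

(** The equation in frame directions is a combination of the equations
    [real_ricci_killing] in coordinate directions, at each point of the domain. *)
Lemma chart_ricci_killing a : spin_conn cst delta w (real_gamma G) a Psi =
  cst mu *: (cl C (frame_ricci delta w a) *m Psi).
Proof.
apply: mx_ev_inj => p Wp.
have dPsi : map_mx (ev Wp) (map_mx (delta a) Psi) =
    \sum_l F p a l *: \col_s pard j l (fun q => real_spinor psi k q s 0) p.
  apply/colP => s; rewrite [LHS]mxE [X in ev Wp X]mxE summxE.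
  rewrite /chart_frame_der /frame_der rmorph_sum; apply: eq_bigr => l _.
  rewrite rmorphM scalemxE; congr (_ * _).
    by rewrite mxE; exact: (liftE oW Wj (Fs a l) Wp).
  rewrite [Psi s 0]mxE; have L := chart_der_lift oW Wj Wj Wp l (real_spinor_smooth psi k s 0).
  by rewrite [RHS]mxE; exact: L.
have SPsi : map_mx (ev Wp) (spin_alg cst C (w a) *m Psi) =
    \sum_l F p a l *: (4^-1 *: \sum_b \sum_d
    gdot g j p (levi_civita g j (e l) (fun q => row b (F q)) p) (row d (F p))
    *: (c b *m c d *m real_spinor psi k p)).
  rewrite map_mxM ev_spinor ev_spin_alg.
  rewrite scale_sum3 -scalemxAl mulmx_suml; congr (_ *: _); apply: eq_bigr => b _.
  rewrite mulmx_suml; apply: eq_bigr => d _; rewrite ev_chart_connection.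
  rewrite -scalemxAl scaler_suml; apply: eq_bigr => l _.
  by rewrite scalerA.
have rhoPsi : map_mx (ev Wp) (cst mu *: (cl C (frame_ricci delta w a) *m Psi)) =
    \sum_l F p a l *: (mu *: ((\sum_b
      (e l *m Ric g j p *m gmx g j p *m (F p)^T) 0 b *: c b) *m real_spinor psi k p)).
  rewrite ev_cstZ map_mxM ev_spinor ev_cl.
  under [RHS]eq_bigr do rewrite scalerA mulrC -scalerA scalemxAl scaler_sumr.
  rewrite -scaler_sumr -mulmx_suml; congr (_ *: (_ *m _)).
  rewrite exchange_big; apply: eq_bigr => b _.
  rewrite ev_chart_ricci scaler_suml.
  by apply: eq_bigr => l _; rewrite scalerA.
rewrite rhoPsi map_mxD dPsi SPsi -big_split; apply: eq_bigr => l _.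
by rewrite -(real_ricci_killing hrk l Wp) scalerDr.
Qed.
End LocalSpinor.

(** * Constancy of the norm and of the scalar curvature *)

(** A function with zero derivatives is constant near [phi j p], and [phi j] is
    continuous. *)
Lemma pard_locally_constant (R : realType) (n : nat) (M : manifold R n) (j : chart M)
    (W : set M) (f : M -> R) (p : M) : open W -> W `<=` dom j -> smooth_in j W f ->
  (forall a q, W q -> pard j a f q = 0) -> W p -> \forall q \near p, f q = f p.
Proof.
move=> oW Wj sf f0 Wp.
have im q : W q -> (phi j @` W) (phi j q) by move=> Wq; exists q.
have f'0 (a : 'I_n) (y : 'rV[R]_n) : (phi j @` W) y -> 'D_(delta_mx 0 a) (f \o phiV j) y = 0.
  by case=> q Wq <-; exact: f0.
have lc := locally_constant (image_open oW Wj) (smooth_C1 sf) (im p Wp) f'0.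
have nW : nbhs p W by exact: open_nbhs_nbhs.
have nphi : \forall q \near p, (f \o phiV j) (phi j q) = (f \o phiV j) (phi j p).
  exact: (phi_continuous (Wj _ Wp) lc).
apply: (@filterS2 _ (nbhs p) _ _ _ _ _ nW nphi) => q Wq.
by rewrite /= !phiK //; exact: Wj.
Qed.

Section LocalSpinor.
Variables (R : realType) (n : nat) (M : manifold R n) (g : metric M).
Variables (G : spinor_module R n) (S : spin_structure g G) (psi : spinor_field S).
Variable (mu : R).
Hypothesis hrk : forall k p (X : 'rV[R]_n), triv_dom k p ->
      spin_nabla psi k p X =
      mu%:C *: (clifford k p (X *m Ric g (ch k) p) *m psi k p).
Local Notation N := (spin_dim n + spin_dim n)%N.
Variable H : 'M[R]_N.
Hypothesis HT : H^T = H.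
Hypothesis cH : forall i, (real_gamma G i)^T *m H = - (H *m real_gamma G i).
Variable k : triv S.
Local Notation j := (ch k).
Local Notation W := (triv_dom k).
Local Notation F := (frame k).
Local Notation c := (real_gamma G).
Local Notation oW := (@triv_dom_open _ _ _ _ _ S k).
Local Notation Wj := (@triv_dom_dom _ _ _ _ _ S k).
Local Notation A := (chart_ring oW Wj).
Local Notation cst := (chart_cst oW Wj).
Local Notation Fs := (@frame_smooth _ _ _ _ _ S k).
Local Notation Fo := (@frame_orthonormal _ _ _ _ _ S k).
Local Notation D := (chart_der (oW := oW) (Wi := Wj) j).
Local Notation delta := (chart_frame_der (oW := oW) (Wi := Wj) j F).
Local Notation w := (chart_connection g j oW Wj F).
Local Notation Psi := (lift_mx oW Wj (real_spinor psi k)).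
Local Notation C := (fun a => map_mx cst (c a)).

Definition spinor_norm p : R := sqnorm H (real_spinor psi k p).
Local Notation norm := (sqnorm (map_mx cst H) Psi).

Let mf := chart_moving_frame oW Wj Wj Fs Fo.
Let cc := real_gamma_clifford G.
Let rk := chart_ricci_killing hrk k.

Lemma ev_spinor_norm p (Wp : W p) : ev Wp norm = spinor_norm p.
Proof.
have -> : ev Wp norm = (map_mx (ev Wp) (Psi^T *m map_mx cst H *m Psi)) 0 0.
  by rewrite [RHS]mxE.
rewrite /spinor_norm /sqnorm !map_mxM -map_trmx ev_spinor.
congr ((_ *m _ *m _) 0 0); apply/matrixP => s t; rewrite 2!mxE; exact: ev_cst.
Qed.

(** The frame matrix is invertible, so the coordinate derivatives of [f] vanish
    with its frame derivatives. *)
Lemma frame_der_locally_constant (f : A) p : (forall i, delta i f = 0) -> W p ->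
  \forall q \near p, low f q = low f p.
Proof.
move=> f0 Wp; apply: (pard_locally_constant oW Wj (low_smooth_in Wj f)) => // a q Wq.
rewrite -(chart_derE Wj Wq) (_ : D a f = 0) ?rmorph0 //.
have GE := mul_inv_frame (frame_lift_orthonormal oW Wj Wj Fs Fo).
have EC b d := congr1 (fun X : 'M[A]_n => X b d) GE.
transitivity (\sum_i (metric_lift g j oW Wj *m (lift_mx oW Wj F)^T) a i * delta i f).
  under eq_bigr do rewrite mulr_sumr.
  rewrite exchange_big (bigD1 a) //= [X in _ + X]big1 ?addr0 => [|b /negPf ba].
    under eq_bigr do rewrite mulrA.
    have := EC a a; rewrite [LHS]mxE [X in _ = X]mxE eqxx -mulr_suml => ->.
    by rewrite mul1r.
  under eq_bigr do rewrite mulrA.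
  have := EC a b; rewrite [LHS]mxE [X in _ = X]mxE eq_sym ba -mulr_suml => ->.
  by rewrite mul0r.
by rewrite big1 // => i _; rewrite f0 mulr0.
Qed.

Lemma spinor_norm_locally_constant p : W p ->
  \forall q \near p, spinor_norm q = spinor_norm p.
Proof.
move=> Wp.
have := frame_der_locally_constant (normsq_const mf cc rk HT cH) Wp.
have nW : nbhs p W by exact: (open_nbhs_nbhs (conj oW Wp)).
apply: (@filterS2 _ (nbhs p) _ _ _ _ _ nW) => q Wq.
by rewrite -(ev_spinor_norm Wq) -(ev_spinor_norm Wp).
Qed.

Lemma scal_locally_constant p : mu != 0 -> (forall q, W q -> spinor_norm q != 0) -> W p ->
  \forall q \near p, Scal g j q = Scal g j p.
Proof.
move=> mu0 norm0 Wp.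
have s0 i : delta i (frame_scal delta w) = 0.
  apply: ev_inj => q Wq; rewrite rmorph0.
  have := congr1 (ev Wq) (scal_const mf cc rk HT cH i).
  set x := delta i _.
  have -> : ev Wq (cst mu * x * norm) = mu * ev Wq x * spinor_norm q.
    rewrite -(ev_spinor_norm Wq) rmorphM; congr (_ * _); rewrite rmorphM.
    by congr (_ * _); exact: ev_cst.
  rewrite rmorph0 => /eqP; rewrite !mulf_eq0 (negPf mu0) (negPf (norm0 q Wq)) orbF.
  by move=> /eqP.
have := frame_der_locally_constant s0 Wp.
have nW : nbhs p W by exact: (open_nbhs_nbhs (conj oW Wp)).
apply: (@filterS2 _ (nbhs p) _ _ _ _ _ nW) => q Wq.
rewrite -(ev_frame_scal oW Wj Wj Fs Fo Wq) -(ev_frame_scal oW Wj Wj Fs Fo Wp).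
exact.
Qed.

(** The Ricci tensor on the vectors of the frame.  Being computed in an orthonormal
    frame, this matrix is symmetric, unlike [Ric]. *)
Definition frame_ric p : 'M[R]_n := F p *m (Ric g j p *m gmx g j p) *m (F p)^T.

Lemma frame_ric_sym p a b : W p -> frame_ric p a b = frame_ric p b a.
Proof.
move=> Wp; rewrite /frame_ric -(ev_frame_ricci oW Wj Wj Fs Fo Wp) [LHS]mxE [RHS]mxE.
congr (ev Wp _); exact: (frame_ricci_sym mf).
Qed.

Lemma frame_ric_norm p : W p -> spinor_norm p != 0 ->
  2^-1 * Scal g j p = mu ^+ 2 *
    (2 * Scal g j p * Scal g j p - 2 * \sum_a \sum_b frame_ric p a b * frame_ric p b a).
Proof.
move=> Wp norm0; apply: (mulIf norm0).
have := congr1 (ev Wp) (ricci_norm mf cc rk HT cH).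
have evl r (x y : A) : ev Wp (cst r * x * y) = r * ev Wp x * ev Wp y.
  by rewrite rmorphM; congr (_ * _); rewrite rmorphM; congr (_ * _); exact: ev_cst.
have evr (x y : A) : ev Wp (2 * x * x - 2 * y) = 2 * ev Wp x * ev Wp x - 2 * ev Wp y.
  by rewrite rmorphB !rmorphM rmorph_nat.
have evs : ev Wp (\sum_a \sum_b frame_ricci delta w a b * frame_ricci delta w b a) =
    \sum_a \sum_b frame_ric p a b * frame_ric p b a.
  rewrite /frame_ric -(ev_frame_ricci oW Wj Wj Fs Fo Wp) rmorph_sum.
  apply: eq_bigr => a _; rewrite [LHS]rmorph_sum; apply: eq_bigr => b _.
  by rewrite rmorphM !mxE.
move=> E; apply: etrans (etrans (esym (etrans (evl _ _ _) _)) E) (etrans (evl _ _ _) _).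
  by rewrite (ev_spinor_norm Wp) (ev_frame_scal oW Wj Wj Fs Fo Wp).
congr (_ * _ * _); last exact: ev_spinor_norm.
by apply: etrans (evr _ _) _; rewrite evs (ev_frame_scal oW Wj Wj Fs Fo Wp).
Qed.

End LocalSpinor.

(** * Connectedness and the traceless Ricci tensor *)

(** Both [P] and its complement are open. *)
Lemma connected_locally_constant (T : topologicalType) (P : set T) (p q : T) :
  connected [set: T] -> (forall x, \forall y \near x, P y <-> P x) -> P p -> P q.
Proof.
move=> cT lP Pp; suff -> : P = [set: T] by [].
have oP : open P.
  rewrite openE => x Px; apply: (@filterS _ (nbhs x) _ _ _ _ (lP x)).
  by move=> y [_ yx]; exact: yx.
have oC : open (~` P).
  rewrite openE => x Px; apply: (@filterS _ (nbhs x) _ _ _ _ (lP x)).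
  by move=> y [yx _] /yx.
apply: cT; first by exists p.
  by exists P => //; rewrite setTI.
by exists P; [rewrite -[P]setCK; exact: open_closedC|rewrite setTI].
Qed.

Section TracelessPart.
Variables (R : realFieldType) (n : nat) (Q : 'M[R]_n).
Hypothesis n_gt0 : (0 < n)%N.
Hypothesis QC : forall a b, Q a b = Q b a.

Definition traceless_norm : R :=
  \sum_a \sum_b (Q a b - \tr Q / n%:R * (a == b)%:R) ^+ 2.
Local Notation s := (\tr Q).

Lemma traceless_norm_ge0 : 0 <= traceless_norm.
Proof. by do 2!apply: sumr_ge0 => ? _; exact: sqr_ge0. Qed.

Lemma traceless_normE :
  traceless_norm = \sum_a \sum_b Q a b * Q b a - s ^+ 2 / n%:R.
Proof.
have n0 : n%:R != 0 :> R by rewrite pnatr_eq0 -lt0n.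
set t := s / n%:R.
have E a : \sum_b (Q a b - t * (a == b)%:R) ^+ 2 =
    \sum_b Q a b * Q b a - 2 * t * Q a a + t ^+ 2.
  transitivity (\sum_b (Q a b * Q b a + (a == b)%:R *: (t ^+ 2 - 2 * t * Q a b : R^o))).
    apply: eq_bigr => b _; rewrite (QC b a); case: (a == b).
      by rewrite scale1r /=; ring.
    by rewrite scale0r /=; ring.
  rewrite big_split (@sum_delta _ _ _ a (fun b => t ^+ 2 - 2 * t * Q a b : R^o)) /=.
  by ring.
rewrite /traceless_norm -/t (eq_bigr _ (fun a _ => E a)) big_split sumrB /=.
rewrite -mulr_sumr -/(\tr Q) sumr_const card_ord -mulr_natr /t.
by field.
Qed.

Lemma traceless_norm_eq0 : traceless_norm = 0 <-> Q = (s / n%:R)%:M.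
Proof.
split=> [T0|e]; last first.
  rewrite /traceless_norm; apply: big1 => a _; apply: big1 => b _.
  by rewrite {1}e mxE; case: (a == b); rewrite ?mulr1 ?mulr0 subrr expr0n.
apply/matrixP => a b; rewrite mxE -[X in _ = X]mulr_natr; apply/eqP; rewrite -subr_eq0 -sqrf_eq0.
have sq0 a' b' : true -> 0 <= (Q a' b' - s / n%:R * (a' == b')%:R) ^+ 2.
  by move=> _; exact: sqr_ge0.
have rows0 := psumr_eq0P (fun a' _ => sumr_ge0 _ (sq0 a')) T0.
by rewrite (psumr_eq0P (sq0 a) (rows0 a isT)).
Qed.

Section ScalarIdentity.
Variable mu : R.
Hypothesis mu0 : mu != 0.
Hypothesis Q_norm : 2^-1 * s = mu ^+ 2 *
  (2 * s * s - 2 * \sum_a \sum_b Q a b * Q b a).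

(** With q the sum of the squares of the entries of [Q], the hypothesis says
    that mu^2 q = mu^2 s^2 - s/4. *)
Lemma traceless_norm_mu :
  4 * mu ^+ 2 * traceless_norm = s * (4 * mu ^+ 2 * s * (n%:R - 1) / n%:R - 1).
Proof.
have n0 : n%:R != 0 :> R by rewrite pnatr_eq0 -lt0n.
rewrite traceless_normE; move: Q_norm; set q := \sum_a _ => e.
have e' : s = 2 * (mu ^+ 2 * (2 * s * s - 2 * q)) by rewrite -e; field.
transitivity (4 * mu ^+ 2 * s ^+ 2 * (n%:R - 1) / n%:R - s); last by field.
by rewrite [X in _ = _ - X]e'; field.
Qed.

Lemma scal0_ricci0 : s = 0 -> Q = 0.
Proof.
move=> s0; have : 4 * mu ^+ 2 * traceless_norm = 0 by rewrite traceless_norm_mu s0 mul0r.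
move=> /eqP; rewrite -mulrA mulf_eq0 pnatr_eq0 /= mulf_eq0 sqrf_eq0 (negPf mu0) /=.
by move=> /eqP/traceless_norm_eq0 ->; rewrite s0 mul0r raddf0.
Qed.

Hypothesis n_gt1 : (1 < n)%N.
Hypothesis s0 : s != 0.
Let n10 : n%:R - 1 != 0 :> R.
Proof. by rewrite subr_eq0 -[1]/(1%:R) eqr_nat gtn_eqF. Qed.

(** For s < 0 the left side is not positive.  For s > 0 the bound is the
    nonnegativity of the right side of [traceless_norm_mu]. *)
Lemma scalar_bound : n%:R / (4 * (n%:R - 1) * s) <= mu ^+ 2.
Proof.
have n0 : n%:R != 0 :> R by rewrite pnatr_eq0 -lt0n.
have np : 0 < n%:R :> R by rewrite ltr0n.
have n1p : 0 < n%:R - 1 :> R by rewrite subr_gt0 ltr1n.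
case: (ltgtP s 0) => [sn|sp|/eqP]; last by rewrite (negPf s0).
  apply: le_trans (sqr_ge0 _); apply: mulr_ge0_le0; first exact: ltW.
  by rewrite invr_le0 mulr_ge0_le0 ?ltW // mulr_gt0.
rewrite ler_pdivrMr; last by rewrite !mulr_gt0.
have : 0 <= 4 * mu ^+ 2 * traceless_norm.
  by rewrite mulr_ge0 ?traceless_norm_ge0 // mulr_ge0 ?sqr_ge0.
rewrite traceless_norm_mu pmulr_rge0 // subr_ge0 ler_pdivlMr // mul1r.
by move=> h; apply: le_trans h _; rewrite le_eqVlt; apply/orP; left; apply/eqP; ring.
Qed.

Lemma scalar_bound_eq :
  mu ^+ 2 = n%:R / (4 * (n%:R - 1) * s) <-> Q = (s / n%:R)%:M.
Proof.
have n0 : n%:R != 0 :> R by rewrite pnatr_eq0 -lt0n.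
rewrite -traceless_norm_eq0; split=> [e|T0].
  have : 4 * mu ^+ 2 * traceless_norm = 0.
    by rewrite traceless_norm_mu e; field; rewrite n0 s0 n10.
  move=> /eqP; rewrite -mulrA mulf_eq0 pnatr_eq0 /= mulf_eq0 sqrf_eq0 (negPf mu0) /=.
  by move=> /eqP.
have /eqP := traceless_norm_mu; rewrite T0 mulr0 eq_sym mulf_eq0 (negPf s0) /= subr_eq0.
move=> /eqP e.
have -> : mu ^+ 2 = (4 * mu ^+ 2 * s * (n%:R - 1) / n%:R) * (n%:R / (4 * (n%:R - 1) * s)).
  by field; rewrite n0 s0 n10.
by rewrite e mul1r.
Qed.

End ScalarIdentity.
End TracelessPart.

(** * Global consequences *)

Section CliffordVector.
Variables (R : realType) (n : nat) (G : spinor_module R n).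

Lemma cliff_sq (v : 'rV[R]_n) : cliff G v *m cliff G v = - (\sum_a v 0 a ^+ 2)%:C%:M.
Proof.
have E : cliff G v *m cliff G v =
    \sum_a \sum_b ((v 0 a)%:C * (v 0 b)%:C) *: (gamma G a *m gamma G b).
  rewrite /cliff mulmx_suml; apply: eq_bigr => a _.
  rewrite mulmx_sumr; apply: eq_bigr => b _.
  by rewrite -scalemxAl -scalemxAr scalerA.
have E' : cliff G v *m cliff G v =
    \sum_a \sum_b ((v 0 a)%:C * (v 0 b)%:C) *: (gamma G b *m gamma G a).
  rewrite E exchange_big; apply: eq_bigr => a _; apply: eq_bigr => b _.
  by rewrite mulrC.
have two0 : (2 : R[i]) != 0 by rewrite pnatr_eq0.
apply: (scalerI two0).
rewrite scaler_nat mulr2n {1}E E' -big_split /=.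
transitivity (\sum_a (-2 * (v 0 a)%:C ^+ 2) *: (1%:M : 'M[R[i]]_(spin_dim n))).
  apply: eq_bigr => a _; rewrite -big_split /=.
  rewrite -[RHS](sum_delta a (fun b => (-2 * ((v 0 a)%:C * (v 0 b)%:C)) *: 1%:M)).
  apply: eq_bigr => b _; rewrite -scalerDr gamma_clifford.
  by rewrite -[(- (2 * _))%:M]scalemx1 !scalerA; congr (_ *: _); ring.
rewrite -scaler_suml -mulr_sumr -[X in _ = 2 *: - X]scalemx1 -scaleNr scalerA.
congr (_ *: _); rewrite mulNr mulrN rmorph_sum; congr (- (_ * _)).
by apply: eq_bigr => a _; rewrite rmorphXn.
Qed.

Lemma cliffB (u v : 'rV[R]_n) : cliff G (u - v) = cliff G u - cliff G v.
Proof.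
rewrite /cliff -sumrB; apply: eq_bigr => a _.
by rewrite !mxE -scalerBl -rmorphB.
Qed.

Lemma cliffZ r (v : 'rV[R]_n) : cliff G (r *: v) = r%:C *: cliff G v.
Proof.
rewrite /cliff scaler_sumr; apply: eq_bigr => a _.
by rewrite mxE scalerA -rmorphM.
Qed.

(** A vector of square - |v|^2 is invertible unless it is zero. *)
Lemma cliff_ker v (x : 'cV[R[i]]_(spin_dim n)) : x != 0 -> cliff G v *m x = 0 -> v = 0.
Proof.
move=> x0 vx; have : cliff G v *m cliff G v *m x = 0 by rewrite -mulmxA vx mulmx0.
rewrite cliff_sq mulNmx mul_scalar_mx => /eqP.
rewrite oppr_eq0 scaler_eq0 (negPf x0) orbF => /eqP/complexI v0.
apply/rowP => a; rewrite mxE; apply/eqP; rewrite -sqrf_eq0; apply/eqP.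
by apply: (psumr_eq0P (fun b _ => sqr_ge0 (v 0 b)) v0).
Qed.

End CliffordVector.

Section Global.
Variables (R : realType) (n : nat) (M : manifold R n) (g : metric M).
Variables (G : spinor_module R n) (S : spin_structure g G).

Section Charts.
Variables (k : triv S) (i : chart M) (p : M).
Hypotheses (kp : triv_dom k p) (ip : dom i p).

Let W := triv_dom k `&` dom i.
Let oW : open W. Proof. by apply: openI; [exact: triv_dom_open|exact: dom_open]. Qed.
Let Wi : W `<=` dom i. Proof. by move=> q []. Qed.
Let Wk : W `<=` dom (ch k). Proof. by move=> q [/triv_dom_dom]. Qed.
Let F_smooth a b : smooth_in i W (fun q => frame k q a b).
Proof.
apply: (smooth_in_change oW Wi Wk); apply: (smooth_inW _ (frame_smooth k a b)).
by move=> q [].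
Qed.
Let F_on q : W q -> frame k q *m gmx g (ch k) q *m (frame k q)^T = 1%:M.
Proof. by move=> [kq _]; exact: frame_orthonormal. Qed.

Lemma scal_triv : Scal g i p = Scal g (ch k) p.
Proof. exact: (scal_change oW Wi Wk F_smooth F_on). Qed.

Lemma ric_triv c : Ric g (ch k) p = c%:M -> Ric g i p = c%:M.
Proof. exact: (ric_scalar_change oW Wi Wk F_smooth F_on). Qed.

End Charts.

Lemma einstein_triv (c : R) : (forall (k : triv S) p,
    triv_dom k p -> Ric g (ch k) p = c%:M) ->
  forall i p, dom i p -> Ric g i p = c%:M.
Proof.
move=> e i p ip; have [k kp] := triv_dom_cover S p.
by apply: (ric_triv kp ip); exact: e.
Qed.

Variables (psi : spinor_field S) (mu : R).
Hypothesis hpsi : ricci_killing_spinor mu psi.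

Let mu0 : mu != 0. Proof. by case: hpsi. Qed.
Let hrk : forall k p (X : 'rV[R]_n), triv_dom k p ->
  spin_nabla psi k p X =
  mu%:C *: (clifford k p (X *m Ric g (ch k) p) *m psi k p).
Proof. by case: hpsi. Qed.

Lemma spinor_triv k l p : triv_dom k p -> triv_dom l p -> psi k p != 0 -> psi l p != 0.
Proof.
move=> kp lp; apply: contraNneq => l0.
by rewrite (spinor_change psi kp lp) l0 mulmx0.
Qed.

Section Form.
Local Notation N := (spin_dim n + spin_dim n)%N.
Variable H : 'M[R]_N.
Hypothesis HT : H^T = H.
Hypothesis cH : forall i, (real_gamma G i)^T *m H = - (H *m real_gamma G i).
Hypothesis Hpos : forall v : 'cV[R]_N, v != 0 -> 0 < (v^T *m H *m v) 0 0.

Lemma spinor_norm_eq0 k p : (spinor_norm psi H k p == 0) = (psi k p == 0).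
Proof.
apply/eqP/eqP => [n0|p0].
  apply/eqP; rewrite -rcol_eq0; apply: contraTT isT => /Hpos.
  by rewrite -[X in _ < X]/(spinor_norm psi H k p) n0 ltxx.
have r0 : real_spinor psi k p = 0 by apply/eqP; rewrite /real_spinor rcol_eq0 p0.
by rewrite /spinor_norm /sqnorm r0 mulmx0 mxE.
Qed.

(** The zeros of [psi] are those of its norm, which is locally constant. *)
Lemma ricci_killing_nonzero k p : triv_dom k p -> psi k p != 0.
Proof.
move=> kp; have [_ [k0 [p0 [kp0 /eqP psi0]]] _] := hpsi.
pose P := [set q : M | forall l : triv S, triv_dom l q -> psi l q != 0].
have PE l q : triv_dom l q -> P q <-> psi l q != 0.
  move=> lq; split; first by apply.
  by move=> pl m mq; exact: (spinor_triv lq mq).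
suff : P p by apply.
apply: (@connected_locally_constant M P p0 p (@manifold_connected _ _ M));
  last exact/(PE k0 p0 kp0).
move=> x; have [l lx] := triv_dom_cover S x.
have nW : nbhs x (triv_dom l) by exact: (open_nbhs_nbhs (conj (@triv_dom_open _ _ _ _ _ S l) lx)).
have nn := spinor_norm_locally_constant hrk HT cH lx.
apply: (@filterS2 _ (nbhs x) _ _ _ _ _ nW nn) => q lq nq.
by rewrite (PE _ _ lq) (PE _ _ lx) -!spinor_norm_eq0 nq.
Qed.

(** Scal is locally constant where [psi] does not vanish, that is everywhere. *)
Lemma scal_constant : exists s, forall i p, dom i p -> Scal g i p = s.
Proof.
have [_ [k0 [p0 [kp0 _]]] _] := hpsi.
exists (Scal g (ch k0) p0) => i p ip; set s := Scal g (ch k0) p0.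
pose P := [set q : M | forall l : triv S, triv_dom l q -> Scal g (ch l) q = s].
have PE (l : triv S) q : triv_dom l q -> P q <-> Scal g (ch l) q = s.
  move=> lq; split; first by apply.
  by move=> e m mq; rewrite -e; apply: (scal_triv lq); exact: triv_dom_dom.
suff Pp : P p by have [k kp] := triv_dom_cover S p; rewrite (scal_triv kp ip) (Pp k kp).
apply: (@connected_locally_constant M P p0 p (@manifold_connected _ _ M));
  last exact/(PE k0 p0 kp0).
move=> x; have [l lx] := triv_dom_cover S x.
have nW : nbhs x (triv_dom l) by exact: (open_nbhs_nbhs (conj (@triv_dom_open _ _ _ _ _ S l) lx)).
have n0 q : triv_dom l q -> spinor_norm psi H l q != 0.
  by rewrite spinor_norm_eq0; exact: ricci_killing_nonzero.
have nn := scal_locally_constant hrk HT cH mu0 n0 lx.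
apply: (@filterS2 _ (nbhs x) _ _ _ _ _ nW nn) => q lq nq.
by rewrite (PE _ _ lq) (PE _ _ lx) nq.
Qed.

Lemma frame_ric_identity (k : triv S) p : triv_dom k p ->
  2^-1 * \tr (frame_ric k p) = mu ^+ 2 *
    (2 * \tr (frame_ric k p) * \tr (frame_ric k p)
     - 2 * \sum_a \sum_b frame_ric k p a b * frame_ric k p b a).
Proof.
move=> kp; rewrite frame_trace; last exact: frame_orthonormal.
apply: (frame_ric_norm hrk HT cH kp).
by rewrite spinor_norm_eq0; exact: ricci_killing_nonzero.
Qed.

End Form.

(** Subtracting the two equations of [psi], the Clifford product of
    mu Ric X - lambda X with [psi] vanishes, so [cliff_ker] applies. *)
Lemma killing_einstein : (forall (k : triv S) p, triv_dom k p -> psi k p != 0) ->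
  killing_spinor psi -> einstein g.
Proof.
move=> psi0 [_ [lambda hk]]; exists (lambda / mu); apply: einstein_triv => k p kp.
have E X := etrans (esym (hrk X kp)) (hk k p X kp).
move: (Ric g (ch k) p) E => Q E.
suff QE : mu *: Q = lambda%:M.
  by rewrite -[LHS](scalerK mu0) QE -scalemx1 scalerA mulrC scalemx1.
have Fg := frame_orthonormal (k := k) kp.
have gF : gmx g (ch k) p *m (frame k p)^T *m frame k p = 1%:M.
  by apply: mulmx1C; rewrite mulmxA.
apply/row_matrixP => a; rewrite !rowE.
set X := delta_mx 0 a; apply/eqP; rewrite -subr_eq0; apply/eqP.
have /(congr1 (fun v => v *m frame k p)) : (X *m (mu *: Q) - X *m lambda%:M)
    *m gmx g (ch k) p *m (frame k p)^T = 0.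
  apply: (cliff_ker (G := G) (psi0 k p kp)).
  have /eqP := E X.
  rewrite -subr_eq0 !scalemxAl -mulmxBl /clifford -!cliffZ -cliffB => /eqP e.
  rewrite -[RHS]e; congr (cliff G _ *m _).
  by rewrite -scalemxAr mul_mx_scalar !mulmxBl -!scalemxAl.
by rewrite mul0mx -!mulmxA [gmx _ _ _ *m _]mulmxA gF mulmx1.
Qed.

Lemma einstein_killing : einstein g -> killing_spinor psi.
Proof.
move=> [c ce]; split; first by case: hpsi.
exists (mu * c) => k p X kp; rewrite (hrk X kp) (ce _ _ (triv_dom_dom kp)).
rewrite mul_mx_scalar /clifford -!scalemxAl cliffZ -scalemxAl scalerA.
by rewrite -rmorphM.
Qed.

End Global.

(** * The theorem *)

Theorem theorem1 (R : realType) (n : nat) (hn : (2 <= n)%N)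
    (M : manifold R n) (g : metric M) (G : spinor_module R n)
    (S : spin_structure g G) (psi : spinor_field S) (mu : R)
    (hpsi : ricci_killing_spinor mu psi) :
  exists s : R,
    [/\ forall i p, dom i p -> Scal g i p = s,
        s = 0 -> ricci_flat g /\ parallel_spinor psi
      & s <> 0 ->
        [/\ n%:R / (4 * (n%:R - 1) * s) <= mu ^+ 2,
            mu ^+ 2 = n%:R / (4 * (n%:R - 1) * s) <-> einstein g
          & einstein g <-> killing_spinor psi]].
Proof.
have [mu0 [k0 [p0 [kp0 _]]] hrk] := hpsi.
have [H [HT cH Hpos]] := invariant_form (real_gamma_clifford G).
have [s scalE] := scal_constant hpsi HT cH Hpos.
have psi0 := ricci_killing_nonzero hpsi HT cH Hpos.
have n_gt0 : (0 < n)%N by exact: ltnW.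
have Q_norm (k : triv S) p (kp : triv_dom k p) := frame_ric_identity hpsi HT cH Hpos kp.
have QC (k : triv S) p (kp : triv_dom k p) a b : frame_ric k p a b = frame_ric k p b a :=
  frame_ric_sym a b kp.
have trQ (k : triv S) p : triv_dom k p -> \tr (frame_ric k p) = s.
  move=> kp; rewrite frame_trace; last exact: frame_orthonormal.
  exact: (scalE _ _ (triv_dom_dom kp)).
have ricE (k : triv S) p c : triv_dom k p -> frame_ric k p = c%:M <-> Ric g (ch k) p = c%:M.
  by move=> kp; apply: frame_scalar; exact: frame_orthonormal.
exists s; split=> //.
  move=> s0; have ric0 (k : triv S) p : triv_dom k p -> Ric g (ch k) p = 0%:M.
    move=> kp; apply/(ricE _ _ _ kp).
    rewrite raddf0; apply: (scal0_ricci0 n_gt0 (QC k p kp) mu0 (Q_norm k p kp)).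
    by rewrite trQ.
  split=> [i p ip|k p X kp].
    by rewrite (einstein_triv ric0 ip) raddf0.
  rewrite hrk // ric0 // raddf0 mulmx0 /clifford !mul0mx.
  by rewrite -[0 : 'rV_n](scale0r 0) cliffZ !scale0r mul0mx scaler0.
move=> /eqP s0.
have s0' (k : triv S) p (kp : triv_dom k p) : \tr (frame_ric k p) != 0 by rewrite trQ.
have bound (k : triv S) p (kp : triv_dom k p) :=
  scalar_bound n_gt0 (QC k p kp) (Q_norm k p kp) hn (s0' k p kp).
have bound_eq (k : triv S) p (kp : triv_dom k p) :=
  scalar_bound_eq n_gt0 (QC k p kp) mu0 (Q_norm k p kp) hn (s0' k p kp).
split.
- by have := bound k0 p0 kp0; rewrite trQ.
- split=> [e|[c ce]].
    exists (s / n%:R); apply: einstein_triv => k p kp.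
    by apply/(ricE _ _ _ kp); have [+ _] := bound_eq k p kp; rewrite !trQ //; apply.
  have [_] := bound_eq k0 p0 kp0; rewrite trQ //; apply.
  have ec := ce _ _ (triv_dom_dom kp0).
  have -> : s / n%:R = c.
    rewrite -(scalE _ _ (triv_dom_dom kp0)) /Scal ec mxtrace_scalar -[c *+ n]mulr_natr mulfK //.
    by rewrite pnatr_eq0 -lt0n.
  exact/(ricE _ _ _ kp0).
- by split; [exact: (einstein_killing hpsi)|exact: (killing_einstein hpsi psi0)].
Qed.
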